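(* Let $\mathcal{D}=\{d_1,\dots,d_D\}$ be a collection of $D$ strings (documents) of total length $n$. There exists an index of size $O(n\log n)$ bits that, given a query pattern $P$ of length $p$ and an integer $k$, answers the top-$k$ document retrieval query for $P$ in $O(p + \log^2\log n + k\log\log\log n + k\log k)$ time.
   Context: Computation model: word RAM with words of $\Theta(\log n)$ bits. A top-$k$ document retrieval query with pattern $P$ asks to report, in decreasing order of relevance, the $k$ documents containing $P$ with the highest relevance score $score(P,d)$, where the relevance score of $d$ with respect to $P$ depends only on $d$ and the set of occurrences of $P$ in $d$ (e.g. the term frequency, the number of occurrences of $P$ in $d$). *)

(* Defs.v *)
From mathcomp Require Import all_boot all_order.

Set Implicit Arguments.
Unset Strict Implicit.
Unset Printing Implicit Defensive.

(* The binary logarithm rounded up, with lg 0 = lg 1 = 0. *)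
Definition lg (x : nat) : nat := up_log 2 x.

(** * Word RAM

    A word of [w] bits is a natural number below [2 ^ w].  The machine has
    registers, a random-access memory addressed by words, random access to a
    read-only input array (the query pattern) and a write-only output stream;
    every instruction costs one time unit.  A program is a finite list of
    instructions, so it uses finitely many registers, and it does not depend
    on [w]. *)

Inductive binop :=
  Add | Sub | Mul | Div | Mod | And | Or | Xor | Shl | Shr | Less | Equal.

Definition eval_binop (w : nat) (op : binop) (x y : nat) : nat :=
  match op with
  | Add => x + y
  | Sub => x + (2 ^ w - y)
  | Mul => x * y
  | Div => x %/ y
  | Mod => x %% y
  | And => Nat.land x y
  | Or => Nat.lor x y
  | Xor => Nat.lxor x y
  | Shl => x * 2 ^ y
  | Shr => x %/ 2 ^ y
  | Less => x < y
  | Equal => x == y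
  end %% 2 ^ w.

Inductive instr :=
  | Const (d c : nat)                 (* R[d] := c            *)
  | Bin (op : binop) (d x y : nat)    (* R[d] := R[x] op R[y] *)
  | Read (d a : nat)                  (* R[d] := M[R[a]]      *)
  | Write (a s : nat)                 (* M[R[a]] := R[s]      *)
  | Input (d i : nat)                 (* R[d] := P[R[i]]      *)
  | Emit (s : nat)                    (* output R[s]          *)
  | Jz (r l : nat)                    (* if R[r] = 0 goto l   *)
  | Halt.

Definition program := seq instr.

Record config := Config {
  pc : nat;
  regs : nat -> nat;
  memory : nat -> nat;
  output : seq nat
}.

(* Running past the end of the program halts. *)
Definition halted (prog : program) (c : config) : Prop :=
  nth Halt prog (pc c) = Halt.

Definition step (w : nat) (prog : program) (P : seq nat) (c : config) :
    config :=
  let: Config l R M o := c in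
  match nth Halt prog l with
  | Const d v => Config l.+1 [eta R with d |-> v %% 2 ^ w] M o
  | Bin op d x y =>
      Config l.+1 [eta R with d |-> eval_binop w op (R x) (R y)] M o
  | Read d a => Config l.+1 [eta R with d |-> M (R a)] M o
  | Write a s => Config l.+1 R [eta M with R a |-> R s] o
  | Input d i => Config l.+1 [eta R with d |-> nth 0 P (R i)] M o
  | Emit s => Config l.+1 R M (rcons o (R s))
  | Jz r l' => Config (if R r == 0 then l' else l.+1) R M o
  | Halt => c
  end.

(* On a query, register 0 holds k, register 1 holds the pattern length, and
   the other registers are cleared. *)
Definition init (P : seq nat) (k : nat) (M : nat -> nat) : config :=
  Config 0 [eta (fun=> 0) with 0 |-> k, 1 |-> size P] M [::].

Definition all_words (w : nat) (s : seq nat) : Prop :=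
  {in s, forall x, x < 2 ^ w}.

Definition stores (idx : seq nat) (M : nat -> nat) : Prop :=
  forall a, a < size idx -> M a = nth 0 idx a.

(* The memory outside the index has arbitrary initial contents, so that all
   the precomputed information is in the index; the query leaves the index
   intact, so that it can be queried again. *)
Definition answers_within (w : nat) (prog : program) (idx P : seq nat)
    (k time : nat) (correct : seq nat -> Prop) : Prop :=
  forall M : nat -> nat, (forall a, M a < 2 ^ w) -> stores idx M ->
  exists2 t, t <= time &
    let c := iter t (step w prog P) (init P k M) in
    [/\ halted prog c, stores idx (memory c) & correct (output c)].

(** * Top-k document retrieval

    Characters are natural numbers, and the documents are indexed by
    ['I_D]. *)

(* The set of starting positions of the occurrences of [P] in [d]. *)
Definition occ (d P : seq nat) : {set 'I_(size d).+1} :=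
  [set j : 'I_(size d).+1 | prefix P (drop j d)].

Definition total_length (D : nat) (docs : 'I_D -> seq nat) : nat :=
  \sum_(i < D) size (docs i).

Definition containing (D : nat) (docs : 'I_D -> seq nat) (P : seq nat) :
    {set 'I_D} :=
  [set i | occ (docs i) P != set0].

(* [score P i] depends only on document [i] and on the set of occurrences of
   [P] in it; only the comparison of scores matters, so they may be taken in
   any totally ordered type. *)
Definition relevance_score (D : nat) (docs : 'I_D -> seq nat)
    (disp : Order.disp_t) (T : orderType disp)
    (score : seq nat -> 'I_D -> T) : Prop :=
  forall (i : 'I_D) (P Q : seq nat),
    occ (docs i) P = occ (docs i) Q -> score P i = score Q i.

(* [o] lists k documents containing [P] of highest score (all of them when
   there are fewer than k) by decreasing score; ties are broken arbitrarily. *)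
Definition is_topk (D : nat) (docs : 'I_D -> seq nat)
    (disp : Order.disp_t) (T : orderType disp)
    (score : seq nat -> 'I_D -> T) (P : seq nat) (k : nat)
    (o : seq nat) : Prop :=
  exists2 s : seq 'I_D, o = [seq val i | i <- s] &
  [/\ uniq s,
      {subset s <= containing docs P},
      size s = minn k #|containing docs P|,
      sorted (fun i j => score P j <= score P i)%O s &
      forall i j, i \in s -> j \in containing docs P -> j \notin s ->
        (score P j <= score P i)%O].

(* Main.v *)
(* A locus is a nonempty set of text positions whose suffixes share a given
   prefix; the loci are the nodes of the suffix tree, at most 2n in number.  If V
   is the locus of P, then the part of V that lies in a document d is a node of
   the suffix tree of d, called a link, and it determines the score of P in d.
   Following Hon, Shah and Vitter, the links that meet V are grouped by the
   smallest depth at which they occur.  The links of a group are those whose key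
   "depth, then string" extends a given one, so they form an interval in the
   lexicographic order of all links, and V has at most p + 1 groups.  The query
   thus asks for the k largest ranks in p + 1 intervals of one array: constant
   time range maxima and a tournament tree over the intervals, each extraction
   splitting an interval in two, take O(p + k log (p + k)) = O(p + k log k) time.

   The groups of all loci do not fit in linear space.  Instead the suffix tree is
   divided into regions, each storing one list of groups, such that the list of
   the region of V contains the groups of V and has length O(p); a group in the
   list belongs to V if and only if an occurrence position and a depth fall into
   the right ranges.

   The locus is found by descending the suffix tree, whose children are stored
   in perfect hash tables with multiply-shift functions, skipping all but the
   first characters of the edges and checking P against the text at the end. *)

Require Import Defs.
From mathcomp Require Import all_boot all_order.
From mathcomp Require Import zify.

Set Implicit Arguments.
Unset Strict Implicit.
Unset Printing Implicit Defensive.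

(** The score of [P] in a document depends only on its occurrences there, and these are also the
    occurrences of the longest string of the link that [P] crosses. So all links are ranked once, by
    a weight that does not mention [P].

    The obstacle is space, as a group may belong to many loci. Two loci with a common group are
    nested, and every locus between them has the group too; hence only the smallest of them has no
    child with the group, and it is said to own it. There are O(n) owned groups in all. A locus
    takes over the lists of its children while the total stays within three times the bound
    [minlen + 1] on the number of its groups. Beyond that it restarts from its own groups, fewer
    than a third of the total, and this drop pays for storing the lists of the children.

    The same chains without gaps justify the membership test: a group belongs to a locus if and only
    if a fixed position of the group lies in the locus and the depth of the locus is between those
    of the largest and the smallest locus with that group. *)

Module Machine.

(** * A structured language with a clock, compiled to the word RAM *)

Inductive arith := AddO | SubO | MulO | WrapMulO | DivO | ModO | ShrO | LtO | EqO.

Definition arith_binop (o : arith) : binop :=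
  match o with
  | AddO => Add | SubO => Defs.Sub | MulO | WrapMulO => Mul | DivO => Div
  | ModO => Mod | ShrO => Shr | LtO => Less | EqO => Equal
  end.

Inductive expr :=
  | K of nat
  | V of nat
  | Ar of arith & expr & expr
  | Ld of nat & expr
  | In of expr.

Inductive cmd :=
  | Set_ of nat & expr
  | St of nat & expr & expr
  | Out of expr
  | Seq of cmd & cmd
  | If of expr & cmd & cmd
  | While of expr & cmd.

(* The memory is seen as a table: the cell in column [c] and row [r] has
   address [r * ncol + c]. *)
Definition ncol := 40.
(* Registers from [tmp] on hold intermediate results. *)
Definition tmp := 40.

Record state := State {
  env : nat -> nat;
  cells : nat -> nat -> nat;
  out : seq nat;
  time : nat
}.

(** Registers and columns are literals, and [Nat.eqb] lets lookups reduce by computation; rows are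
    symbolic and are compared by [==]. *)
Definition upd (f : nat -> nat) (d v : nat) : nat -> nat :=
  fun x => if Nat.eqb x d then v else f x.

Definition mupd (m : nat -> nat -> nat) (c r v : nat) : nat -> nat -> nat :=
  fun c' r' => if Nat.eqb c' c then (if r' == r then v else m c' r')
               else m c' r'.

Section Semantics.
Variables (w : nat) (P : seq nat).

Definition ideal (o : arith) (x y : nat) : nat :=
  match o with
  | AddO => x + y
  | SubO => x - y
  | MulO => x * y
  | WrapMulO => (x * y) %% 2 ^ w
  | DivO => x %/ y
  | ModO => x %% y
  | ShrO => x %/ 2 ^ y
  | LtO => x < y
  | EqO => x == y
  end.

(** Sufficient for the wrapping instruction to agree with [ideal]. [WrapMulO] is the product of the
    hash functions, which is meant to wrap. *)
Definition safe (o : arith) (x y : nat) : Prop :=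
  match o with
  | AddO => x + y < 2 ^ w
  | SubO => y <= x
  | MulO => x * y < 2 ^ w
  | _ => True
  end.

Fixpoint ev (st : state) (e : expr) : nat :=
  match e with
  | K c => c
  | V x => env st x
  | Ar o a b => ideal o (ev st a) (ev st b)
  | Ld c a => cells st c (ev st a)
  | In a => nth 0 P (ev st a)
  end.

Fixpoint ok (st : state) (e : expr) : Prop :=
  match e with
  | K c => c < 2 ^ w
  | V x => True
  | Ar o a b => [/\ ok st a, ok st b & safe o (ev st a) (ev st b)]
  | Ld c a => ok st a /\ ev st a * ncol + c < 2 ^ w
  | In a => ok st a
  end.

Fixpoint ecost (e : expr) : nat :=
  match e with
  | K _ | V _ => 1
  | Ar _ a b => ecost a + ecost b + 1
  | Ld _ a => ecost a + 5
  | In a => ecost a + 1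
  end.

(** Total correctness with a clock: the invariant of [While] carries a counter that every iteration
    decreases. Besides the evaluation of the test, a conditional or a loop costs 3 where the body is
    followed by an unconditional jump, and 1 where only [Jz] is executed. *)
Fixpoint wp (c : cmd) (Q : state -> Prop) (st : state) : Prop :=
  let: State e m o t := st in
  match c with
  | Set_ d a => ok st a /\ Q (State (upd e d (ev st a)) m o (t + (ecost a + 1)))
  | St c a b =>
      [/\ ok st a, ok st b, ev st a * ncol + c < 2 ^ w &
       Q (State e (mupd m c (ev st a) (ev st b)) o (t + (ecost a + ecost b + 5)))]
  | Out a => ok st a /\ Q (State e m (rcons o (ev st a)) (t + (ecost a + 1)))
  | Seq a b => wp a (wp b Q) st
  | If a b1 b2 =>
      ok st a /\
      if ev st a is _.+1 then wp b1 Q (State e m o (t + (ecost a + 3)))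
      else wp b2 Q (State e m o (t + (ecost a + 1)))
  | While a b =>
      exists2 Inv : nat -> state -> Prop, (exists k, Inv k st) &
      forall k st', Inv k st' ->
        ok st' a /\
        let: State e' m' o' t' := st' in
        if ev st' a is _.+1 then
          exists2 k', k = k'.+1 & wp b (Inv k') (State e' m' o' (t' + (ecost a + 3)))
        else Q (State e' m' o' (t' + (ecost a + 1)))
  end.

Lemma wp_mono (c : cmd) (Q Q' : state -> Prop) (st : state) :
  (forall s, Q s -> Q' s) -> wp c Q st -> wp c Q' st.
Proof.
elim: c Q Q' st => [d a|c a b|a|c1 IH1 c2 IH2|a c1 IH1 c2 IH2|a c IH] Q Q' [e m o t] QQ' /=.
- by case=> ? /QQ'.
- by case=> ? ? ? /QQ'.
- by case=> ? /QQ'.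
- by apply: IH1 => s; apply: IH2.
- by case=> ?; case: (ev _ _) => [|x] H; split => //; [apply: IH2 H | apply: IH1 H].
- case=> Inv Hk HI; exists Inv => // k [e' m' o' t'] /HI [oka H]; split=> //.
  by case: (ev _ _) H => // /QQ'.
Qed.

Fixpoint wfe (e : expr) : bool :=
  match e with
  | K _ => true
  | V x => x < tmp
  | Ar _ a b => wfe a && wfe b
  | Ld c a => (c < ncol) && wfe a
  | In a => wfe a
  end.

Fixpoint wfc (c : cmd) : bool :=
  match c with
  | Set_ d a => (d < tmp) && wfe a
  | St c a b => [&& c < ncol, wfe a & wfe b]
  | Out a => wfe a
  | Seq a b => wfc a && wfc b
  | If a b c => [&& wfe a, wfc b & wfc c]
  | While a b => wfe a && wfc b
  end.

(** Registers from [t] on are an evaluation stack; [Or] of a register with itself is a move. *)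
Fixpoint ecode (e : expr) (t : nat) : program :=
  match e with
  | K c => [:: Const t c]
  | V x => [:: Bin Or t x x]
  | Ar o a b => ecode a t ++ ecode b t.+1 ++ [:: Bin (arith_binop o) t t t.+1]
  | Ld c a => ecode a t ++ [:: Const t.+1 ncol; Bin Mul t t t.+1;
                              Const t.+1 c; Bin Add t t t.+1; Read t t]
  | In a => ecode a t ++ [:: Input t t]
  end.

(** Jumps are absolute, so the code depends on its address [l]. Loading 0 before [Jz] makes the jump
    unconditional. *)
Fixpoint comp (c : cmd) (l : nat) : program :=
  match c with
  | Set_ d a => ecode a tmp ++ [:: Bin Or d tmp tmp]
  | St c a b => ecode a tmp ++ ecode b tmp.+1 ++
      [:: Const tmp.+2 ncol; Bin Mul tmp tmp tmp.+2; Const tmp.+2 c;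
          Bin Add tmp tmp tmp.+2; Write tmp tmp.+1]
  | Out a => ecode a tmp ++ [:: Emit tmp]
  | Seq a b => comp a l ++ comp b (l + size (comp a l))
  | If a b c =>
      let la := l + size (ecode a tmp) + 1 in
      let cb := comp b la in
      let lc := la + size cb + 2 in
      let cc := comp c lc in
      ecode a tmp ++ [:: Jz tmp lc] ++ cb ++
      [:: Const tmp 0; Jz tmp (lc + size cc)] ++ cc
  | While a b =>
      let la := l + size (ecode a tmp) + 1 in
      let cb := comp b la in
      ecode a tmp ++ [:: Jz tmp (la + size cb + 2)] ++ cb ++
      [:: Const tmp 0; Jz tmp l]
  end.

Variable prog : program.
Hypothesis w_gt0 : 0 < w.
Hypothesis P_words : forall x, nth 0 P x < 2 ^ w.

Definition at_ (l : nat) (c : program) : Prop :=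
  forall i, i < size c -> nth Halt prog (l + i) = nth Halt c i.

Lemma at_cat l (c1 c2 : program) :
  at_ l (c1 ++ c2) -> at_ l c1 /\ at_ (l + size c1) c2.
Proof.
move=> H; split=> i Hi.
  by rewrite H ?size_cat ?nth_cat ?Hi //; lia.
by rewrite -addnA H ?size_cat ?nth_cat; [rewrite ltnNge leq_addr /= addKn | lia].
Qed.

Lemma at_cons l (i : instr) (c : program) :
  at_ l (i :: c) -> nth Halt prog l = i /\ at_ l.+1 c.
Proof.
move=> H; split; first by rewrite -[l]addn0 (H 0).
by move=> j Hj; rewrite addSnnS (H j.+1).
Qed.

Definition regs_ok (R : nat -> nat) := forall x, R x < 2 ^ w.

Definition sim (st : state) (c : config) : Prop :=
  [/\ forall x, x < tmp -> regs c x = env st x,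
      forall k r, k < ncol -> memory c (r * ncol + k) = cells st k r,
      output c = out st,
      regs_ok (regs c) & regs_ok (memory c)].

Notation stepP := (step w prog P).
Notation steps t c c' := (iter t stepP c = c').

Lemma steps_cat t1 t2 (a b c : config) :
  steps t1 a b -> steps t2 b c -> steps (t1 + t2) a c.
Proof. by move=> <- <-; rewrite addnC iterD. Qed.

Lemma W_gt0 : 0 < 2 ^ w. Proof. by rewrite expn_gt0. Qed.

Lemma upd_ok (R : nat -> nat) d v :
  regs_ok R -> v < 2 ^ w -> regs_ok [eta R with d |-> v].
Proof. by move=> HR Hv x /=; case: ifP. Qed.

Lemma ltn_modW x : x %% 2 ^ w < 2 ^ w.
Proof. by rewrite ltn_mod W_gt0. Qed.

Lemma eval_ideal (o : arith) x y :
  x < 2 ^ w -> y < 2 ^ w -> safe o x y ->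
  eval_binop w (arith_binop o) x y = ideal o x y.
Proof.
move=> Hx Hy; rewrite /eval_binop; case: o => /= H.
- exact: modn_small.
(* The machine adds the complement [2 ^ w - y]; since [y <= x], the sum exceeds [x - y] by exactly
   [2 ^ w]. *)
- by rewrite addnBA ?(ltnW Hy) // addnC -addnBA // modnDl modn_small //; lia.
- exact: modn_small.
- by [].
- by rewrite modn_small // (leq_ltn_trans (leq_div _ _) Hx).
- by rewrite modn_small // (leq_ltn_trans (leq_mod _ _) Hx).
- by rewrite modn_small // (leq_ltn_trans (leq_div _ _) Hx).
- by rewrite modn_small //; case: (x < y) => /=; rewrite ?W_gt0 // (@ltn_exp2l 2 0 w).
- by rewrite modn_small //; case: (x == y) => /=; rewrite ?W_gt0 // (@ltn_exp2l 2 0 w).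
Qed.

Lemma ideal_lt (o : arith) x y :
  x < 2 ^ w -> y < 2 ^ w -> safe o x y -> ideal o x y < 2 ^ w.
Proof. by move=> Hx Hy H; rewrite -eval_ideal // ltn_modW. Qed.

Lemma lorxx x : Nat.lor x x = x.
Proof. exact: PeanoNat.Nat.lor_diag. Qed.

Lemma size_ecode (e : expr) t : size (ecode e t) = ecost e.
Proof.
elim: e t => [c|x|o a IHa b IHb|c a IHa|a IHa] t //=; rewrite !size_cat ?IHa ?IHb //=.
by rewrite addnA.
Qed.

(** Preservation of the registers below [t] lets the first operand wait in [t] while the second is
    evaluated in [t.+1]. *)
Lemma ecode_sound (e : expr) t l (st : state) (R M : nat -> nat) (o : seq nat) :
  at_ l (ecode e t) -> tmp <= t -> wfe e -> sim st (Config l R M o) -> ok st e ->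
  exists R', [/\ steps (ecost e) (Config l R M o) (Config (l + ecost e) R' M o),
    R' t = ev st e, forall x, x < t -> R' x = R x & regs_ok R'].
Proof.
elim: e t l R => [c|x|op a IHa b IHb|c a IHa|a IHa] t l R.
- move=> /at_cons [Hc _] Ht _ [_ _ _ HR HM] okc; rewrite /= in HR HM.
  exists [eta R with t |-> c]; split=> /=; rewrite ?eqxx //.
  + by rewrite Hc addn1 modn_small.
  + by move=> y Hy; rewrite ltn_eqF.
  + exact: upd_ok.
- move=> /at_cons [Hc _] Ht Hx [HE _ _ HR HM] _; rewrite /= in HR HM HE Hx.
  exists [eta R with t |-> R x]; split=> /=; rewrite ?eqxx ?HE //.
  + by rewrite Hc addn1 /eval_binop /= lorxx -HE // modn_small //; apply: HR.
  + by move=> y Hy; rewrite ltn_eqF.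
  + by apply: upd_ok => //; rewrite -HE //; apply: HR.
- move=> /at_cat [Ca] /at_cat [Cb] /at_cons [Co _] Ht /= /andP[wa wb] S [oka okb sf].
  have [R1 [s1 v1 k1 ok1]] := IHa _ _ _ Ca Ht wa S oka.
  rewrite !size_ecode in Cb Co.
  have S1 : sim st (Config (l + ecost a) R1 M o).
    case: S => /= HE ? ? ? ?; split=> //= y Hy.
    by rewrite k1 ?(leq_trans Hy) // HE.
  have [R2 [s2 v2 k2 ok2]] := IHb _ _ _ Cb (leqW Ht) wb S1 okb.
  have e1 : R2 t = ev st a by rewrite k2.
  exists [eta R2 with t |-> ideal op (ev st a) (ev st b)]; split=> /=; rewrite ?eqxx //.
  + apply: steps_cat (steps_cat s1 s2) _ => /=.
    by rewrite Co !addnA addn1 -e1 -v2 eval_ideal // e1 v2.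
  + by move=> y Hy; rewrite ltn_eqF // k2 ?k1 // ltnW.
  + by apply: upd_ok => //; rewrite -e1 -v2; apply: ideal_lt => //; rewrite e1 v2.
- move=> /at_cat [Ca] C Ht /= /andP[wc wa] S [oka okb].
  have [R1 [s1 v1 k1 ok1]] := IHa _ _ _ Ca Ht wa S oka.
  rewrite !size_ecode in C.
  have [C1 {}/at_cons [C2 /at_cons [C3 /at_cons [C4 /at_cons [C5 _]]]]] := at_cons C.
  case: S => /= HE HM Ho HR HMo.
  (* [Const] truncates [ncol]. This is harmless: for a nonzero row the address bound forces
     [ncol < 2 ^ w], and row 0 annihilates the factor. *)
  have Hn : ncol < 2 ^ w \/ ev st a = 0.
    by case: (ev st a) okb => [|y]; [right | left; nia].
  have tS : (t.+1 == t) = false by apply/eqP; lia.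
  have tS' : (t == t.+1) = false by apply/eqP; lia.
  eexists; split.
  + apply: steps_cat s1 _ => /=; rewrite C1 /= C2 /= C3 /= C4 /= C5 /=.
    by rewrite !addnS addn0.
  + rewrite /= ?eqxx ?tS ?tS' /= ?eqxx ?tS ?tS' /= -?HM // v1 /eval_binop /=; congr M.
    have -> : (ev st a * (ncol %% 2 ^ w)) %% 2 ^ w = ev st a * ncol.
      case: Hn => [Hn|->]; last by rewrite mod0n.
      by rewrite [ncol %% _]modn_small // modn_small //; lia.
    by rewrite modnDmr modn_small.
  + by move=> y Hy /=; rewrite (ltn_eqF Hy) (ltn_eqF (leqW Hy)) k1.
  + by repeat (apply: upd_ok; last by [exact: ltn_modW | exact: HMo]).
- move=> /at_cat [Ca] /at_cons [Co _] Ht /= wa S oka.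
  have [R1 [s1 v1 k1 ok1]] := IHa _ _ _ Ca Ht wa S oka.
  rewrite !size_ecode in Co.
  exists [eta R1 with t |-> nth 0 P (ev st a)]; split=> /=; rewrite ?eqxx //.
  + by apply: steps_cat s1 _ => /=; rewrite Co !addnA addn1 -v1.
  + by move=> y Hy; rewrite ltn_eqF // k1.
  + exact: upd_ok.
Qed.

Lemma addr_inj r r' c c' :
  c < ncol -> c' < ncol -> r * ncol + c = r' * ncol + c' -> r = r' /\ c = c'.
Proof. by rewrite /ncol; lia. Qed.

Lemma wp_sound (c : cmd) l (st : state) (R M : nat -> nat) (o : seq nat)
    (Q : state -> Prop) :
  at_ l (comp c l) -> wfc c -> sim st (Config l R M o) -> wp c Q st ->
  exists t R' M' o' st', [/\
    steps t (Config l R M o) (Config (l + size (comp c l)) R' M' o'),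
    sim st' (Config (l + size (comp c l)) R' M' o'), time st' = time st + t & Q st'].
Proof.
elim: c l st R M o Q => [d a|k a b|a|c1 IH1 c2 IH2|a c1 IH1 c2 IH2|a c IH] l st R M o Q.
- move=> /at_cat [Ca] /at_cons [Co _] /= /andP[wd wa] S.
  case: st S => e m o0 t S [oka HQ].
  have [R1 [s1 v1 k1 ok1]] := ecode_sound Ca (leqnn _) wa S oka.
  rewrite size_ecode in Co.
  case: S => /= HE HM Ho HR HMo.
  have v1W := ok1 tmp; rewrite v1 in v1W.
  exists (ecost a + 1), [eta R1 with d |-> ev (State e m o0 t) a], M, o.
  exists (State (upd e d (ev (State e m o0 t) a)) m o0 (t + (ecost a + 1))).
  rewrite size_cat size_ecode /=; split=> //.
  + by apply: steps_cat s1 _ => /=; rewrite Co addnA addn1 v1 /eval_binop /= lorxx modn_small.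
  + split=> //=; last exact: upd_ok.
    move=> x Hx; rewrite /upd; case: eqP => [->|]; first by rewrite PeanoNat.Nat.eqb_refl.
    by move=> /PeanoNat.Nat.eqb_neq ->; rewrite k1 // HE.
- move=> /at_cat [Ca] /at_cat [Cb] C /= /and3P[wk wa wb] S.
  case: st S => e m o0 t S [oka okb okc HQ].
  have [R1 [s1 v1 k1 ok1]] := ecode_sound Ca (leqnn _) wa S oka.
  rewrite !size_ecode in Cb C.
  have S1 : sim (State e m o0 t) (Config (l + ecost a) R1 M o).
    case: S => /= HE ? ? ? ?; split=> //= y Hy.
    by rewrite k1 // HE.
  have [R2 [s2 v2 k2 ok2]] := ecode_sound Cb (leqnSn _) wb S1 okb.
  have e1 : R2 tmp = ev (State e m o0 t) a by rewrite k2.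
  have [C1 {}/at_cons [C2 /at_cons [C3 /at_cons [C4 /at_cons [C5 _]]]]] := at_cons C.
  case: S => /= HE HM Ho HR HMo.
  have Hn : ncol < 2 ^ w \/ ev (State e m o0 t) a = 0.
    by case: (ev _ a) okc => [|y]; [right | left; nia].
  have Hadr : ((ev (State e m o0 t) a * (ncol %% 2 ^ w)) %% 2 ^ w + k %% 2 ^ w) %% 2 ^ w
      = ev (State e m o0 t) a * ncol + k.
    rewrite modnDmr; have -> : (ev (State e m o0 t) a * (ncol %% 2 ^ w)) %% 2 ^ w =
      ev (State e m o0 t) a * ncol; last by rewrite modn_small.
    case: Hn => [Hn|->]; last by rewrite mod0n.
    by rewrite [ncol %% _]modn_small // modn_small //; lia.
  have -> : l + size (comp (St k a b) l) = (l + ecost a + ecost b).+4.+1.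
    by rewrite /= !size_cat !size_ecode /=; lia.
  exists (ecost a + ecost b + 5); do 4 eexists; split; last exact: HQ.
  + apply: steps_cat (steps_cat s1 s2) _ => /=.
    by rewrite C1 /= C2 /= C3 /= C4 /= C5 /=.
  + rewrite /eval_binop /= e1 v2 Hadr; split=> //=.
    * move=> x Hx.
      by rewrite (ltn_eqF Hx) (ltn_eqF (leqW (leqW Hx))) (k2 _ (leqW Hx)) (k1 _ Hx) HE.
    * move=> k' r Hk'; rewrite /mupd.
      case: eqP => [/(addr_inj Hk' wk) [-> ->]|Hne].
        by rewrite PeanoNat.Nat.eqb_refl eqxx.
      case: PeanoNat.Nat.eqb_spec => [ek|_]; last exact: HM.
      by case: eqP => [er|_]; [case: Hne; rewrite ek er | rewrite HM].
    * by move=> x /=; repeat (case: ifP => _); rewrite ?ltn_modW //.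
    * by apply: upd_ok => //; have := ok2 tmp.+1; rewrite v2.
  + by [].
- move=> /at_cat [Ca] /at_cons [Co _] /= wa S.
  case: st S => e m o0 t S [oka HQ].
  have [R1 [s1 v1 k1 ok1]] := ecode_sound Ca (leqnn _) wa S oka.
  rewrite size_ecode in Co.
  case: S => /= HE HM Ho HR HMo.
  exists (ecost a + 1); do 4 eexists; split; last exact: HQ.
  + apply: steps_cat s1 _ => /=; rewrite Co size_cat size_ecode /= addnA addn1 v1.
    by [].
  + by split=> //=; [move=> x Hx; rewrite k1 ?HE | rewrite Ho].
  + by [].
- move=> /at_cat [C1 C2] /= /andP[w1 w2] S.
  case: st S => e m o0 t S H.
  have [t1 [R1 [M1 [o1 [st1 [s1 S1 T1 H1]]]]]] := IH1 _ _ _ _ _ _ C1 w1 S H.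
  have [t2 [R2 [M2 [o2 [st2 [s2 S2 T2 H2]]]]]] := IH2 _ _ _ _ _ _ C2 w2 S1 H1.
  exists (t1 + t2), R2, M2, o2, st2; rewrite size_cat addnA; split=> //.
  + exact: steps_cat s1 s2.
  + by rewrite T2 T1 addnA.
- move=> /at_cat [Ca] /at_cat [/at_cons [Cj _]] /at_cat [C1].
  move=> /at_cat [/at_cons [Cz /at_cons [Cj2 _]] C2] /= /and3P[wa w1 w2] S.
  rewrite !size_ecode /= in Cj C1 Cz Cj2 C2.
  case: st S => e m o0 t S [oka H].
  have [R1 [s1 v1 k1 ok1]] := ecode_sound Ca (leqnn _) wa S oka.
  rewrite !size_cat /= !size_cat size_ecode /=.
  set la := l + ecost a + 1 in Cj C1 Cz Cj2 C2 *.
  set lc := la + size (comp c1 la) + 2 in Cj Cz Cj2 C2 *.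
  have -> : l + (ecost a + (size (comp c1 la) + (size (comp c2 lc)).+2).+1) =
     lc + size (comp c2 lc) by rewrite /lc /la; lia.
  case E: (ev _ a) H v1 => [|x] H v1.
  + have S1 : sim (State e m o0 (t + (ecost a + 1))) (Config lc R1 M o).
      by case: S => /= HE HM Ho HR HMo; split=> //= y Hy; rewrite k1 ?HE.
    have C2' : at_ lc (comp c2 lc).
      by move=> i Hi; rewrite -C2 //; congr nth; rewrite /lc /la; lia.
    have [t2 [R2 [M2 [o2 [st2 [s2 S2 T2 H2]]]]]] := IH2 _ _ _ _ _ _ C2' w2 S1 H.
    exists (ecost a + 1 + t2), R2, M2, o2, st2; split=> //; last by rewrite T2 /=; lia.
    apply: steps_cat s2; apply: steps_cat s1 _ => /=.
    by rewrite Cj v1 /=.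
  + have S1 : sim (State e m o0 (t + (ecost a + 3))) (Config la R1 M o).
      by case: S => /= HE HM Ho HR HMo; split=> //= y Hy; rewrite k1 ?HE.
    have [t2 [R2 [M2 [o2 [st2 [s2 S2 T2 H2]]]]]] := IH1 _ _ _ _ _ _ C1 w1 S1 H.
    have sj : steps (ecost a + 1) (Config l R M o) (Config la R1 M o).
      by apply: steps_cat s1 _ => /=; rewrite Cj v1 /= /la addn1.
    have sz : steps 2 (Config (la + size (comp c1 la)) R2 M2 o2)
       (Config (lc + size (comp c2 lc)) [eta R2 with tmp |-> 0] M2 o2).
      rewrite /= Cz /= Cj2 /= mod0n eqxx; congr Config.
    exists (ecost a + 1 + t2 + 2), [eta R2 with tmp |-> 0], M2, o2, st2; split=> //.
    * exact: steps_cat (steps_cat sj s2) sz.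
    * case: S2 => /= HE HM Ho HR HMo; split=> //=.
        by move=> y Hy; rewrite ltn_eqF // HE.
      by apply: upd_ok => //; rewrite W_gt0.
    * by rewrite T2 /=; lia.
- move=> C /= /andP[wa wc] S.
  case: st S => e m o0 t S [Inv [k Hk] HI].
  (* Induction on the counter of the invariant; at counter 0 the test must fail. *)
  elim: k e m o0 t R M o S Hk => [|k IHk] e m o0 t R M o S Hk.
  all: move: (C) => /at_cat [Ca] /at_cat [/at_cons [Cj _]] /at_cat [C1].
  all: move=> /at_cons [Cz /at_cons [Cj2 _]].
  all: rewrite !size_ecode /= in Cj C1 Cz Cj2 *.
  all: have [oka H] := HI _ _ Hk.
  all: have [R1 [s1 v1 k1 ok1]] := ecode_sound Ca (leqnn _) wa S oka.
  all: rewrite !size_cat /= !size_cat size_ecode /=.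
  all: set la := l + ecost a + 1 in Cj C1 Cz Cj2 *.
  all: have El : l + (ecost a + (size (comp c la) + 2).+1) = la + size (comp c la) + 2 by rewrite /la; lia.
  all: rewrite El.
  all: case E: (ev _ a) H v1 => [|x] H v1.
  1,3: exists (ecost a + 1), R1, M, o, (State e m o0 (t + (ecost a + 1))); split=> //;
    first by [apply: steps_cat s1 _ => /=; rewrite Cj v1 /=];
    by case: S => /= HE HM Ho HR HMo; split=> //= y Hy; rewrite k1 ?HE.
  all: case: H => k' // [<-] H.
  have S1 : sim (State e m o0 (t + (ecost a + 3))) (Config la R1 M o).
    by case: S => /= HE HM Ho HR HMo; split=> //= y Hy; rewrite k1 ?HE.
  have [t2 [R2 [M2 [o2 [[e2 m2 o2' t2'] [s2 S2 T2 H2]]]]]] := IH _ _ _ _ _ _ C1 wc S1 H.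
  have sj : steps (ecost a + 1) (Config l R M o) (Config la R1 M o).
    by apply: steps_cat s1 _ => /=; rewrite Cj v1 /= /la addn1.
  have sz : steps 2 (Config (la + size (comp c la)) R2 M2 o2)
     (Config l [eta R2 with tmp |-> 0] M2 o2).
    by rewrite /= Cz /= Cj2 /= mod0n eqxx.
  have S3 : sim (State e2 m2 o2' t2') (Config l [eta R2 with tmp |-> 0] M2 o2).
    case: S2 => /= HE HM Ho HR HMo; split=> //=.
      by move=> y Hy; rewrite ltn_eqF // HE.
    by apply: upd_ok => //; rewrite W_gt0.
  have [t4 [R4 [M4 [o4 [st4 [s4 S4 T4 H4]]]]]] := IHk _ _ _ _ _ _ _ S3 H2.
  rewrite size_cat /= size_cat size_ecode /= -/la El in s4 S4.
  exists (ecost a + 1 + t2 + 2 + t4), R4, M4, o4, st4; split=> //.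
  + exact: steps_cat (steps_cat (steps_cat sj s2) sz) s4.
  + by rewrite T4 /=; move: T2 => /=; lia.
Qed.

End Semantics.

End Machine.
Import Machine.

(** * Multiply-shift and perfect hashing *)

Module Hashing.

Definition mulshift (w a s x : nat) : nat := ((x * a) %% 2 ^ w) %/ 2 ^ s.

Lemma sum_periodic n c (g : nat -> nat) :
  (forall x, g (x + n) = g x) -> \sum_(b < n) g (b + c) = \sum_(b < n) g b.
Proof.
move=> per; elim: c => [|c IH]; first by apply: eq_bigr => i _; rewrite addn0.
rewrite -IH; case: n per {IH} => [|n] per; first by rewrite !big_ord0.
rewrite big_ord_recr [RHS]big_ord_recl /= addnC; congr (_ + _).
  by rewrite -(per (0 + c)); congr g; lia.
by apply: eq_bigr => i _; congr g; rewrite /bump /=; lia.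
Qed.

Lemma mod_div_exp s l m : (m %% 2 ^ (s + l)) %/ 2 ^ s = (m %/ 2 ^ s) %% 2 ^ l.
Proof. by rewrite expnD mulnC -modn_divl. Qed.

(** Adding [y * a] leaves the top bits unchanged, so the corresponding bits of [y * a] vanish up to
    the carry [c] out of the low [s] bits; the carry is 0 if these bits of [y * a] are. *)
Lemma mulshift_top s l a x y :
  mulshift (s + l) a s (x + y) = mulshift (s + l) a s x ->
  exists2 c, c < 2 & (((y * a) %/ 2 ^ s + c) %% 2 ^ l = 0 /\
    (2 ^ s %| y -> c = 0)).
Proof.
rewrite /mulshift !mod_div_exp mulnDl => H.
have p0 : 0 < 2 ^ s by rewrite expn_gt0.
rewrite divnD // in H.
exists (2 ^ s <= (x * a) %% 2 ^ s + (y * a) %% 2 ^ s : nat); first by case: (2 ^ s <= _).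
split; last first.
  by move=> d; rewrite (eqP (dvdn_mulr a d)) addn0 leqNgt ltn_mod p0.
move: H; rewrite -addnA -{2}[(x * a) %/ _]addn0 => /eqP; rewrite eqn_modDl => /eqP ->.
exact: mod0n.
Qed.

(** Write the difference of the keys as [o * 2 ^ i] with [o] odd. If [s <= i], there is no carry,
    and a collision would make [2 ^ w] divide the difference. Otherwise, moving the odd multiplier
    by [2 ^ (s - i)] moves the product by [o * 2 ^ s] and its top bits by [o]. In [2 ^ l] such moves
    the top bits run through all residues, and at most two of them, one for each carry, collide. *)
Lemma mulshift_collisions s l x y :
  0 < s + l -> x < 2 ^ (s + l) -> y < 2 ^ (s + l) -> x != y ->
  2 ^ l * (\sum_(b < 2 ^ (s + l).-1)
     (mulshift (s + l) b.*2.+1 s x == mulshift (s + l) b.*2.+1 s y)) <= 2 ^ (s + l).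
Proof.
set w := s + l => w0.
wlog lt_yx : x y / y < x.
  move=> IH Hx Hy xy; case: (ltngtP x y) => [lt|lt|e].
  - under eq_bigr => b _ do rewrite eq_sym.
    by apply: IH; rewrite // eq_sym.
  - exact: IH.
  - by rewrite e eqxx in xy.
move=> Hx Hy _.
pose z := x - y; have Hz : x = y + z by rewrite /z; lia.
have z0 : 0 < z by lia.
have zW : z < 2 ^ w by lia.
rewrite Hz.
pose g a := mulshift w a s (y + z) == mulshift w a s y.
rewrite -/w; have -> : \sum_(b < 2 ^ w.-1) (mulshift w b.*2.+1 s (y + z) ==
    mulshift w b.*2.+1 s y) = \sum_(b < 2 ^ w.-1) (g b.*2.+1 : nat) by [].
have [o co Eo] := pfactor_coprime (isT : prime 2) z0.
set i := logn 2 z in Eo; rewrite mulnC in Eo.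
case: (leqP s i) => [le_si|lt_is].
  rewrite [X in _ * X]big1 ?muln0 // => b _; rewrite /g; case: eqP => // /mulshift_top [c _ [+ H2]].
  have dz : 2 ^ s %| z by rewrite Eo dvdn_mulr // dvdn_exp2l.
  rewrite (H2 dz) addn0 => /eqP.
  rewrite -/(dvdn (2 ^ l) _) => H; exfalso.
  have : 2 ^ w %| z * b.*2.+1.
    rewrite /w expnD -(divnK (dvdn_mulr b.*2.+1 dz)) mulnC dvdn_pmul2r ?expn_gt0 //.
  rewrite Gauss_dvdl; last by rewrite coprimeXl // coprime2n /= odd_double.
  by move/(dvdn_leq z0); rewrite leqNgt zW.
have per : forall b, g (b + 2 ^ w.-1).*2.+1 = g b.*2.+1.
  move=> b; rewrite /g /mulshift; have -> : (b + 2 ^ w.-1).*2.+1 = b.*2.+1 + 2 ^ w.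
    by rewrite doubleD addSn; congr (_ + _).+1; rewrite -mul2n -expnS prednK.
  by rewrite !mulnDr ![_ + _ * 2 ^ w]addnC !modnMDl.
(* Half of [2 ^ (s - i)], because the multiplier is [b.*2.+1]. *)
pose st := 2 ^ (s - i).-1.
have est : st.*2 = 2 ^ (s - i) by rewrite -mul2n -expnS prednK // subn_gt0.
have shift t : \sum_(b < 2 ^ w.-1) (g b.*2.+1 : nat) =
   \sum_(b < 2 ^ w.-1) (g (b + t * st).*2.+1 : nat).
  by rewrite (@sum_periodic _ (t * st) (fun b => g b.*2.+1)) // => b; rewrite per.
(* All [2 ^ l] shifted sums are equal by periodicity; after exchanging the sums, only the shifts of
   a fixed [b] are to be counted. *)
have -> : 2 ^ l * \sum_(b < 2 ^ w.-1) (g b.*2.+1 : nat) =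
  \sum_(t < 2 ^ l) \sum_(b < 2 ^ w.-1) (g (b + t * st).*2.+1 : nat).
  by under [RHS]eq_bigr => t _ do rewrite -shift; rewrite sum_nat_const card_ord.
rewrite exchange_big /=.
have -> : 2 ^ w = \sum_(b < 2 ^ w.-1) 2.
  by rewrite sum_nat_const card_ord mulnC -expnS prednK.
apply: leq_sum => b _.
pose A := (z * b.*2.+1) %/ 2 ^ s.
have inj : injective (fun t : 'I_(2 ^ l) => (A + t * o) %% 2 ^ l).
  move=> t1 t2 /eqP; rewrite eqn_modDl => H; apply/val_inj => /=.
  wlog le12 : t1 t2 H / t1 <= t2.
    move=> IH; case: (leqP t1 t2) => [|/ltnW] le; first exact: IH.
    by symmetry; apply: IH; rewrite // eq_sym.
  move: H; rewrite eq_sym eqn_mod_dvd ?leq_mul2r ?le12 ?orbT // -mulnBl.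
  rewrite Gauss_dvdl; last by rewrite coprimeXl // coprime2n.
  case: (posnP (t2 - t1)) => [H _|p0]; first by lia.
  by move/(dvdn_leq p0); have := ltn_ord t2; lia.
have key t : g (b + t * st).*2.+1 ->
   (A + t * o) %% 2 ^ l = 0 \/ (A + t * o + 1) %% 2 ^ l = 0.
  move=> /eqP /mulshift_top [c Hc [H _]].
  have E : z * (b + t * st).*2.+1 = z * b.*2.+1 + (t * o) * 2 ^ s.
    rewrite doubleD -addSn mulnDr; congr (_ + _).
    rewrite doubleMr est {1}Eo -(subnK (ltnW lt_is)) expnD addnK; nia.
  rewrite E divnDMl ?expn_gt0 // -/A in H.
  by move: Hc H; case: c => [|[|]] //; rewrite ?addn0; [left | right].
have uniq1 c : \sum_(t < 2 ^ l) ((A + t * o + c) %% 2 ^ l == 0 : nat) <= 1.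
  rewrite -big_mkcond sum1_card; apply/card_le1_eqP => t1 t2.
  rewrite !unfold_in => /eqP H1 /eqP H2; apply: inj => /=.
  by apply/eqP; rewrite -(eqn_modDr c) H1 H2.
apply: leq_trans (leq_add (uniq1 0) (uniq1 1)).
rewrite -big_split /=; apply: leq_sum => t _.
case G: (g _) => //; rewrite addn0; case: (key _ G) => ->; rewrite eqxx ?addn1 //.
Qed.

Definition collisions (h : nat -> nat) (s : seq nat) : nat :=
  \sum_(x <- s) \sum_(y <- s | x != y) (h x == h y).

(** Averaging: over the [2 ^ w.-1] odd multipliers, [2 ^ l] times the number of collisions sums to
    at most [size K ^ 2 * 2 ^ w]. *)
Lemma mulshift_exists w l (K : seq nat) :
  0 < w -> l <= w -> {in K, forall x, x < 2 ^ w} ->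
  exists b : 'I_(2 ^ w.-1),
    2 ^ l * collisions (mulshift w b.*2.+1 (w - l)) K <= 2 * size K ^ 2.
Proof.
move=> w0 lw HK; apply/existsP; apply: contraT; rewrite negb_exists => /forallP H.
have : \sum_(b < 2 ^ w.-1) (2 * size K ^ 2).+1 <=
    \sum_(b < 2 ^ w.-1) 2 ^ l * collisions (mulshift w b.*2.+1 (w - l)) K.
  by apply: leq_sum => b _; rewrite ltnNge; apply: H.
rewrite leqNgt => /negP [].
apply: (@leq_ltn_trans (\sum_(x <- K) \sum_(y <- K) 2 ^ w)); last first.
  rewrite sum_nat_const card_ord !big_const_seq !count_predT !iter_addn_0.
  have -> : 2 ^ w = 2 * 2 ^ w.-1 by rewrite -expnS prednK.
  by have : 0 < 2 ^ w.-1; [rewrite expn_gt0 | rewrite -mulnn; nia].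
rewrite -big_distrr /= exchange_big big_distrr /=.
rewrite !big_seq; apply: leq_sum => x xK.
rewrite exchange_big big_distrr /= big_mkcond.
rewrite !big_seq; apply: leq_sum => y yK.
case: ifP => // xy.
by have := @mulshift_collisions (w - l) l x y; rewrite subnK // => ->; rewrite ?HK.
Qed.

Definition multiplier (w l : nat) (K : seq nat) : nat :=
  if [pick b : 'I_(2 ^ w.-1) |
      2 ^ l * collisions (mulshift w b.*2.+1 (w - l)) K <= 2 * size K ^ 2]
  is Some b then b.*2.+1 else 0.

Lemma multiplierP w l (K : seq nat) :
  0 < w -> l <= w -> {in K, forall x, x < 2 ^ w} ->
  2 ^ l * collisions (mulshift w (multiplier w l K) (w - l)) K <= 2 * size K ^ 2.
Proof.
move=> w0 lw HK; rewrite /multiplier; case: pickP => // H.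
by have [b Hb] := mulshift_exists w0 lw HK; have := H b; rewrite Hb.
Qed.

Lemma multiplier_lt w l (K : seq nat) : 0 < w -> multiplier w l K < 2 ^ w.
Proof.
move=> w0; rewrite /multiplier; case: pickP => [b _|_]; last by rewrite expn_gt0.
have -> : 2 ^ w = 2 * 2 ^ w.-1 by rewrite -expnS prednK.
by have := ltn_ord b; lia.
Qed.

(** The summand 1 is there for [n = 0], where the power is 1. *)
Lemma up_log2_bounds n : n <= 2 ^ up_log 2 n <= 2 * n + 1.
Proof.
rewrite up_logP //=; case: n => [|[|n]]; rewrite ?up_log0 ?up_log1 //.
have /andP[+ _] := @up_log_bounds 2 n.+2 isT isT.
have : 0 < up_log 2 n.+2 by rewrite up_log_gt0.
by case: (up_log _ _) => // k _ /=; rewrite expnS; lia.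
Qed.

Lemma collisions_inj (h : nat -> nat) (K : seq nat) :
  collisions h K = 0 -> {in K &, injective h}.
Proof.
move=> /eqP; rewrite sum_nat_seq_eq0 => /allP H x y xK yK exy.
have := H x xK; rewrite /= sum_nat_seq_eq0 => /allP /(_ y yK).
by rewrite exy eqxx; case: eqP.
Qed.

(** Both sides count the ordered pairs of keys in a common bucket; the diagonal contributes
    [size K]. *)
Lemma sum_buckets (h : nat -> nat) (K : seq nat) nb :
  uniq K -> {in K, forall x, h x < nb} ->
  \sum_(j < nb) size [seq x <- K | h x == j] ^ 2 = size K + collisions h K.
Proof.
move=> uK HK.
transitivity (\sum_(x <- K) \sum_(y <- K) (h x == h y : nat)).
  transitivity (\sum_(j < nb) \sum_(x <- K) \sum_(y <- K) (h x == j) * (h y == j)).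
    apply: eq_bigr => j _; rewrite size_filter -sum1_count big_mkcond expnS expn1 /=.
    rewrite big_distrl /=; apply: eq_bigr => x _.
    by rewrite big_distrr /=; apply: eq_bigr => y _; case: (h x == j); case: (h y == j).
  rewrite exchange_big big_seq [RHS]big_seq; apply: eq_bigr => x xK.
  rewrite exchange_big; apply: eq_bigr => y _.
  rewrite (bigD1 (Ordinal (HK x xK))) //= eqxx mul1n eq_sym big1 ?addn0 //.
  move=> j; rewrite -val_eqE /= eq_sym => /negPf H.
  by rewrite H.
rewrite /collisions -sum1_size -big_split /= big_seq [RHS]big_seq.
apply: eq_bigr => x xK.
rewrite (bigD1_seq x) //= eqxx; congr (_ + _).
by apply: eq_bigl => y; rewrite eq_sym.
Qed.

(* The two-level scheme of Fredman, Komlos and Szemeredi. *)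
Lemma perfect_hashing w (K : seq nat) :
  0 < w -> uniq K -> {in K, forall x, x < 2 ^ w} -> 4 * size K ^ 2 + 4 <= 2 ^ w ->
  exists (a s nb tot : nat) (a2 s2 off : nat -> nat),
    [/\ [/\ a < 2 ^ w, s <= w, nb <= 4 * size K + 1 & tot <= 20 * size K + 3],
        forall j, a2 j < 2 ^ w /\ s2 j <= w,
        forall x, x < 2 ^ w -> mulshift w a s x < nb /\
          off (mulshift w a s x) +
          mulshift w (a2 (mulshift w a s x)) (s2 (mulshift w a s x)) x < tot &
        {in K &, injective (fun x => off (mulshift w a s x) +
          mulshift w (a2 (mulshift w a s x)) (s2 (mulshift w a s x)) x)}].
Proof.
move=> w0 uK HK HW; set m := size K in HW *.
have lt_ms a l x : l <= w -> mulshift w a (w - l) x < 2 ^ l.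
  move=> lw; rewrite /mulshift ltn_divLR ?expn_gt0 // -expnD subnKC // ltn_mod.
  by rewrite expn_gt0.
have exp_le l : 2 ^ l <= 4 * m ^ 2 + 3 -> l <= w.
  by move=> H; rewrite -(@leq_exp2l 2) //; lia.
(* With [2 ^ l >= 2 * m], the bound [2 * m ^ 2] of [multiplierP] leaves at most [m] collisions. *)
pose l := up_log 2 (2 * m).
have /andP[l1 l2] := up_log2_bounds (2 * m); rewrite -/l in l1 l2.
have lw : l <= w by apply: exp_le; nia.
pose a := multiplier w l K; pose h := mulshift w a (w - l).
have Hcoll : collisions h K <= m.
  have := multiplierP w0 lw HK; rewrite -/a -/h -/m.
  case: (posnP m) => [m0|m0]; last by nia.
  have -> : K = [::] by apply: size0nil.
  by rewrite /collisions big_nil.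
pose Kj j := [seq x <- K | h x == j].
(* The summand 1 makes the table larger than twice the square of the bucket, so that the number of
   collisions is below 1. *)
pose lj j := up_log 2 (2 * size (Kj j) ^ 2 + 1).
have ljb j : 2 * size (Kj j) ^ 2 + 1 <= 2 ^ lj j <= 4 * size (Kj j) ^ 2 + 3.
  by have := up_log2_bounds (2 * size (Kj j) ^ 2 + 1); rewrite -/(lj j); lia.
have ljw j : lj j <= w.
  apply: exp_le; have /andP[_ H] := ljb j; apply: (leq_trans H).
  by rewrite leq_add2r leq_mul2l /= leq_sqr size_filter count_size.
pose a2 j := multiplier w (lj j) (Kj j).
have KjP j : {in Kj j, forall x, x < 2 ^ w}.
  by move=> x; rewrite mem_filter => /andP[_ /HK].
have Hcj j : {in Kj j &, injective (mulshift w (a2 j) (w - lj j))}.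
  apply: collisions_inj; have := multiplierP w0 (ljw j) (KjP j).
  by have := ljb j; rewrite -/(a2 j); nia.
pose off j := \sum_(i < j) 2 ^ lj i.
have offS i j : i < j -> off i + 2 ^ lj i <= off j.
  elim: j => // j IH; rewrite ltnS leq_eqVlt => /predU1P[->|/IH H].
    by rewrite [off j.+1]big_ord_recr.
  by rewrite [off j.+1]big_ord_recr /= (leq_trans H) // leq_addr.
exists a, (w - l), (2 ^ l), (off (2 ^ l)), a2, (fun j => w - lj j), off.
split.
- split=> //; rewrite ?leq_subr ?multiplier_lt //; first by lia.
  (* The squares of the bucket sizes sum to at most [2 * m], and there are at most [4 * m + 1]
     buckets: the total is [8 * m + 12 * m + 3]. *)
  apply: (@leq_trans (\sum_(i < 2 ^ l) (4 * size (Kj i) ^ 2 + 3))).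
    by apply: leq_sum => i _; case/andP: (ljb i).
  rewrite big_split /= -big_distrr /= (@sum_buckets h) //; last first.
    by move=> x xK; apply: lt_ms.
  by rewrite sum_nat_const card_ord -/m; lia.
- by move=> j; rewrite leq_subr multiplier_lt.
- move=> x xw; split; first exact: lt_ms.
  have H := lt_ms a l x lw; apply: leq_trans (offS _ _ H).
  by rewrite ltn_add2l lt_ms.
- move=> x y xK yK; rewrite -/h => E.
  have Exy : h x = h y.
    case: (ltngtP (h x) (h y)) => // lt.
      have := offS _ _ lt; have := lt_ms (a2 (h x)) (lj (h x)) x (ljw _); lia.
    have := offS _ _ lt; have := lt_ms (a2 (h y)) (lj (h y)) y (ljw _); lia.
  apply: (Hcj (h x)); rewrite ?mem_filter ?eqxx ?Exy ?eqxx //.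
  by move: E; rewrite Exy => /addnI.
Qed.

End Hashing.
Import Hashing.

(** * Laminar families, lexicographic order and convexity *)

Module Convexity.

(** Let [B] be a largest member properly inside [S]. Any other member inside [S], except [S] itself,
    lies in [B] or in [S :\: B], and the bound [2 * #|S| - 1] solves the resulting recurrence. *)
Lemma laminar_card (T : finType) (F : {set {set T}}) :
  set0 \notin F ->
  {in F &, forall A B : {set T}, A :&: B != set0 -> (A \subset B) || (B \subset A)} ->
  #|F| <= 2 * #|T|.
Proof.
move=> F0 lam.
suff H (S : {set T}) : S != set0 -> #|F :&: powerset S| < 2 * #|S|.
  have [T0|T0] := eqVneq [set: T] set0.
    rewrite (_ : F = set0) ?cards0 //; apply/setP=> A; rewrite in_set0.
    apply/negP => AF; case/negP: F0; rewrite (_ : set0 = A) //.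
    by apply/esym/eqP; rewrite -subset0 -T0 subsetT.
  have := H _ T0; rewrite cardsT => /ltnW; rewrite (setIidPl _) //.
  by apply/subsetP => A _; rewrite powersetE subsetT.
have [k] := ubnP #|S|; elim: k S => // k IH S Sk S0.
pose G := [set A in F | A \proper S].
have [G0|[A0 A0G]] := set_0Vmem G.
  apply: (@leq_ltn_trans 1); last by rewrite -card_gt0 in S0; lia.
  rewrite -(cards1 S); apply: subset_leq_card; apply/subsetP => A.
  rewrite inE powersetE inE => /andP[AF AS].
  move: (in_set0 A); rewrite -G0 inE AF /= properEneq AS andbT => /negbT.
  by rewrite negbK.
case: (@arg_maxnP _ A0 (mem G) (fun A => #|A|) A0G) => B BG Bmax.
move: (BG); rewrite /= inE => /andP[BF BS].
have BD : S :\: B != set0 by rewrite setD_eq0; case/andP: BS.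
have B0 : B != set0 by apply: contraNneq F0 => <-.
have cS : #|S| = #|B| + #|S :\: B| by rewrite -(cardsID B S) (setIidPr (proper_sub BS)).
have c2 : 0 < #|S :\: B| by rewrite card_gt0.
have H1 : #|F :&: powerset B| < 2 * #|B| by apply: IH => //; lia.
have H2 : #|F :&: powerset (S :\: B)| < 2 * #|S :\: B| by apply: IH => //; lia.
have : F :&: powerset S \subset
    [set S] :|: ((F :&: powerset B) :|: (F :&: powerset (S :\: B))).
  apply/subsetP => A; rewrite !inE => /andP[AF AS].
  rewrite AF /=; have [//|AneS] := eqVneq A S.
  have AG : A \in G by rewrite inE AF properEneq AneS AS.
  have [AB|AB] := eqVneq (A :&: B) set0.
    by rewrite /= subsetD AS /= -setI_eq0 AB eqxx !orbT.
  case/orP: (lam _ _ AF BF AB) => [->//|BA].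
  suff -> : A = B by rewrite subxx.
  by apply/eqP; rewrite eq_sym eqEcard BA; apply: Bmax.
move/subset_leq_card => H3; apply: leq_ltn_trans H3 _.
have U1 := (leq_card_setU (F :&: powerset B) (F :&: powerset (S :\: B))).1.
have U2 := (leq_card_setU [set S] ((F :&: powerset B) :|: (F :&: powerset (S :\: B)))).1.
rewrite cards1 in U2; apply: leq_ltn_trans U2 _; rewrite cS.
apply: leq_ltn_trans (_ : 1 + (#|F :&: powerset B| + #|F :&: powerset (S :\: B)|) < _).
  by rewrite leq_add2l.
move: #|F :&: powerset B| #|F :&: powerset (S :\: B)| H1 H2 => u v; lia.
Qed.

Section Order.

Fixpoint lexle (s t : seq nat) : bool :=
  match s, t with
  | [::], _ => true
  | _, [::] => false
  | a :: s', b :: t' => (a < b) || ((a == b) && lexle s' t')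
  end.

Lemma lexle_total : total lexle.
Proof.
elim=> [|a s IH] [|b t] //=.
by rewrite (eq_sym b a); case: (ltngtP a b) => //= _; apply: IH.
Qed.

Lemma lexle_trans : transitive lexle.
Proof.
elim=> [|b t IH] [|a s] [|c u] //=.
case/orP=> [ab|/andP[/eqP<- st]] /orP[bc|/andP[/eqP<- tu]].
- by rewrite (ltn_trans ab bc).
- by rewrite ab.
- by rewrite bc.
- by rewrite eqxx (IH _ _ st tu) orbT.
Qed.

(** This convexity turns every locus into an interval of the sorted suffixes, as in a suffix
    array. *)
Lemma lexle_prefix (Q s t u : seq nat) :
  lexle s t -> lexle t u -> prefix Q s -> prefix Q u -> prefix Q t.
Proof.
elim: Q s t u => [|a Q IH] [|b s] [|c t] [|d u] //=.
move=> H1 H2 /andP[/eqP Eb Hs] /andP[/eqP Ed Hu]; move: H1 H2.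
rewrite -Eb -Ed; case: (ltngtP a c) => //= _ H1 H2.
exact: IH H1 H2 Hs Hu.
Qed.

Lemma convex_interval (T : eqType) (e : seq T) (P : pred T) :
  (forall x y z, x \in e -> y \in e -> z \in e ->
     index x e <= index y e <= index z e -> P x -> P z -> P y) ->
  exists lo hi, lo <= hi <= size e /\
    {in e, forall x, P x = (lo <= index x e < hi)}.
Proof.
move=> conv; case: (boolP (has P e)) => [hP|/hasPn nP]; last first.
  by exists 0, 0; split=> // x /nP /negPf ->.
have [x0 x0e Px0] := hasP hP.
pose lo := find P e; pose hi := \max_(y <- e | P y) (index y e).+1.
have hmax y : y \in e -> P y -> index y e < hi by move=> ye Py; apply: leq_bigmax_seq.
have lomin y : y \in e -> P y -> lo <= index y e.
  by move=> ye Py; rewrite leqNgt; apply/negP => /(before_find x0); rewrite nth_index // Py.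
exists lo, hi; split.
  rewrite (leq_trans (lomin _ x0e Px0) (ltnW (hmax _ x0e Px0))) /=.
  by apply/bigmax_leqP_seq => y ye _; rewrite index_mem.
move=> y ye; apply/idP/idP => [Py|/andP[H1 H2]]; first by rewrite lomin ?hmax.
have /hasP [z ze /andP[Pz Hz]] : has (fun z => P z && (index y e <= index z e)) e.
  apply: contraLR H2 => /hasPn H; rewrite -leqNgt.
  apply/bigmax_leqP_seq => z ze Pz; rewrite ltnNge; apply/negP => le.
  by have := H z ze; rewrite Pz le.
have xlo : P (nth x0 e lo) by apply: nth_find.
apply: (conv (nth x0 e lo) y z) => //.
  by rewrite mem_nth // -has_find.
rewrite Hz andbT (leq_trans _ H1) // -ltnS.
rewrite -[X in index _ X](cat_take_drop lo.+1) index_cat.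
rewrite (take_nth x0) -?has_find // mem_rcons inE eqxx /=.
rewrite -cats1 index_cat; case: ifP => [|_].
  by rewrite -index_mem size_take -has_find hP; lia.
by rewrite /= eqxx size_take -has_find hP addn0.
Qed.

End Order.

End Convexity.
Import Convexity.

(** * Loci of strings: the suffix tree as a family of sets *)

Module PrefixFamily.

Section PrefixFamily.
Variables (X : finType) (key : X -> seq nat).
Implicit Types A B : {set X}.

(* [fam] consists of the nonempty loci, the nodes of the suffix tree: the locus
   [A] is [pre Q] for strings [Q] of each length from [minlen A] to [maxlen A]. *)
Definition pre (Q : seq nat) : {set X} := [set x | prefix Q (key x)].
Definition cls (l : nat) (x : X) : {set X} := pre (take l (key x)).
Definition len A (l : nat) : bool :=
  [exists x, (l <= size (key x)) && (A == cls l x)].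
Definition maxkey : nat := \max_x size (key x).
Definition fam : {set {set X}} := [set A | [exists l : 'I_maxkey.+1, len A l]].
Definition minlen A : nat := find (len A) (iota 0 maxkey.+1).
Definition maxlen A : nat := \max_(l < maxkey.+1 | len A l) l.

Lemma mem_cls l (x : X) : x \in cls l x.
Proof. by rewrite inE prefix_take. Qed.

Lemma in_cls l (x y : X) : l <= size (key x) ->
  y \in cls l x = (l <= size (key y)) && (take l (key y) == take l (key x)).
Proof.
move=> lx; rewrite inE prefixE size_takel //; apply/eqP/andP => [E|[_ /eqP->]] //.
by rewrite E eqxx; split=> //; rewrite -(size_takel lx) -E size_take; case: ltnP; lia.
Qed.

Lemma pre_cls (Q : seq nat) (x : X) :
  x \in pre Q -> size Q <= size (key x) /\ pre Q = cls (size Q) x.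
Proof.
rewrite inE => H; split; first exact: size_prefix.
by rewrite /cls; move: H; rewrite prefixE => /eqP ->.
Qed.

Lemma cls_eq l (x y : X) : l <= size (key x) -> y \in cls l x ->
  l <= size (key y) /\ cls l y = cls l x.
Proof. by move=> lx; rewrite in_cls // => /andP[ly /eqP E]; split; rewrite // /cls E. Qed.

Lemma sub_cls l l' (x : X) : l <= l' -> cls l' x \subset cls l x.
Proof.
move=> ll; apply/subsetP => y; rewrite !inE; apply: prefix_trans.
by rewrite -(take_takel _ ll) prefix_take.
Qed.

Lemma len_maxkey A l : len A l -> l <= maxkey.
Proof.
case/existsP => x /andP[H _]; apply: (leq_trans H).
exact: (leq_bigmax (F := fun x => size (key x))).
Qed.

Lemma lenP A l (x : X) : x \in A ->
  reflect (l <= size (key x) /\ A = cls l x) (len A l).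
Proof.
move=> xA; apply: (iffP existsP) => [[y /andP[ly /eqP EA]]|[lx EA]]; last first.
  by exists x; rewrite lx EA eqxx.
rewrite EA in xA; have [lx E] := cls_eq ly xA.
by rewrite lx EA E.
Qed.

Lemma len_nonempty A l : len A l -> A != set0.
Proof. by case/existsP => x /andP[_ /eqP->]; apply/set0Pn; exists x; apply: mem_cls. Qed.

Lemma len_fam A l : len A l -> A \in fam.
Proof.
move=> H; rewrite inE; apply/existsP.
by exists (Ordinal (len_maxkey H : l < maxkey.+1)).
Qed.

Lemma len_cls l (x : X) : l <= size (key x) -> len (cls l x) l.
Proof. by move=> H; apply/existsP; exists x; rewrite H eqxx. Qed.

Lemma len_pre (Q : seq nat) (x : X) : x \in pre Q -> len (pre Q) (size Q).
Proof. by case/pre_cls => H ->; apply: len_cls. Qed.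

Lemma fam_nonempty A : A \in fam -> A != set0.
Proof. by rewrite inE => /existsP [l /len_nonempty]. Qed.

Lemma len_minlen A : A \in fam -> len A (minlen A).
Proof.
rewrite inE => /existsP [l Hl].
have H : has (len A) (iota 0 maxkey.+1).
  by apply/hasP; exists (l : nat); rewrite // mem_iota /=.
have := nth_find 0 H; rewrite nth_iota ?add0n //.
by rewrite has_find size_iota in H.
Qed.

Lemma len_maxlen A : A \in fam -> len A (maxlen A).
Proof.
rewrite inE => /existsP [l Hl]; rewrite /maxlen.
by have [k Hk ->] := @eq_bigmax_cond _ (fun i : 'I_maxkey.+1 => len A i)
  (fun i => i : nat) ltac:(by apply/card_gt0P; exists l).
Qed.

Lemma len_bounds A l : len A l -> minlen A <= l <= maxlen A.
Proof.
move=> H; have lk := len_maxkey H; apply/andP; split.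
  rewrite leqNgt; apply/negP => lt; have := before_find 0 lt.
  by rewrite nth_iota ?add0n ?H // ltnS.
exact: (leq_bigmax_cond (F := fun i : 'I_maxkey.+1 => i : nat) (Ordinal (lk : l < maxkey.+1))).
Qed.

(** The loci of the prefixes of one string shrink as the length grows, so equal ends force equality
    in between. *)
Lemma len_convex A l1 l2 l :
  len A l1 -> len A l2 -> l1 <= l <= l2 -> len A l.
Proof.
move=> H1 H2 /andP[l1l ll2]; have /set0Pn [x xA] := len_nonempty H1.
have [lx1 E1] := lenP _ xA H1; have [lx2 E2] := lenP _ xA H2.
apply/(lenP _ xA); split; first exact: leq_trans lx2.
apply/eqP; rewrite eqEsubset; apply/andP; split; first by rewrite E2 sub_cls.
by have := sub_cls x l1l; rewrite -E1.
Qed.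

(** Two loci through a common [x] are loci of prefixes of [key x], and these form a chain. *)
Lemma fam_laminar : {in fam &, forall A B : {set X},
  A :&: B != set0 -> (A \subset B) || (B \subset A)}.
Proof.
move=> A B fA fB /set0Pn [x /setIP [xA xB]].
have [_ ->] := lenP _ xA (len_minlen fA); have [_ ->] := lenP _ xB (len_minlen fB).
by case: (leqP (minlen A) (minlen B)) => [|/ltnW] H; rewrite (sub_cls _ H) ?orbT.
Qed.

Lemma card_fam : #|fam| <= 2 * #|X|.
Proof.
apply: laminar_card fam_laminar.
by apply/negP => /fam_nonempty; rewrite eqxx.
Qed.

Lemma interval_order : exists e : seq X, [/\ uniq e, e =i predT &
  forall Q, exists lo hi, lo <= hi <= size e /\
    forall x, (x \in pre Q) = (lo <= index x e < hi)].
Proof.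
pose r x y := lexle (key x) (key y).
exists (sort r (enum X)).
have tr : transitive r by move=> x y z; apply: lexle_trans.
have u : uniq (sort r (enum X)) by rewrite sort_uniq enum_uniq.
have m : sort r (enum X) =i predT by move=> x; rewrite mem_sort mem_enum.
split=> // Q.
have st : sorted r (sort r (enum X)) by apply: sort_sorted => x y; apply: lexle_total.
have rr : reflexive r by move=> x; have := lexle_total (key x) (key x); rewrite orbb.
have le x y : index x (sort r (enum X)) <= index y (sort r (enum X)) -> r x y.
  move=> H; rewrite -(nth_index x (_ : x \in sort r (enum X))) ?m //.
  rewrite -[X in r _ X](nth_index x (_ : y \in sort r (enum X))) ?m //.
  by apply: (sorted_leq_nth tr rr) => //; rewrite inE index_mem m.
have [|lo [hi [H1 H2]]] := @convex_interval _ (sort r (enum X)) (fun x => x \in pre Q).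
  move=> x y z _ _ _ /andP[/le xy /le yz]; rewrite !inE.
  exact: lexle_prefix xy yz.
by exists lo, hi; split=> // x; apply: H2; rewrite m.
Qed.

End PrefixFamily.

Section Alloc.
Variables (T : finType) (sz : T -> nat).

(** Blocks of sizes [sz] are laid out one after another by prefix sums; [inv] tells which block a
    row belongs to, so that a column of the index can be defined row by row. *)
Lemma allocation : exists (off : T -> nat) (inv : nat -> option (T * nat)),
  [/\ forall t, off t + sz t <= \sum_t sz t,
   forall t i, i < sz t -> inv (off t + i) = Some (t, i) &
   forall r t i, inv r = Some (t, i) -> i < sz t].
Proof.
pose off (t : T) := \sum_(u : T | enum_rank u < enum_rank t) sz u.
have offS u t : enum_rank u < enum_rank t -> off u + sz u <= off t.
  move=> ut; rewrite /off [X in _ <= X](bigD1 u) //= addnC leq_add2l.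
  rewrite [X in X <= _]big_mkcond [X in _ <= X]big_mkcond /=; apply: leq_sum => v _.
  case: ifP => // H; rewrite (ltn_trans H ut) /=.
  by case: eqP H => // ->; rewrite ltnn.
exists off, (fun r => omap (fun t => (t, r - off t)) [pick t | off t <= r < off t + sz t]).
split.
- move=> t; rewrite /off [X in _ <= X](bigD1 t) //= addnC leq_add2l.
  rewrite [X in X <= _]big_mkcond [X in _ <= X]big_mkcond /=; apply: leq_sum => v _.
  by case: ifP => // H; case: eqP H => //= ->; rewrite ltnn.
- move=> t i it; case: pickP => [u Hu|/(_ t)] /=; last by rewrite leq_addr ltn_add2l it.
  suff -> : u = t by rewrite addKn.
  apply: enum_rank_inj; apply: val_inj => /=.
  by case: (ltngtP (enum_rank u) (enum_rank t)) => // /offS; lia.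
- by move=> r t i; case: pickP => //= u Hu [<- <-]; lia.
Qed.

End Alloc.

(** * Regions of a forest and the total length of their lists *)

Section Regions.
Variables (T I : finType) (par : T -> option T) (mu d : T -> nat) (S : T -> {set I}) (J : {set I}).
Hypothesis mu_par : forall v u, par v = Some u -> mu v < mu u.
Hypothesis d_par : forall v u, par v = Some u -> d u <= d v.
Hypothesis S_small : forall v, #|S v| <= d v.
Hypothesis S_sub : forall v, S v \subset J.

(** [S v] will be the groups of a locus, and those that no child has are charged to [v]; by
    [own_inj] at most [#|J|] are charged in all. *)
Definition own (v : T) : {set I} := S v :\: \bigcup_(c | par c == Some v) S c.
Hypothesis own_inj : forall v v' i, i \in own v -> i \in own v' -> v = v'.

(* A node takes over the lists of its children as long as they hold at most
   [3 * d v] elements, and otherwise falls back on [S v], its children becoming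
   the tops of regions: the lists at the tops then have linear total size, and
   the list at the top of a region contains those of all its nodes. *)
Fixpoint lst_rec (k : nat) (v : T) : {set I} :=
  if k is k'.+1 then
    if #|own v| + \sum_(c | par c == Some v) #|lst_rec k' c| <= 3 * d v then
      own v :|: \bigcup_(c | par c == Some v) lst_rec k' c
    else S v
  else set0.

Definition lst (v : T) : {set I} := lst_rec (mu v).+1 v.
Definition merges (v : T) : bool :=
  #|own v| + \sum_(c | par c == Some v) #|lst c| <= 3 * d v.
Definition top (v : T) : bool := if par v is Some u then ~~ merges u else true.

(** [mu] drops strictly from a node to its children, so fuel above [mu v] reaches the leaves. *)
Lemma lst_rec_stable k (v : T) : mu v < k -> lst_rec k v = lst v.
Proof.
rewrite /lst; elim: k {-2}k (leqnn k) v => [|n IH] k.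
  by rewrite leqn0 => /eqP ->.
case: k => // k kn v vk.
have E c : par c == Some v -> lst_rec k c = lst_rec (mu v) c.
  move=> /eqP /mu_par cv; rewrite (IH k) //; last by lia.
  by rewrite (IH (mu v)) //; lia.
have E1 : \sum_(c | par c == Some v) #|lst_rec k c| =
    \sum_(c | par c == Some v) #|lst_rec (mu v) c|.
  by apply: eq_bigr => c /E ->.
have E2 : \bigcup_(c | par c == Some v) lst_rec k c =
    \bigcup_(c | par c == Some v) lst_rec (mu v) c.
  by apply: eq_bigr => c /E ->.
by rewrite /= E1 E2.
Qed.

Lemma lstE (v : T) : lst v =
  if merges v then own v :|: \bigcup_(c | par c == Some v) lst c else S v.
Proof.
have E c : par c == Some v -> lst_rec (mu v) c = lst c.
  by move=> /eqP /mu_par cv; rewrite lst_rec_stable.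
rewrite {1}/lst /= /merges.
rewrite (eq_bigr (fun c => #|lst c|)) => [|c /E -> //].
by rewrite (eq_bigr (fun c => lst c)) => // c /E.
Qed.

(** An element of [S v] is owned by [v] or comes from a child, whose list a merge passes on; a
    fallback list is [S v] itself. *)
Lemma sub_lst (v : T) : S v \subset lst v.
Proof.
have [k] := ubnP (mu v); elim: k v => // k IH v vk; rewrite lstE.
case: ifP => // _; apply/subsetP => i iS; rewrite in_setU in_setD iS andbT.
case: (boolP (i \in \bigcup_(c | _) S c)) => //= /bigcupP [c Pc ic].
apply/bigcupP; exists c => //; apply: subsetP ic; apply: IH.
by have := mu_par (eqP Pc); lia.
Qed.

Lemma lst_small (v : T) : #|lst v| <= 3 * d v.
Proof.
rewrite lstE; case: ifP => [H|_]; last by have := S_small v; lia.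
apply: leq_trans H; apply: leq_trans (leq_card_setU _ _).1 _.
rewrite leq_add2l; elim/big_rec2: _ => [|c n A _ H]; first by rewrite cards0.
by apply: leq_trans (leq_card_setU _ _).1 _; rewrite leq_add2l.
Qed.

Lemma sum_own : \sum_v #|own v| <= #|J|.
Proof.
have own_sub v : own v \subset J by apply: subset_trans (S_sub v); apply: subsetDl.
under eq_bigr => v _ do rewrite -sum1_card big_mkcond.
rewrite exchange_big /= -sum1_card [X in _ <= X]big_mkcond; apply: leq_sum => i _.
case: ifPn => [_|iJ]; last first.
  by rewrite big1 // => v _; case: ifP => // /(subsetP (own_sub v)); rewrite (negPf iJ).
rewrite -big_mkcond sum1_card; apply/card_le1_eqP => v v'.
by rewrite !unfold_in => H1 H2; apply: (@own_inj _ _ i).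
Qed.

Lemma sum_children (f : T -> nat) :
  \sum_v \sum_(c | par c == Some v) f c = \sum_(c | par c != None) f c.
Proof.
rewrite (exchange_big_dep (fun c => par c != None)) => [|v c _ /eqP -> //] /=.
apply: eq_bigr => c; case E: (par c) => [u|] // _.
rewrite (bigD1 u) //= big1 ?addn0 // => v /andP[/eqP [->]].
by rewrite eqxx.
Qed.

(** A list is charged 3 per element to the owned elements and the lists of the children. A merge
    adds no charge; a fallback keeps less than a third of the total, which frees 2 per element for
    the lists of the children, now tops. In the sum over the forest, the lists below the roots
    cancel. *)
Lemma sum_top : 2 * \sum_(v | top v) #|lst v| <= 3 * #|J|.
Proof.
have local v : 3 * #|lst v| + 2 * (~~ merges v * \sum_(c | par c == Some v) #|lst c|)
   <= 3 * (#|own v| + \sum_(c | par c == Some v) #|lst c|).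
  rewrite lstE; case M: (merges v).
    rewrite /= mul0n muln0 addn0 leq_mul2l /=.
    apply: leq_trans (leq_card_setU _ _).1 _; rewrite leq_add2l.
    elim/big_rec2: _ => [|c n A _ H]; first by rewrite cards0.
    by apply: leq_trans (leq_card_setU _ _).1 _; rewrite leq_add2l.
  have := S_small v; move/negbT: M; rewrite /merges -ltnNge /= mul1n; lia.
have : \sum_v (3 * #|lst v| + 2 * (~~ merges v * \sum_(c | par c == Some v) #|lst c|))
   <= \sum_v (3 * (#|own v| + \sum_(c | par c == Some v) #|lst c|)).
  by apply: leq_sum => v _; apply: local.
rewrite !big_split /= !big1_eq !addn0 !sum_children.
have -> : \sum_v ~~ merges v * \sum_(c | par c == Some v) #|lst c| =
   \sum_(c | par c != None) top c * #|lst c|.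
  rewrite -sum_children; apply: eq_bigr => v _; rewrite big_distrr /=.
  by apply: eq_bigr => c /eqP E; rewrite /top E.
have -> : \sum_(v | top v) #|lst v| =
   \sum_(c | par c == None) #|lst c| + \sum_(c | par c != None) top c * #|lst c|.
  rewrite (bigID (fun c => par c == None)) /=; congr (_ + _).
    by apply: eq_bigl => c; rewrite /top; case: (par c) => [u|]; rewrite ?andbF.
  rewrite [LHS]big_mkcond [RHS]big_mkcond /=; apply: eq_bigr => c _.
  by case: (top c); case: (par c) => //= u; rewrite ?mul1n.
have -> : \sum_v #|lst v| = \sum_(c | par c == None) #|lst c| +
   \sum_(c | par c != None) #|lst c| by rewrite (bigID (fun c => par c == None)).
move: (\sum_(c | par c == None) _) (\sum_(c | par c != None) #|_|) => a b.
move: (\sum_(c | par c != None) _) (\sum_i _) sum_own => t o.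
by move: #|J| => c; lia.
Qed.

(** Take the nearest top above [v]: lists only grow along merging ancestors, while [d] does not grow
    towards the root, so the list at the top is still short compared with [d v]. *)
Lemma region (v : T) : exists t, [/\ top t, lst v \subset lst t & #|lst t| <= 3 * d v].
Proof.
pose K := \max_u mu u.
have leK u : mu u <= K by apply: (leq_bigmax (F := mu)).
have [k] := ubnP (K - mu v); elim: k v => // k IH v vk.
case: (boolP (top v)) => [tv|]; first by exists v; rewrite lst_small.
rewrite /top; case E: (par v) => [u|] //; rewrite negbK => Mu.
have := mu_par E; have := leK u => Ku vu.
have [|t [tt sut ct]] := IH u; first by lia.
exists t; split=> //; last by have := d_par E; lia.
apply: subset_trans sut; rewrite [lst u]lstE Mu.
by apply: subsetU; rewrite (bigcup_sup v) ?E ?orbT.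
Qed.

End Regions.

End PrefixFamily.
Import PrefixFamily.

(** * Range maxima by blocks, and tournament trees *)

Module RangeMax.

Section RangeMax.
Variable rk : nat -> nat.

Definition rg (l r : nat) : seq nat := [seq rk i | i <- iota l (r - l)].
Definition mx (l r : nat) : nat := \max_(x <- rg l r) x.

Lemma rg_cat l m r : l <= m <= r -> rg l r = rg l m ++ rg m r.
Proof.
move=> /andP[lm mr]; rewrite /rg -map_cat; congr map.
have -> : r - l = (m - l) + (r - m) by lia.
by rewrite iotaD subnKC.
Qed.

Lemma rg_cons l r : l < r -> rg l r = rk l :: rg l.+1 r.
Proof. by move=> lr; rewrite /rg subnS; case: (r - l) (subn_gt0 l r) => [|k]; rewrite lr. Qed.

Lemma rg_nil l r : r <= l -> rg l r = [::].
Proof. by rewrite -subn_eq0 /rg => /eqP ->. Qed.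

Lemma mx_cat l m r : l <= m <= r -> mx l r = maxn (mx l m) (mx m r).
Proof. by move=> H; rewrite /mx (rg_cat H) big_cat. Qed.

Lemma mx_nil l r : r <= l -> mx l r = 0.
Proof. by move=> H; rewrite /mx rg_nil // big_nil. Qed.

Lemma leq_mx l r i : l <= i < r -> rk i <= mx l r.
Proof.
move=> H; apply: (leq_bigmax_seq (F := id)) => //.
by apply: map_f; rewrite mem_iota; lia.
Qed.

Lemma mx_leq l r b : (forall i, l <= i < r -> rk i <= b) -> mx l r <= b.
Proof.
move=> H; apply/bigmax_leqP_seq => x /mapP [i]; rewrite mem_iota => Hi -> _.
by apply: H; lia.
Qed.

Lemma mx_attained l r : l < r -> exists2 i, l <= i < r & rk i = mx l r.
Proof.
move: {2}(r - l) (erefl (r - l)) => d; elim: d l => [|d IH] l E lr; first by lia.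
rewrite /mx rg_cons // big_cons -/(mx _ _).
have [lr'|rl] := ltnP l.+1 r; last first.
  by rewrite mx_nil // maxn0; exists l; rewrite ?leqnn.
have [|i Hi Ei] := IH l.+1 _ lr'; first by lia.
have [le|lt] := leqP (rk l) (mx l.+1 r); first by exists i => //; lia.
by exists l => //; rewrite leqnn.
Qed.

Lemma mx_overlap l a b r : l <= a -> a <= b -> b <= r ->
  mx l r = maxn (mx l b) (mx a r).
Proof.
move=> la ab br; rewrite (@mx_cat l a r) ?la ?(leq_trans ab) //.
rewrite (@mx_cat l a b) ?la // (@mx_cat a b r) ?ab //.
by rewrite -!maxnA; congr maxn; rewrite maxnA maxnn.
Qed.

Section Blocks.
Variable s : nat.
Hypothesis s_gt0 : 0 < s.

(** The type of the block prefix ending at [r]. There are only [2 ^ s] types, so the answers inside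
    blocks can be tabulated by type and offset. *)
Definition suffix_maxima (r : nat) : s.-tuple bool :=
  [tuple of mkseq (fun t => let i := (r %/ s) * s + t in
     (i < r) && all (fun j => rk j < rk i) (iota i.+1 (r - i.+1))) s].

Definition code (r : nat) : nat := enum_rank (suffix_maxima r).

Definition first_from (c off : nat) : nat :=
  find (fun t => (off <= t) &&
          nth false (nth [tuple of nseq s false] (enum {: s.-tuple bool}) c) t) (iota 0 s).

Lemma code_lt r : code r < 2 ^ s.
Proof.
by apply: leq_trans (ltn_ord (enum_rank (suffix_maxima r))) _; rewrite card_tuple card_bool.
Qed.

Lemma first_from_le c off : first_from c off <= s.
Proof. by have := find_size (fun t => (off <= t) &&
  nth false (nth [tuple of nseq s false] (enum {: s.-tuple bool}) c) t) (iota 0 s);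
  rewrite size_iota. Qed.

(* The last maximum of [l, r) is the first strict suffix maximum of the block
   prefix ending at [r] whose position is at least [l]. *)
Lemma block_max l r : l < r -> l %/ s = r %/ s ->
  let i := (l %/ s) * s + first_from (code r) (l %% s) in
  l <= i < r /\ rk i = mx l r.
Proof.
move=> lr blr.
have [p [Hp Ep Lp]] : exists p, [/\ l <= p < r, rk p = mx l r &
    forall j, p < j < r -> rk j < rk p].
  move: {2}(r - l) (erefl (r - l)) => d; elim: d (l) (lr) => [|d IH] a ar E; first by lia.
  rewrite /mx rg_cons // big_cons -/(mx _ _).
  have [lr'|rl] := ltnP a.+1 r; last first.
    by rewrite mx_nil // maxn0; exists a; split=> // *; lia.
  have [|p [Hp Ep Lp]] := IH a.+1 lr'; first by lia.
  have [le|lt] := leqP (rk a) (mx a.+1 r).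
    by exists p; split=> //; lia.
  exists a; split=> //; first by rewrite leqnn.
  by move=> j Hj; apply: leq_ltn_trans lt; apply: leq_mx; lia.
set b := (l %/ s) * s.
pose t0 := p - b.
have Hnth : nth [tuple of nseq s false] (enum {: s.-tuple bool}) (code r) = suffix_maxima r.
  by rewrite /code nth_enum_rank.
suff -> : first_from (code r) (l %% s) = t0.
  by rewrite /= /t0 subnKC; [split | lia].
rewrite /first_from Hnth.
pose P t := (l %% s <= t) && nth false (suffix_maxima r) t.
have Pt t : t < s -> P t = [&& l %% s <= t, b + t < r &
    all (fun j => rk j < rk (b + t)) (iota (b + t).+1 (r - (b + t).+1))].
  by move=> ts; rewrite /P nth_mkseq // -blr.
have t0s : t0 < s by rewrite /t0; lia.
have Pt0 : P t0.
  rewrite Pt // /t0 subnKC; last by lia.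
  apply/and3P; split; [by lia | by lia|].
  by apply/allP => j; rewrite mem_iota => Hj; apply: Lp; lia.
apply/eqP; rewrite eqn_leq; apply/andP; split.
  rewrite leqNgt; apply/negP => H; have := before_find 0 H.
  by rewrite nth_iota // add0n -/(P t0) Pt0.
(* An earlier candidate would exceed the value at [p], which is the maximum of the range. *)
rewrite leqNgt; apply/negP => H.
have hasP : has P (iota 0 s) by apply/hasP; exists t0; rewrite ?mem_iota.
have := nth_find 0 hasP; set f := find _ _ in H *.
have fs : f < s by rewrite (ltn_trans H).
rewrite nth_iota // add0n Pt // => /and3P[H1 H2 /allP H3].
have := H3 p; rewrite mem_iota => /(_ _) H4.
have : rk p < rk (b + f) by apply: H4; rewrite /t0 in H; lia.
rewrite Ep ltnNge leq_mx //; lia.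
Qed.

Lemma sparse_max l r t :
  2 ^ t <= r - l < 2 ^ t.+1 -> l < r ->
  mx (l * s) (r * s) =
  maxn (mx (l * s) ((l + 2 ^ t) * s)) (mx ((r - 2 ^ t) * s) (r * s)).
Proof.
rewrite expnS => H lr; apply: mx_overlap; rewrite leq_mul2r; apply/orP; right; lia.
Qed.

Lemma cross_max l r : l %/ s < r %/ s ->
  mx l r = maxn (mx l ((l %/ s).+1 * s))
    (maxn (mx ((l %/ s).+1 * s) (r %/ s * s)) (mx (r %/ s * s) r)).
Proof.
move=> H.
have H1 : l <= (l %/ s).+1 * s by rewrite ltnW // ltn_ceil.
have H2 : (l %/ s).+1 * s <= r %/ s * s by rewrite leq_mul2r H orbT.
have H3 := leq_trunc_div r s.
by rewrite (@mx_cat l _ r (_ : l <= (l %/ s).+1 * s <= r)) ?H1 ?(leq_trans H2) //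
  (@mx_cat _ (r %/ s * s) r) ?H2.
Qed.

End Blocks.
End RangeMax.

Section Tournament.
Variables (T : nat -> nat) (n : nat).
Hypothesis n_gt0 : 0 < n.

(** In heap numbering the leaves are [n] to [n.*2.-1], and [n] need not be a power of two: the
    children of each inner node are again nodes below [n.*2]. *)
Lemma tournament_max :
  (forall i, 0 < i < n -> T i = maxn (T i.*2) (T i.*2.+1)) ->
  (forall i, n <= i < n.*2 -> T i <= T 1) /\
  exists2 i, n <= i < n.*2 & T i = T 1.
Proof.
move=> H; split.
  suff: forall i, 0 < i < n.*2 -> T i <= T 1 by move=> + i Hi; apply; lia.
  move=> i; have [k] := ubnP i; elim: k i => // k IH i ik Hi.
  have [->|i1] := eqVneq i 1; first exact: leqnn.
  have i2 : 0 < i./2 < n by lia.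
  apply: leq_trans (IH _ _ (_ : 0 < i./2 < n.*2)); last 2 first.
  - by lia.
  - by lia.
  rewrite (H _ i2) -{1}(odd_double_half i) leq_max.
  by case: (odd i); rewrite ?add1n ?add0n leqnn ?orbT.
suff: forall i, 0 < i < n.*2 -> exists2 j, n <= j < n.*2 & T j = T i.
  by apply; lia.
move=> i; have [k] := ubnP (n.*2 - i); elim: k i => // k IH i ik Hi.
have [ni|lt] := leqP n i; first by exists i => //; lia.
rewrite H; last by lia.
by case: (leqP (T i.*2) (T i.*2.+1)) => _; apply: IH; lia.
Qed.

End Tournament.

End RangeMax.
Import RangeMax.

Implicit Types (e : nat -> nat) (m : nat -> nat -> nat) (o : seq nat) (t : nat).

(** * The program for range maxima *)

Module RangeMaxProgram.

Implicit Types Q : state -> Prop.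

Arguments wp : simpl never.
Arguments maxn : simpl never.

Section Rules.
Variables (w : nat) (P : seq nat).
Notation wp := (wp w P).
Notation ok := (ok w P).
Notation ev := (ev w P).

Lemma wp_seq (a b : cmd) Q (st : state) :
  wp a (wp b Q) st -> wp (Seq a b) Q st.
Proof. by case: st. Qed.

(** The value is a separate argument, so that it can be brought into closed form before it enters
    the state. *)
Lemma wp_set d (a : expr) Q e m o t v :
  ok (State e m o t) a -> ev (State e m o t) a = v ->
  Q (State (upd e d v) m o (t + (ecost a + 1))) ->
  wp (Set_ d a) Q (State e m o t).
Proof. by move=> H <-. Qed.

Lemma wp_assign d (a : expr) (b : cmd) Q e m o t v :
  ok (State e m o t) a -> ev (State e m o t) a = v ->
  wp b Q (State (upd e d v) m o (t + (ecost a + 1))) ->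
  wp (Seq (Set_ d a) b) Q (State e m o t).
Proof. by move=> H <-. Qed.

Lemma wp_store c (a b : expr) Q e m o t r v :
  ok (State e m o t) a -> ok (State e m o t) b ->
  ev (State e m o t) a = r -> ev (State e m o t) b = v ->
  r * ncol + c < 2 ^ w ->
  Q (State e (mupd m c r v) o (t + (ecost a + ecost b + 5))) ->
  wp (St c a b) Q (State e m o t).
Proof. by move=> H1 H2 <- <-. Qed.

Lemma wp_out (a : expr) Q e m o t v :
  ok (State e m o t) a -> ev (State e m o t) a = v ->
  Q (State e m (rcons o v) (t + (ecost a + 1))) ->
  wp (Out a) Q (State e m o t).
Proof. by move=> H <-. Qed.

Lemma wp_if (a : expr) (c1 c2 : cmd) Q e m o t (b : bool) :
  ok (State e m o t) a -> (ev (State e m o t) a != 0) = b ->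
  (if b then wp c1 Q (State e m o (t + (ecost a + 3)))
   else wp c2 Q (State e m o (t + (ecost a + 1)))) ->
  wp (If a c1 c2) Q (State e m o t).
Proof.
move=> H <- H2; rewrite /Machine.wp -/wp; split=> //.
by case: (Machine.ev _ _ _ _) H2.
Qed.

Lemma wp_while (a : expr) (b : cmd) Q (Inv : nat -> state -> Prop)
    k (st : state) :
  Inv k st ->
  (forall k e m o t, Inv k (State e m o t) ->
     ok (State e m o t) a /\
     if ev (State e m o t) a != 0 then
       exists2 k', k = k'.+1 & wp b (Inv k') (State e m o (t + (ecost a + 3)))
     else Q (State e m o (t + (ecost a + 1)))) ->
  wp (While a b) Q st.
Proof.
case: st => e m o t HI H; rewrite /Machine.wp -/wp; exists Inv; first by exists k.
move=> k' [e' m' o' t'] /H [oka H2]; split=> //.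
by case: (Machine.ev _ _ _ _) H2.
Qed.

End Rules.

(** Register 39 is a dummy that no program reads. *)
Definition skip : cmd := Set_ 39 (K 0).
Definition set_max (d u : nat) : cmd := If (Ar LtO (V d) (V u)) (Set_ d (V u)) skip.

Declare Scope cmd_scope.
Delimit Scope cmd_scope with cmd.
Notation "a ;; b" := (Seq a b) (at level 90, right associativity) : cmd_scope.
Notation "a +' b" := (Ar AddO a b) (at level 50, left associativity).
Notation "a -' b" := (Ar SubO a b) (at level 50, left associativity).
Notation "a *' b" := (Ar MulO a b) (at level 40, left associativity).
Notation "a /' b" := (Ar DivO a b) (at level 40, left associativity).
Notation "a <' b" := (Ar LtO a b) (at level 70).
Notation "a ==' b" := (Ar EqO a b) (at level 70).

(* Columns of the memory table; their contents in the index are given by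
   [column] below.  Nodes are rows of the columns [cMAXL] to [cLLEN], buckets
   and entries of the hash tables are rows of [cBA] to [cCHILD], list items are
   rows of [cXPOS] to [cIMX], and the columns from [cRK] on serve range maxima
   over the links.  The tournament tree ([cTREE]) and its intervals ([cLO],
   [cHI]) are working space, in the rows from [N] on. *)
Notation cHDR := 0 (only parsing).
Notation cTXT := 1 (only parsing).
Notation cMAXL := 2 (only parsing).
Notation cHA := 3 (only parsing).
Notation cHS := 4 (only parsing).
Notation cHB := 5 (only parsing).
Notation cTX := 6 (only parsing).
Notation cSL := 7 (only parsing).
Notation cSP := 8 (only parsing).
Notation cEP := 9 (only parsing).
Notation cDEP := 10 (only parsing).
Notation cLPTR := 11 (only parsing).
Notation cLLEN := 12 (only parsing).
Notation cBA := 13 (only parsing).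
Notation cBS := 14 (only parsing).
Notation cBB := 15 (only parsing).
Notation cKEY := 16 (only parsing).
Notation cCHILD := 17 (only parsing).
Notation cXPOS := 18 (only parsing).
Notation cDLO := 19 (only parsing).
Notation cDHI := 20 (only parsing).
Notation cILO := 21 (only parsing).
Notation cIHI := 22 (only parsing).
Notation cIMX := 23 (only parsing).
Notation cRK := 24 (only parsing).
Notation cSUF := 25 (only parsing).
Notation cPRE := 26 (only parsing).
Notation cCODE := 27 (only parsing).
Notation cDOC := 28 (only parsing).
Notation cPOS := 29 (only parsing).
Notation cTBL := 30 (only parsing).
Notation cLOG := 31 (only parsing).
Notation cPOW := 32 (only parsing).
Notation cSPT := 33 (only parsing).
Notation cTREE := 34 (only parsing).
Notation cLO := 35 (only parsing).
Notation cHI := 36 (only parsing).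

Notation vk := 0 (only parsing).
Notation vp := 1 (only parsing).
Notation vN := 2 (only parsing).
Notation vn := 3 (only parsing).
Notation vs := 4 (only parsing).
Notation vcur := 6 (only parsing).
Notation vi := 7 (only parsing).
Notation vok := 8 (only parsing).
Notation vc := 9 (only parsing).
Notation vb := 10 (only parsing).
Notation ve := 11 (only parsing).
Notation vx := 12 (only parsing).
Notation vkk := 13 (only parsing).
Notation vLP := 14 (only parsing).
Notation vLL := 15 (only parsing).
Notation vNT := 16 (only parsing).
Notation vsp := 17 (only parsing).
Notation vep := 18 (only parsing).
Notation vdep := 19 (only parsing).
Notation vq := 20 (only parsing).
Notation vv := 21 (only parsing).
Notation vlo := 22 (only parsing).
Notation vhi := 23 (only parsing).
Notation vr := 24 (only parsing).
Notation vj := 25 (only parsing).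
Notation vrho := 26 (only parsing).
Notation vm := 27 (only parsing).
Notation va := 28 (only parsing).
Notation vl := 29 (only parsing).
Notation vrr := 30 (only parsing).
Notation vres := 31 (only parsing).
Notation vbl := 32 (only parsing).
Notation vbr := 33 (only parsing).
Notation vu := 34 (only parsing).
Notation vt := 35 (only parsing).

Definition range_max : cmd := (
  Set_ vres (K 0);;
  If (V vl <' V vrr) (
    Set_ vbl (V vl /' V vs);;
    Set_ vbr (V vrr /' V vs);;
    If (V vbl ==' V vbr)
      (Set_ vu (Ld cCODE (V vrr));;
       Set_ vu (Ld cTBL (V vu +' (V vl -' V vbl *' V vs)));;
       Set_ vres (Ld cRK (V vbl *' V vs +' V vu)))
      (Set_ vres (Ld cSUF (V vl));;
       Set_ vu (Ld cPRE (V vrr));;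
       set_max vres vu;;
       Set_ vbl (V vbl +' K 1);;
       If (V vbl <' V vbr)
         (Set_ vt (V vbr -' V vbl);;
          Set_ vu (Ld cSPT (Ld cLOG (V vt) +' V vbl));;
          set_max vres vu;;
          Set_ vu (Ld cSPT (Ld cLOG (V vt) +' (V vbr -' Ld cPOW (V vt))));;
          set_max vres vu)
         skip))
    skip)%cmd.

Lemma eqb_lt a b : a < b -> Nat.eqb a b = false.
Proof. by move=> H; apply/PeanoNat.Nat.eqb_neq; lia. Qed.

Ltac upd_other :=
  rewrite /upd; repeat match goal with |- context [Nat.eqb ?a ?b] =>
    have -> : Nat.eqb a b = false by
      apply: eqb_lt; match goal with H : is_true (leq (S a) _) |- _ => apply: (leq_trans H); done end
  end.

Section RangeMaxProgram.
Variables (w : nat) (P : seq nat) (N : nat) (A : nat -> nat -> nat).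
Variables (rk : nat -> nat) (M s NB : nat).
Hypothesis HW : 1000 * (N * N) + 1000 <= 2 ^ w.
Notation wp := (wp w P).

(** Ranges are half-open, so the prefix columns extend to row [M]. [cCODE] and [cLOG] hold values
    already multiplied by the row lengths of the tables that they address. *)
Record rmq_index : Prop := RmqIndex {
  rmq_s : 0 < s;
  rmq_M : M + s <= N;
  rmq_rk : forall i, i < N -> A cRK i = rk i;
  rmq_suf : forall l, l <= M -> A cSUF l = mx rk l ((l %/ s).+1 * s);
  rmq_pre : forall r, r <= M -> A cPRE r = mx rk ((r %/ s) * s) r;
  rmq_code : forall r, r <= M -> A cCODE r = code rk s r * s;
  rmq_code_size : 2 ^ s * s <= N;
  rmq_tbl : forall c j, c < 2 ^ s -> j < s -> A cTBL (c * s + j) = first_from s c j;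
  rmq_NB : M %/ s < NB;
  rmq_log : forall l, 0 < l <= M -> A cLOG l = trunc_log 2 l * NB /\
     A cPOW l = 2 ^ trunc_log 2 l;
  rmq_spt_size : forall l, 0 < l <= M %/ s -> (trunc_log 2 l).+1 * NB <= N;
  rmq_spt : forall l b, 0 < l <= M %/ s -> b < NB ->
    A cSPT (trunc_log 2 l * NB + b) = mx rk (b * s) ((b + 2 ^ trunc_log 2 l) * s)
}.
Hypothesis I : rmq_index.

Definition holds_index m : Prop :=
  forall c r, c < ncol -> r < N -> m c r = A c r.

(** Registers are numbered by lifetime: a routine changes only those from some [d] on, and its
    callers keep lasting values below. *)
Definition keeps (d : nat) (e e' : nat -> nat) : Prop := forall x, x < d -> e' x = e x.

Lemma N_small : N <= 2 ^ w. Proof. by move: HW; nia. Qed.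

(** Besides the index, this covers the working space, whose rows lie between [N] and [4 * N]. *)
Lemma addr_small r c : r <= 4 * N -> c < ncol -> r * ncol + c < 2 ^ w.
Proof. by move: HW; rewrite /ncol; nia. Qed.

Lemma cell_small r c : r < N -> c < ncol -> r * ncol + c < 2 ^ w.
Proof. by move=> H; apply: addr_small; lia. Qed.

Lemma ltNW x : x < N -> x < 2 ^ w.
Proof. by move=> H; apply: leq_trans N_small. Qed.

Lemma set_max_spec d u Q e m o t :
  d < 39 -> u < 39 ->
  (forall e' t', (forall x, x < 39 -> e' x = upd e d (maxn (e d) (e u)) x) ->
     t' <= t + 10 -> Q (State e' m o t')) ->
  wp (set_max d u) Q (State e m o t).
Proof.
move=> d39 u39 H; apply: wp_if => //=.
case: ltnP => /= ud.
- apply: wp_set => //=; apply: H => /=; last by lia.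
  by move=> x _; rewrite /upd; case: ifP => // _; lia.
- apply: wp_set => //=; first by move: HW; lia.
  apply: H => /=; last by lia.
  move=> x x39; rewrite /upd; case: PeanoNat.Nat.eqb_spec => [|_]; first by lia.
  by case: PeanoNat.Nat.eqb_spec => // ->; lia.
Qed.

Lemma range_max_spec l r Q e m o t :
  holds_index m -> l <= M -> r <= M -> e vl = l -> e vrr = r -> e vs = s ->
  (forall e' t', keeps 31 e e' -> e' vres = mx rk l r -> t' <= t + 200 ->
     Q (State e' m o t')) ->
  wp range_max Q (State e m o t).
Proof.
move=> Hm lM rM El Er Es H.
have [s0 MN] := (rmq_s I, rmq_M I).
have adr := cell_small.
have NW := N_small.
have sl := leq_trunc_div l s; have sr := leq_trunc_div r s.
apply: wp_assign => //=; first by move: HW; lia.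
apply: wp_if => //=; rewrite /upd /= El Er eqb0 negbK.
case: ltnP => /= lr; last first.
  apply: wp_set => //=; first by move: HW; lia.
  apply: H => /=; last by lia.
    by move=> x x31; upd_other.
  by rewrite mx_nil.
apply: wp_assign => //=; rewrite /upd /= El Es.
apply: wp_assign => //=; rewrite /upd /= Er Es.
apply: wp_if => //=; rewrite /upd /= eqb0 negbK.
case: eqVneq => /= Eb.
- apply: wp_assign => //=.
    by split=> //; rewrite Er; apply: adr => //; lia.
  rewrite Er Hm //; last by lia.
  rewrite (rmq_code I) //.
  have cl := code_lt rk s r.
  have ol : l - l %/ s * s = l %% s by rewrite {1}(divn_eq l s) addKn.
  have ls : l %% s < s by rewrite ltn_mod.
  have cs : code rk s r * s + l %% s < N.
    apply: leq_trans (rmq_code_size I).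
    apply: (@leq_trans ((code rk s r).+1 * s)); last by rewrite leq_mul2r cl orbT.
    by rewrite mulSn addnC ltn_add2r.
  apply: wp_assign => //=.
    rewrite /upd /= El Es; split.
      by split=> //; [split=> //; split=> //; lia | rewrite ol; lia].
    by rewrite ol; apply: adr => //; lia.
  rewrite /upd /= El Es ol Hm // (rmq_tbl I) //.
  have [Hi Ei] := block_max rk s0 lr Eb.
  apply: wp_set => //=.
    rewrite /upd /= Es; split; last by apply: adr => //; lia.
    by split=> //; [split=> //; lia | lia].
  rewrite /upd /= Es Hm //; last by lia.
  rewrite (rmq_rk I) ?Ei; last by lia.
  apply: H => /=; last by lia.
    by move=> x x31; upd_other.
  by [].
have lbr : l %/ s < r %/ s by rewrite ltn_neqAle Eb leq_div2r // ltnW.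
have rB : r %/ s <= M %/ s by rewrite leq_div2r.
have BM : M %/ s <= M by apply: leq_div.
have BMN : M %/ s < N by apply: leq_ltn_trans BM _; lia.
have BNB := rmq_NB I.
apply: wp_assign => //=.
  by split=> //; rewrite El; apply: adr => //; lia.
rewrite El Hm //; last by lia.
rewrite (rmq_suf I) //.
apply: wp_assign => //=.
  by split=> //; rewrite /upd /= Er; apply: adr => //; lia.
rewrite /upd /= Er Hm //; last by lia.
rewrite (rmq_pre I) //.
apply: wp_seq; apply: set_max_spec => // e1 t1 He1 Ht1.
have E1bl : e1 vbl = l %/ s by rewrite He1.
have E1br : e1 vbr = r %/ s by rewrite He1.
have E1res : e1 vres = maxn (mx rk l ((l %/ s).+1 * s)) (mx rk (r %/ s * s) r) by rewrite He1.
have K1 : keeps 31 e e1.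
  move=> x x31; rewrite He1; last by lia.
  by upd_other.
apply: wp_assign => //=.
  by split=> //; [move: HW; lia | rewrite E1bl; lia].
rewrite E1bl addn1.
apply: wp_if => //=; rewrite /upd /= E1br eqb0 negbK.
have Ecr := cross_max rk s0 lbr.
case: ltnP => /= mid; last first.
  apply: wp_set => //=; first by move: HW; lia.
  apply: H => /=; last by move: Ht1 => /=; lia.
    move=> x x31; rewrite -K1 // /upd.
    by upd_other.
  rewrite /upd /= E1res Ecr [mx rk ((l %/ s).+1 * s) (r %/ s * s)]mx_nil ?max0n //.
  by rewrite leq_mul2r mid orbT.
set bl := (l %/ s).+1 in E1res Ecr mid *; set br := r %/ s in lbr rB E1br Ecr mid E1res *.
have brNB : br < NB by apply: leq_ltn_trans BNB.
have blNB : bl < NB by apply: ltn_trans mid brNB.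
set d := br - bl.
have br2NB k : br - k < NB by apply: leq_ltn_trans brNB; apply: leq_subr.
have Hd : 0 < d <= M %/ s by rewrite /d subn_gt0 mid (leq_trans (leq_subr _ _) rB).
have HdM : 0 < d <= M by case/andP: Hd => -> /leq_trans ->.
have [Elog Epow] := rmq_log I HdM.
have Hspt := rmq_spt_size I Hd.
have spt := rmq_spt I Hd.
have /andP[tl1 tl2] : 2 ^ trunc_log 2 d <= d < 2 ^ (trunc_log 2 d).+1.
  by apply: trunc_log_bounds => //; case/andP: Hd.
have tb : 2 ^ trunc_log 2 d <= br by apply: (leq_trans tl1); apply: leq_subr.
set T := trunc_log 2 d in tb Elog Epow Hspt spt tl1 tl2.
have dN : d < N by apply: leq_ltn_trans BMN; case/andP: Hd.
have lt1 : T * NB + bl < N.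
  by apply: leq_trans Hspt; rewrite mulSn addnC ltn_add2r.
have lt2 : T * NB + (br - 2 ^ T) < N.
  by apply: leq_trans Hspt; rewrite mulSn addnC ltn_add2r.
apply: wp_assign => //=.
  by rewrite /upd /= E1br; split=> //; lia.
rewrite /upd /= E1br -/d.
apply: wp_assign => //=.
  rewrite /upd /= Hm // Elog; split; last exact: adr.
  by split=> //; [split=> //; apply: adr | apply: ltNW].
rewrite /upd /= [m cLOG _]Hm // Elog Hm // spt //.
apply: wp_seq; apply: set_max_spec => // e2 t2 He2 Ht2.
have E2br : e2 vbr = br by rewrite He2.
have E2t : e2 vt = d by rewrite He2.
have E2res : e2 vres = maxn (maxn (mx rk l (bl * s)) (mx rk (br * s) r))
   (mx rk (bl * s) ((bl + 2 ^ T) * s)) by rewrite He2 //= /upd /= E1res.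
have K2 : keeps 31 e e2.
  move=> x x31; rewrite He2; last by lia.
  rewrite -K1 // /upd.
  by upd_other.
apply: wp_assign => //=.
  rewrite E2t E2br [m cLOG _]Hm // [m cPOW _]Hm // Elog Epow.
  split; last exact: adr.
  split; [by split=> //; apply: adr | | exact: ltNW].
  by split=> //; split=> //; apply: adr.
rewrite E2t E2br [m cLOG _]Hm // [m cPOW _]Hm // Elog Epow Hm // spt //.
apply: set_max_spec => // e3 t3 He3 Ht3.
apply: H; last by clear -Ht1 Ht2 Ht3; lia.
- move=> x x31; rewrite He3; last by lia.
  rewrite -K2 // /upd.
  by upd_other.
- rewrite He3 // /upd /= E2res Ecr.
  rewrite (@sparse_max rk s s0 bl br T) ?tl1 //.
  rewrite (subnK tb).
  by move: (mx _ _ _) (mx _ _ _) (mx _ _ _) (mx _ _ _) => x1 x2 x3 x4; clear; lia.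
Qed.

End RangeMaxProgram.

End RangeMaxProgram.
Import RangeMaxProgram.

(** * The tournament tree over the intervals *)

Module SlotTree.

Implicit Types Q : state -> Prop.

Definition pull : cmd := (
  Set_ vt (Ld cTREE (V vN +' V vbl *' K 2));;
  Set_ vu (Ld cTREE (V vN +' (V vbl *' K 2 +' K 1)));;
  set_max vt vu;;
  St cTREE (V vN +' V vbl) (V vt))%cmd.

Definition climb : cmd := (
  While (K 1 <' V vbl) (Set_ vbl (V vbl /' K 2);; pull))%cmd.

Definition build : cmd := (
  Set_ vbl (V vNT);;
  While (K 1 <' V vbl) (Set_ vbl (V vbl -' K 1);; pull))%cmd.

(** A leaf packs the largest rank of its interval and the slot number into one word: comparison is
    by rank first, and division by [N] with remainder recovers both. *)
Definition set_slot : cmd := (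
  St cLO (V vN +' V va) (V vl);;
  St cHI (V vN +' V va) (V vrr);;
  range_max;;
  St cTREE (V vN +' (V vNT +' V va)) (V vres *' V vN +' V va);;
  Set_ vbl (V vNT +' V va);;
  climb)%cmd.

(** Slot [q] keeps the part of its interval before the reported link, and the fresh slot [LL + j]
    gets the part after it. Ranks of links are positive, so a maximum of 0 means that nothing is
    left. *)
Definition pop_loop : cmd := (
  While (V vj <' V vkk)
    (Set_ vv (Ld cTREE (V vN +' K 1));;
     Set_ vrho (V vv /' V vN);;
     Set_ vq (Ar ModO (V vv) (V vN));;
     If (V vrho)
       (Out (Ld cDOC (V vrho));;
        Set_ vm (Ld cPOS (V vrho));;
        Set_ vhi (Ld cHI (V vN +' V vq));;
        Set_ va (V vq);;
        Set_ vl (Ld cLO (V vN +' V vq));;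
        Set_ vrr (V vm);;
        set_slot;;
        Set_ va (V vLL +' V vj);;
        Set_ vl (V vm +' K 1);;
        Set_ vrr (V vhi);;
        set_slot;;
        Set_ vj (V vj +' K 1))
       (Set_ vj (V vkk))))%cmd.

Arguments range_max : simpl never.
Arguments pull : simpl never.
Arguments build : simpl never.
Arguments climb : simpl never.
Arguments set_slot : simpl never.
Arguments pop_loop : simpl never.

Section TopK.
Variables (w : nat) (P : seq nat) (N : nat) (A : nat -> nat -> nat).
Variables (rk : nat -> nat) (M s NB : nat).
Hypothesis HW : 1000 * (N * N) + 1000 <= 2 ^ w.
Hypothesis I : rmq_index N A rk M s NB.
Hypothesis rk_lt : forall i, rk i < N.
Notation wp := (wp w P).
Notation holds_index := (holds_index N A).

Definition tree_node m (j : nat) : Prop :=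
  m cTREE (N + j) = maxn (m cTREE (N + j.*2)) (m cTREE (N + j.*2.+1)).

Definition tree_ok m (NT : nat) : Prop :=
  forall j, 0 < j < NT -> tree_node m j.

Definition leaf_ok m (NT : nat) : Prop :=
  forall q, q < NT ->
    m cTREE (N + (NT + q)) = mx rk (m cLO (N + q)) (m cHI (N + q)) * N + q.

Definition ancestor (j i : nat) : Prop := exists f, j = i %/ 2 ^ f.+1.

Lemma mupd_same m c r v : mupd m c r v c r = v.
Proof. by rewrite /mupd PeanoNat.Nat.eqb_refl eqxx. Qed.

Lemma mupd_row m c r v c' r' :
  r' != r -> mupd m c r v c' r' = m c' r'.
Proof. by rewrite /mupd => /negPf ->; case: ifP. Qed.

Lemma mupd_col m c r v c' r' :
  Nat.eqb c' c = false -> mupd m c r v c' r' = m c' r'.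
Proof. by rewrite /mupd => ->. Qed.

Lemma holds_index_upd m c r v :
  holds_index m -> N <= r -> holds_index (mupd m c r v).
Proof.
move=> Hm Nr c' r' Hc Hr; rewrite mupd_row; first exact: Hm.
by apply: contraTneq Hr => ->; rewrite -leqNgt.
Qed.

Lemma small_value x : x <= 4 * N -> x < 2 ^ w.
Proof.
move=> H; apply: leq_ltn_trans (addr_small HW H (isT : 0 < ncol)).
by rewrite /ncol; lia.
Qed.

Lemma pull_spec h NT Q e m o t :
  e vN = N -> e vbl = h -> NT <= N -> 0 < h < NT ->
  (forall e' m' t', keeps 31 e e' -> e' vbl = h -> tree_node m' h ->
     (forall c r, (c != cTREE) || (r != N + h) -> m' c r = m c r) ->
     t' <= t + 50 -> Q (State e' m' o t')) ->
  wp pull Q (State e m o t).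
Proof.
move=> EN Eh NTN /andP[h0 hN] H.
have W0 := HW.
have W2 : 2 < 2 ^ w by clear -W0; lia.
have W1 : 1 < 2 ^ w by clear -W0; lia.
have s1 : N + h * 2 <= 4 * N by clear -hN NTN; lia.
have s2 : N + (h * 2 + 1) <= 4 * N by clear -hN NTN; lia.
have adr := addr_small HW.
have small := small_value.
have h2s : h * 2 < 2 ^ w by apply: small; clear -s1; lia.
have h2s' : h * 2 + 1 < 2 ^ w by apply: small; clear -s2; lia.
apply: wp_assign => //=.
  rewrite EN Eh; split; last exact: adr.
  by split=> //; apply: small.
rewrite EN Eh.
apply: wp_assign => //=.
  rewrite /upd /= EN Eh; split; last exact: adr.
  by split=> //; apply: small.
rewrite /upd /= EN Eh.
apply: wp_seq; apply: (set_max_spec P W0) => // e1 t1 He1 Ht1.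
have E1N : e1 vN = N by rewrite He1.
have E1bl : e1 vbl = h by rewrite He1.
have E1t : e1 vt = maxn (m 34 (N + h * 2)) (m 34 (N + (h * 2 + 1))) by rewrite He1.
apply: (@wp_store _ _ _ _ _ _ _ _ _ _ (N + h)
  (maxn (m 34 (N + h * 2)) (m 34 (N + (h * 2 + 1))))) => //=; rewrite ?E1N ?E1bl //.
- by split=> //; apply: small; clear -s1; lia.
- by apply: adr => //; clear -s1; lia.
apply: H => //.
- move=> x x31; rewrite He1; last by apply: (leq_trans x31).
  by upd_other.
- rewrite /tree_node mupd_same !mupd_row; [by rewrite -!muln2 addn1| |];
    by apply/eqP; clear -h0; lia.
- move=> c r; case: (eqVneq c 34) => [->|c34] /= Hcr; first by rewrite mupd_row.
  by rewrite mupd_col //; apply/PeanoNat.Nat.eqb_neq/eqP.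
- by clear -Ht1; move: Ht1 => /=; lia.
Qed.

(** Nodes are visited in decreasing order, so the children of a node are final when it is
    computed. *)
Lemma build_spec NT Q e m o t :
  e vN = N -> e vNT = NT -> 0 < NT <= N ->
  (forall e' m' t', keeps 31 e e' -> tree_ok m' NT ->
     (forall c r, [|| c != cTREE, r < N | N + NT <= r] -> m' c r = m c r) ->
     t' <= t + 80 * NT -> Q (State e' m' o t')) ->
  wp build Q (State e m o t).
Proof.
move=> EN ENT /andP[NT0 NTN] H.
have W0 := HW.
have W1 : 1 < 2 ^ w by clear -W0; lia.
apply: wp_assign => //=; rewrite ENT.
pose Inv k st := let: State e' m' o' t' := st in
  [/\ keeps 31 e e', o' = o,
    (forall c r, [|| c != cTREE, r < N | N + NT <= r] -> m' c r = m c r),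
    (e' vbl = k.+1 /\ k < NT /\ forall j, k < j < NT -> tree_node m' j)
    & t' + 80 * k <= t + 2 + 80 * NT.-1].
apply: (@wp_while _ _ _ _ _ Inv NT.-1).
  split=> //; first by move=> x x31; upd_other.
    split; rewrite /upd /= ?prednK //; split=> // j; lia.
move=> k e' m' o' t' [Ke -> Hm' [Ei' [kN Hk]] Ht].
have EN' : e' vN = N by rewrite Ke.
split; first by split.
rewrite /= Ei' eqb0 negbK ltnS.
case: k kN Hk Ei' Ht => [|k] kN Hk Ei' Ht /=.
  apply: H => //.
  by clear -Ht NT0; lia.
exists k => //.
apply: wp_assign => //=; first by rewrite Ei'.
rewrite Ei' subn1 /=.
apply: (@pull_spec k.+1 NT) => //.
move=> e2 m2 t2 K2 E2 Hn Hm2 T2.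
split=> //.
- by move=> x x31; rewrite K2 //; upd_other; apply: Ke.
- move=> c r Hcr; rewrite Hm2 ?Hm' //; apply: contraTT Hcr.
  by rewrite negb_or !negbK => /andP[-> /eqP ->] /=; clear -kN; lia.
- split=> //; split; first exact: ltnW.
  move=> j Hj; have [->//|jk] := eqVneq j k.+1.
  rewrite /tree_node !Hm2; first by apply: Hk; clear -Hj jk; lia.
  + by apply/orP; right; clear -Hj jk; lia.
  + by apply/orP; right; clear -Hj jk; lia.
  + by apply/orP; right; clear -Hj jk; lia.
- by clear -T2 Ht; lia.
Qed.

(** Only the nodes above [i] may be wrong. Once the parent of the current node is repaired, only the
    proper ancestors of that parent are left, and [i < 2 ^ K.+1] allows at most [K] steps. *)
Lemma climb_spec i K NT Q e m o t :
  e vN = N -> e vbl = i -> NT <= N -> 0 < i < NT.*2 -> i < 2 ^ K.+1 ->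
  (forall j, 0 < j < NT -> ~ ancestor j i -> tree_node m j) ->
  (forall e' m' t', keeps 31 e e' -> tree_ok m' NT ->
     (forall c r, [|| c != cTREE, r < N | N + NT <= r] -> m' c r = m c r) ->
     t' <= t + 80 * K.+1 -> Q (State e' m' o t')) ->
  wp climb Q (State e m o t).
Proof.
move=> EN Ei NTN Hi iK Hanc H.
pose Inv k st := let: State e' m' o' t' := st in
  [/\ keeps 31 e e', o' = o,
    (forall c r, [|| c != cTREE, r < N | N + NT <= r] -> m' c r = m c r),
    (exists i', [/\ e' vbl = i', 0 < i' < NT.*2, i' < 2 ^ k.+1 &
      (forall j, 0 < j < NT -> ~ ancestor j i' -> tree_node m' j)])
    & t' + 80 * k <= t + 80 * K].
apply: (@wp_while _ _ _ _ _ Inv K); first by split=> //; exists i.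
move=> k e' m' o' t' [Ke -> Hm' [i' [Ei' Hi' ik Hanc']] Ht].
have EN' : e' vN = N by rewrite Ke.
have W0 := HW.
have W2 : 2 < 2 ^ w by clear -W0; lia.
have W1 : 1 < 2 ^ w by clear -W0; lia.
split; first by split.
rewrite /= Ei' eqb0 negbK.
case: ltnP => /= i1; last first.
  apply: H => //; last by clear -Ht; lia.
  move=> j Hj; apply: Hanc' => // [[f Ef]]; move: Hj; rewrite Ef divn_small //.
  rewrite (leq_ltn_trans i1) // expnS; have : 0 < 2 ^ f by rewrite expn_gt0.
  by clear; lia.
case: k ik Ht => [|k] ik Ht; first by clear -i1 ik; lia.
exists k => //.
set h := i' %/ 2.
have Eh : h = i'./2 by rewrite /h divn2.
have h0 : 0 < h by rewrite Eh; clear -i1; lia.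
have hN : h < NT by rewrite Eh; clear -Hi'; lia.
apply: wp_assign => //=; rewrite Ei' -/h.
apply: (@pull_spec h NT) => //; first by rewrite h0.
move=> e2 m2 t2 K2 E2 Hn Hm2 T2.
split=> //.
- by move=> x x31; rewrite K2 //; upd_other; apply: Ke.
- move=> c r Hcr; rewrite Hm2 ?Hm' //; apply: contraTT Hcr.
  by rewrite negb_or !negbK => /andP[-> /eqP ->] /=; clear -hN; lia.
- exists h; split=> //.
  + by rewrite h0 /=; clear -hN; lia.
  + by rewrite Eh; move: ik; rewrite !expnS; move: (2 ^ k) => z; clear; lia.
  + move=> j Hj Hnanc; have [->//|jh] := eqVneq j h.
    have ne1 : j.*2 != h.
      apply/eqP => E3; apply: Hnanc; exists 0; rewrite divn2; clear -E3; lia.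
    have ne2 : j.*2.+1 != h.
      apply/eqP => E3; apply: Hnanc; exists 0; rewrite divn2; clear -E3; lia.
    rewrite /tree_node !Hm2 ?eqn_add2l ?ne1 ?ne2 ?jh //.
    apply: Hanc' => // [[f Ef]].
    case: f Ef => [|f] Ef; first by move: jh; rewrite Ef eqxx.
    by apply: Hnanc; exists f; rewrite Ef [in RHS]/h -divnMA -expnS.
- by clear -Ht T2; lia.
Qed.

Lemma mx_lt l r : mx rk l r < N.
Proof.
have N0 : 0 < N by apply: leq_ltn_trans (rk_lt 0).
by rewrite -(prednK N0) ltnS; apply: mx_leq => i _; rewrite -ltnS prednK.
Qed.

Lemma set_slot_spec a l r K NT Q e m o t :
  holds_index m -> tree_ok m NT -> leaf_ok m NT ->
  a < NT -> NT <= N -> NT.*2 <= 2 ^ K.+1 -> l <= M -> r <= M ->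
  e vN = N -> e vs = s -> e vNT = NT -> e va = a -> e vl = l -> e vrr = r ->
  (forall e' m' t', keeps 31 e e' -> holds_index m' -> tree_ok m' NT -> leaf_ok m' NT ->
     (forall q, m' cLO (N + q) = if q == a then l else m cLO (N + q)) ->
     (forall q, m' cHI (N + q) = if q == a then r else m cHI (N + q)) ->
     t' <= t + 300 + 80 * K.+1 -> Q (State e' m' o t')) ->
  wp set_slot Q (State e m o t).
Proof.
move=> Hm Ht Hl aNT NTN NTK lM rM EN Es ENT Ea El Er H.
have adr := addr_small HW.
have small := small_value.
have sNa : N + a <= 4 * N by clear -aNT NTN; lia.
have sNTa : N + (NT + a) <= 4 * N by clear -aNT NTN; lia.
have sTa : NT + a <= 4 * N by clear -aNT NTN; lia.
have W0 := HW.
apply: wp_seq; apply: (wp_store (r := N + a) (v := l)) => //=; rewrite ?EN ?Ea //.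
- by split=> //; apply: small.
- exact: adr.
apply: wp_seq; apply: (wp_store (r := N + a) (v := r)) => //=; rewrite ?EN ?Ea //.
- by split=> //; apply: small.
- exact: adr.
set m2 := mupd _ 36 _ _.
have Hm2 : holds_index m2 by do 2 (apply: holds_index_upd; rewrite ?leq_addr //).
apply: wp_seq; apply: (range_max_spec P W0 I Hm2 lM rM) => // e1 t1 K1 E1 Ht1.
have [E1N E1NT E1a] : [/\ e1 vN = N, e1 vNT = NT & e1 va = a] by rewrite !K1.
(* Packed leaves are below [N * N]; this is where words must have room for a square. *)
have vs1 : mx rk l r * N < 2 ^ w.
  by have := mx_lt l r; move: (mx _ _ _) => z; clear -W0; nia.
have vs2 : mx rk l r * N + a < 2 ^ w.
  by have := mx_lt l r; move: (mx _ _ _) => z; clear -W0 aNT NTN; nia.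
apply: wp_seq; apply: (wp_store (r := N + (NT + a)) (v := mx rk l r * N + a)) => //=;
  rewrite ?E1N ?E1NT ?E1a ?E1 //.
- by split=> //; [split=> //; apply: small | apply: small].
- exact: adr.
set m3 := mupd m2 _ _ _.
apply: wp_assign => //=.
  by rewrite E1NT E1a; split=> //; apply: small.
rewrite E1NT E1a.
have Hm3 : holds_index m3 by apply: holds_index_upd; rewrite ?leq_addr //.
apply: (@climb_spec (NT + a) K NT) => //.
- by clear -aNT; lia.
- by apply: leq_trans NTK; clear -aNT; lia.
- move=> j Hj Hn.
  have old x : m2 34 x = m 34 x by [].
  rewrite /tree_node.
  have ne x : x != NT + a -> m3 34 (N + x) = m 34 (N + x).
    by move=> xn; rewrite /m3 mupd_row ?old // eqn_add2l.
  have n1 : j != NT + a by apply/eqP; clear -Hj; lia.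
  have n2 : j.*2 != NT + a.
    by apply/eqP => E2; apply: Hn; exists 0; rewrite divn2; clear -E2; lia.
  have n3 : j.*2.+1 != NT + a.
    by apply/eqP => E2; apply: Hn; exists 0; rewrite divn2; clear -E2; lia.
  by rewrite (ne _ n1) (ne _ n2) (ne _ n3); apply: Ht.
move=> e' m' t' K' Ht' Hm' Htime.
have LOe q : m' cLO (N + q) = if q == a then l else m cLO (N + q).
  rewrite Hm' //= /m3 mupd_col // /m2 mupd_col //.
  by rewrite /mupd /= eqn_add2l.
have HIe q : m' cHI (N + q) = if q == a then r else m cHI (N + q).
  rewrite Hm' //= /m3 mupd_col // /m2.
  by rewrite /mupd /= eqn_add2l.
apply: H => //.
- move=> x x31; rewrite K' // -K1 //; by upd_other.
- by move=> c x Hc Hx; rewrite Hm' ?Hx ?orbT //; apply: Hm3.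
- move=> q Hq; rewrite LOe HIe Hm'; last first.
    by rewrite addnA leq_addr !orbT.
  have [->|qa] := eqVneq q a; first by rewrite /m3 mupd_same.
  by rewrite /m3 mupd_row ?eqn_add2l //; apply: Hl.
- by clear -Htime Ht1; move: Htime Ht1 => /=; lia.
Qed.

End TopK.

End SlotTree.
Import SlotTree.

(** * Extraction of the largest ranks *)

Module TopSlots.

Implicit Types Q : state -> Prop.

Section Pop.
Variables (w : nat) (P : seq nat) (N : nat) (A : nat -> nat -> nat).
Variables (rk : nat -> nat) (M s NB : nat).
Hypothesis HW : 1000 * (N * N) + 1000 <= 2 ^ w.
Hypothesis I : rmq_index N A rk M s NB.
Hypothesis rk_lt : forall i, rk i < N.
Hypothesis rk_pos : forall i, 0 < rk i -> i < M.
Hypothesis pos_rk : forall i, i < M -> A cPOS (rk i) = i.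
Notation wp := (wp w P).
Notation holds_index := (holds_index N A).

(** Counting by every predicate expresses that the ranks in all slots form the multiset [L]. *)
Definition slots_hold (lo hi : nat -> nat) (NT : nat) (L : seq nat) : Prop :=
  forall a : pred nat, \sum_(q < NT) count a (rg rk (lo q) (hi q)) = count a L.

Lemma slots_mem (lo hi : nat -> nat) NT (L : seq nat) x :
  slots_hold lo hi NT L ->
  x \in L <-> exists2 q, q < NT & x \in rg rk (lo q) (hi q).
Proof.
move=> H; rewrite -has_pred1 has_count -H lt0n sum_nat_eq0 negb_forall; split.
  case/existsP => q; rewrite /= -lt0n -has_count has_pred1 => Hq.
  by exists q.
case=> q qN Hx; apply/existsP; exists (Ordinal qN).
by rewrite /= -lt0n -has_count has_pred1.
Qed.

Lemma mem_rg_leq l r x : x \in rg rk l r -> x <= mx rk l r.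
Proof. by case/mapP => i; rewrite mem_iota => Hi ->; apply: leq_mx; lia. Qed.

Lemma slots_empty (lo hi : nat -> nat) NT (L : seq nat) :
  slots_hold lo hi NT L -> all (fun x => 0 < x) L ->
  (forall q, q < NT -> mx rk (lo q) (hi q) = 0) -> L = [::].
Proof.
case: L => // x L H /= /andP[x0 _] H0.
have [q qN xq] : exists2 q, q < NT & x \in rg rk (lo q) (hi q).
  by apply/(slots_mem x H); rewrite mem_head.
by have := mem_rg_leq xq; rewrite H0 //; lia.
Qed.

(** The head of the sorted [L] is the maximum over the slots. Cutting the interval of [q] at its
    position removes that one occurrence, and the empty slot [q'] takes the right part. *)
Lemma slots_pop (lo hi : nat -> nat) NT (L : seq nat) q q' :
  slots_hold lo hi NT L -> sorted geq L -> q < NT -> q' < NT -> hi q' <= lo q' ->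
  (forall x, x < NT -> mx rk (lo x) (hi x) <= mx rk (lo q) (hi q)) ->
  0 < mx rk (lo q) (hi q) ->
  let rho := mx rk (lo q) (hi q) in let m := A cPOS rho in
  [/\ lo q <= m < hi q, m < M, q != q',
     exists L', L = rho :: L' &
     slots_hold (fun x => if x == q' then m.+1 else if x == q then lo q else lo x)
       (fun x => if x == q' then hi q else if x == q then m else hi x) NT (behead L)].
Proof.
move=> H srt qN q'N e' Hmax rho0 rho m.
have ltq : lo q < hi q.
  by rewrite ltnNge; apply/negP => le; move: rho0; rewrite mx_nil.
have [i Hi Ei] := mx_attained rk ltq.
have iM : i < M by apply: rk_pos; rewrite Ei.
have Em : m = i by rewrite /m /rho -Ei pos_rk.
have qq' : q != q' by apply: contraTneq e' => <-; rewrite -ltnNge.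
have rhoL : rho \in L.
  apply/(slots_mem _ H); exists q => //; rewrite /rho -Ei; apply: map_f.
  by rewrite mem_iota; lia.
have Lle x : x \in L -> x <= rho.
  move=> /(slots_mem _ H) [y yN]; move=> /mem_rg_leq /leq_trans; apply; exact: Hmax.
have [L' EL] : exists L', L = rho :: L'.
  case: L srt rhoL Lle {H} => // y L' /= srt; rewrite inE => rhoL Lle.
  exists L'; congr cons; apply/eqP; rewrite eqn_leq Lle ?mem_head //=.
  case/orP: rhoL => [/eqP->|rhoL] //.
  by have /allP /(_ _ rhoL) := order_path_min (fun x y z H1 H2 => leq_trans H2 H1) srt.
split; rewrite ?Em //; first by exists L'.
move=> a; rewrite EL /=.
have Ha := H a; rewrite EL /= (bigD1 (Ordinal qN)) //= (bigD1 (Ordinal q'N)) /= in Ha; last first.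
  by rewrite -val_eqE /= eq_sym.
rewrite [rg rk (lo q') _]rg_nil //= add0n in Ha.
rewrite (bigD1 (Ordinal qN)) //= (bigD1 (Ordinal q'N)) /=; last first.
  by rewrite -val_eqE /= eq_sym.
move: Ha.
rewrite eqxx (negPf qq') !eqxx.
have -> : rg rk (lo q) (hi q) = rg rk (lo q) i ++ rk i :: rg rk i.+1 (hi q).
  rewrite (@rg_cat rk _ i) ?[rg rk i _]rg_cons //; lia.
rewrite count_cat /= Ei -/rho.
set S1 := \sum_(_ < _ | _) _; set S2 := \sum_(_ < _ | _) _.
have -> : S2 = S1.
  apply: eq_bigr => x /andP[]; rewrite -!val_eqE /= => /negPf -> /negPf -> //.
move: (count _ _) (count _ _) (count _ _) S1 (a rho : nat) => *; lia.
Qed.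

(** Each extraction updates two slots, and each update climbs at most [K.+1] levels at 80
    instructions. *)
Definition pop_cost (K : nat) : nat := 1000 + 160 * K.+1.

Lemma pop_loop_spec (L : seq nat) kk LL K NT Q e m o t :
  holds_index m -> tree_ok N m NT -> leaf_ok N rk m NT ->
  NT = LL + kk -> 0 < NT <= N -> NT.*2 <= 2 ^ K.+1 ->
  (forall q, q < NT -> m cLO (N + q) <= M /\ m cHI (N + q) <= M) ->
  (forall q, LL <= q < NT -> m cHI (N + q) <= m cLO (N + q)) ->
  slots_hold (fun q => m cLO (N + q)) (fun q => m cHI (N + q)) NT L ->
  sorted geq L -> all (fun x => 0 < x) L ->
  e vN = N -> e vs = s -> e vNT = NT -> e vLL = LL -> e vkk = kk -> e vj = 0 ->
  (forall e' m' t', holds_index m' -> t' <= t + 10 + pop_cost K * kk ->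
     Q (State e' m' (o ++ [seq A cDOC r | r <- take kk L]) t')) ->
  wp pop_loop Q (State e m o t).
Proof.
move=> Hm Ht Hl ENT NTb NTK Hb Hfree Hs srt pos EN Es ENT' ELL Ekk Ej H.
have W0 := HW; have adr := addr_small HW.
have small := small_value HW.
have N0 : 0 < N by clear -NTb; lia.
(* The first alternative is the early exit, where the ranks are exhausted and [vj] was set to [kk];
   in the second one [j] ranks have been reported and the slots hold the rest. *)
pose Inv k st := let: State e' m' o' t' := st in
  [/\ keeps 20 e e', holds_index m', t' + pop_cost K * k <= t + pop_cost K * kk &
   (e' vj = kk /\ o' = o ++ [seq A cDOC r | r <- take kk L]) \/
   exists j, [/\ e' vj = j /\ j + k = kk,
     o' = o ++ [seq A cDOC r | r <- take j L],
     tree_ok N m' NT, leaf_ok N rk m' NT &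
     [/\ forall q, q < NT -> m' cLO (N + q) <= M /\ m' cHI (N + q) <= M,
         forall q, LL + j <= q < NT -> m' cHI (N + q) <= m' cLO (N + q) &
         slots_hold (fun q => m' cLO (N + q)) (fun q => m' cHI (N + q)) NT (drop j L)]]].
apply: (@wp_while _ _ _ _ _ Inv kk).
  split=> //; right; exists 0; rewrite take0 drop0 /= cats0 addn0; split=> //.
move=> k e1 m1 o1 t1 [K1 Hm1 Htime Hcase].
have [E1N E1s E1NT E1LL E1kk] : [/\ e1 vN = N, e1 vs = s, e1 vNT = NT, e1 vLL = LL & e1 vkk = kk] by rewrite !K1.
split; first by split.
rewrite /= E1kk eqb0 negbK.
case: Hcase => [[E1j Eo]|[j [[E1j jk] Eo Ht1 Hl1 [Hb1 Hfree1 Hs1]]]].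
  rewrite E1j ltnn /= Eo; apply: H => //.
  by clear -Htime; lia.
rewrite E1j; case: ltnP => /= jkk; last first.
  have Ejk : j = kk by clear -jk jkk; lia.
  by rewrite Eo Ejk; apply: H => //; clear -Htime; lia.
case: k jk Htime => [|k] jk Htime; first by exfalso; clear -jk jkk; lia.
exists k => //.
have [Tmax [i0 Hi0 Ti0]] := @tournament_max (fun i => m1 cTREE (N + i)) NT
  ltac:(by case/andP: NTb) Ht1.
pose lo q := m1 cLO (N + q); pose hi q := m1 cHI (N + q).
pose q := i0 - NT.
have qN : q < NT by rewrite /q; clear -Hi0; lia.
have Ei0 : i0 = NT + q by rewrite /q; clear -Hi0; lia.
set rho := mx rk (lo q) (hi q).
have ET : m1 cTREE (N + 1) = rho * N + q by rewrite -Ti0 Ei0 Hl1.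
have Erho : (rho * N + q) %/ N = rho.
  by rewrite divnMDl // divn_small ?addn0 //; clear -NTb qN; lia.
have Eq : (rho * N + q) %% N = q.
  by rewrite modnMDl modn_small //; clear -NTb qN; lia.
have Hmax x : x < NT -> mx rk (lo x) (hi x) <= rho.
  move=> xN; have := Tmax (NT + x); rewrite Hl1 // ET => Hx.
  rewrite -Erho leq_divRL //; apply: leq_trans (Hx _).
    by rewrite leq_addr.
  by clear -xN; lia.
have pos' : all (fun x => 0 < x) (drop j L).
  by apply/allP => x /mem_drop; apply: (allP pos).
apply: wp_assign => //=.
  rewrite E1N; split; [split=> // | apply: adr => //]; last by clear -N0; lia.
  by apply: small; clear -N0; lia.
  by apply: small; clear -N0; lia.
rewrite E1N ET.
apply: wp_assign => //=.
rewrite /upd /= E1N Erho.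
apply: wp_assign => //=.
rewrite /upd /= E1N Eq.
apply: wp_if => //=; rewrite /upd /= -lt0n.
case: posnP => /= rho0.
  have E0 : drop j L = [::].
    by apply: slots_empty Hs1 pos' _ => x xN; have := Hmax x xN; rewrite rho0 leqn0 => /eqP.
  apply: wp_set => //=; rewrite /upd /= E1kk.
  split=> //.
  - by move=> x x20; upd_other; apply: K1.
  - by clear -Htime; rewrite /pop_cost in Htime *; lia.
  - left; split=> //; rewrite Eo; congr (_ ++ map _ _).
    have jL : size L <= j by rewrite -subn_eq0 -size_drop E0.
    by rewrite !take_oversize //; clear -jL jkk; lia.
have LLjN : LL + j < NT by rewrite ENT; clear -jkk; lia.
have freeq : hi (LL + j) <= lo (LL + j) by apply: Hfree1; rewrite leqnn.
have [Hm' mM qne [L' EL'] Hs2] :=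
  @slots_pop lo hi NT (drop j L) q (LL + j) Hs1 (drop_sorted j srt) qN LLjN freeq Hmax rho0.
rewrite -/rho in Hm' mM EL' Hs2.
set mm := A cPOS rho in Hm' mM Hs2.
have rhoN : rho < N by apply: mx_lt.
have rho4 : rho <= 4 * N by clear -rhoN; lia.
have qN4 : N + q <= 4 * N by clear -qN NTb; lia.
apply: wp_seq; apply: wp_out => //=.
  by split=> //; apply: adr.
rewrite /upd /= Hm1 //.
apply: wp_assign => //=.
  by split=> //; apply: adr.
rewrite /upd /= Hm1 // -/mm.
apply: wp_assign => //=.
  by rewrite /upd /= E1N; split; [split=> //; apply: small | apply: adr].
rewrite /upd /= E1N -/(hi q).
apply: wp_assign => //=.
rewrite /upd /=.
apply: wp_assign => //=.
  by rewrite /upd /= E1N; split; [split=> //; apply: small | apply: adr].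
rewrite /upd /= E1N -/(lo q).
apply: wp_assign => //=.
rewrite /upd /=.
have [loM hiM] := Hb1 q qN.
apply: wp_seq; apply: (@set_slot_spec w P N A rk M s NB HW I rk_lt q (lo q) mm K NT) => //.
  by case/andP: NTb.
  by apply: ltnW.
move=> e2 m2 t2 K2 Hm2 Ht2 Hl2 LO2 HI2 T2.
have [E2N E2s E2NT E2LL E2j] : [/\ e2 vN = N, e2 vs = s, e2 vNT = NT, e2 vLL = LL & e2 vj = j] by rewrite !K2.
have [E2m E2hi] : e2 vm = mm /\ e2 vhi = hi q by rewrite !K2.
apply: wp_assign => //=.
  by rewrite E2LL E2j; split=> //; apply: small; clear -LLjN NTb; lia.
rewrite E2LL E2j.
apply: wp_assign => //=.
  have MN := rmq_M I.
  by rewrite /upd /= E2m; split=> //; [apply: small|apply: small]; clear -mM MN N0; lia.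
rewrite /upd /= E2m addn1.
apply: wp_assign => //=.
rewrite /upd /= E2hi.
apply: wp_seq; apply: (@set_slot_spec w P N A rk M s NB HW I rk_lt (LL + j) mm.+1 (hi q) K NT) => //.
  by case/andP: NTb.
move=> e3 m3 t3 K3 Hm3 Ht3 Hl3 LO3 HI3 T3.
have E3j : e3 vj = j by rewrite K3.
apply: wp_set => //=.
  by rewrite E3j; split=> //; apply: small; clear -LLjN NTb N0; lia.
rewrite E3j addn1.
split=> //.
- move=> x x20; have x31 : x < 31 by apply: leq_trans x20 _.
  upd_other; rewrite K3 //; upd_other; rewrite K2 //; upd_other; exact: K1.
- by clear -Htime T2 T3; move: Htime T2 T3; rewrite /pop_cost /=; lia.
right; exists j.+1; split=> //.
- by split=> //; clear -jk; lia.
- rewrite Eo -cats1 -catA; congr (_ ++ _).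
  have jL : j < size L by rewrite ltnNge -subn_eq0 -size_drop EL'.
  rewrite (take_nth 0) // map_rcons cats1; congr (rcons _ (A _ _)).
  by rewrite -[j in nth _ _ j]addn0 -nth_drop EL'.
split.
- move=> x xN; rewrite LO3 HI3 LO2 HI2.
  case: ifP => _; first by split.
  by case: ifP => _; [split=> //; apply: ltnW | apply: Hb1].
- move=> x Hx; rewrite LO3 HI3 LO2 HI2 !ifF.
  + by apply: Hfree1; clear -Hx; lia.
  + apply/eqP => Exq; have := Hfree1 x ltac:(clear -Hx; lia); rewrite Exq -/(hi q) -/(lo q).
    by clear -Hm'; lia.
  + by apply/eqP; clear -Hx; lia.
  + apply/eqP => Exq; have := Hfree1 x ltac:(clear -Hx; lia); rewrite Exq -/(hi q) -/(lo q).
    by clear -Hm'; lia.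
  + by apply/eqP; clear -Hx; lia.
- have -> : drop j.+1 L = behead (drop j L).
    by rewrite -drop1 drop_drop add1n.
  move=> a; rewrite -Hs2; apply: eq_bigr => x _.
  by rewrite LO3 HI3 LO2 HI2.
Qed.

End Pop.

End TopSlots.
Import TopSlots.

(** * Retrieval from the list of a region *)

Module Retrieval.

Implicit Types Q : state -> Prop.

(** The working space has arbitrary contents, so every slot is written: list items that are not
    groups of the locus, and the slots reserved for splits, get an empty interval. *)
Definition fill : cmd := (
  Set_ vq (K 0);;
  While (V vq <' V vNT)
    (Set_ vv (V vq);;
     Set_ vlo (K 0);;
     Set_ vhi (K 0);;
     If (V vq <' V vLL)
       (Set_ vr (V vLP +' V vq);;
        If (((V vsp <' Ld cXPOS (V vr)) *' (Ld cXPOS (V vr) <' V vep)) *'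
            ((Ld cDLO (V vr) <' V vdep) *' (V vdep <' Ld cDHI (V vr))))
          (Set_ vlo (Ld cILO (V vr));;
           Set_ vhi (Ld cIHI (V vr));;
           Set_ vv (Ld cIMX (V vr) *' V vN +' V vq))
          skip)
       skip;;
     St cLO (V vN +' V vq) (V vlo);;
     St cHI (V vN +' V vq) (V vhi);;
     St cTREE (V vN +' (V vNT +' V vq)) (V vv);;
     Set_ vq (V vq +' K 1)))%cmd.

(** [k] can be any word; capping it at [n] makes the slots fit into the working space. *)
Definition retrieve : cmd := (
  Set_ vkk (V vk);;
  If (V vn <' V vk) (Set_ vkk (V vn)) skip;;
  Set_ vLP (Ld cLPTR (V vcur));;
  Set_ vLL (Ld cLLEN (V vcur));;
  Set_ vNT (V vLL +' V vkk);;
  Set_ vsp (Ld cSP (V vcur));;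
  Set_ vep (Ld cEP (V vcur));;
  Set_ vdep (Ld cDEP (V vcur));;
  fill;;
  build;;
  Set_ vj (K 0);;
  pop_loop)%cmd.

Arguments fill : simpl never.

Section Retrieve.
Variables (w : nat) (P : seq nat) (N : nat) (A : nat -> nat -> nat).
Variables (rk : nat -> nat) (M s NB : nat).
Hypothesis HW : 1000 * (N * N) + 1000 <= 2 ^ w.
Hypothesis I : rmq_index N A rk M s NB.
Hypothesis rk_lt : forall i, rk i < N.
Hypothesis rk_pos : forall i, 0 < rk i -> i < M.
Hypothesis pos_rk : forall i, i < M -> A cPOS (rk i) = i.
Notation wp := (wp w P).
Notation holds_index := (holds_index N A).

Definition crosses (v r : nat) : bool :=
  (A cSP v < A cXPOS r < A cEP v) && (A cDLO r < A cDEP v < A cDHI r).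

Definition slot_lo (v LP LL q : nat) : nat :=
  if (q < LL) && crosses v (LP + q) then A cILO (LP + q) else 0.
Definition slot_hi (v LP LL q : nat) : nat :=
  if (q < LL) && crosses v (LP + q) then A cIHI (LP + q) else 0.

Lemma fill_spec v LP LL NT Q e m o t :
  holds_index m -> NT <= N -> LP + LL <= N ->
  (forall q, q < LL -> A cIMX (LP + q) = mx rk (A cILO (LP + q)) (A cIHI (LP + q))) ->
  e vN = N -> e vNT = NT -> e vLL = LL -> e vLP = LP ->
  e vsp = A cSP v -> e vep = A cEP v -> e vdep = A cDEP v ->
  (forall e' m' t', keeps 20 e e' -> holds_index m' ->
     (forall q, q < NT -> [/\ m' cLO (N + q) = slot_lo v LP LL q,
        m' cHI (N + q) = slot_hi v LP LL q &
        m' cTREE (N + (NT + q)) = mx rk (slot_lo v LP LL q) (slot_hi v LP LL q) * N + q]) ->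
     t' <= t + 10 + 200 * NT -> Q (State e' m' o t')) ->
  wp fill Q (State e m o t).
Proof.
move=> Hm NTN LPN Himx EN ENT ELL ELP Esp Eep Edep H.
have W0 := HW.
have small := small_value HW.
have adr := addr_small HW.
have W0' : 0 < 2 ^ w by clear -W0; lia.
have W1 : 1 < 2 ^ w by clear -W0; lia.
apply: wp_assign => //=.
pose Inv k st := let: State e' m' o' t' := st in
  [/\ keeps 20 e e', o' = o, holds_index m',
    (exists q, [/\ e' vq = q, q + k = NT &
      forall x, x < q -> [/\ m' cLO (N + x) = slot_lo v LP LL x,
        m' cHI (N + x) = slot_hi v LP LL x &
        m' cTREE (N + (NT + x)) = mx rk (slot_lo v LP LL x) (slot_hi v LP LL x) * N + x]])
    & t' + 200 * k <= t + 5 + 200 * NT].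
apply: (@wp_while _ _ _ _ _ Inv NT).
  split=> //; first by move=> x x31; upd_other.
    by exists 0; split.
  by clear; lia.
move=> k e1 m1 o1 t1 [K1 -> Hm1 [q [Eq qk Hq]] Ht].
have [E1N E1NT E1LL E1LP E1sp] : [/\ e1 vN = N, e1 vNT = NT, e1 vLL = LL, e1 vLP = LP & e1 vsp = A cSP v] by rewrite !K1.
have [E1ep E1dep] : e1 vep = A cEP v /\ e1 vdep = A cDEP v by rewrite !K1.
split; first by split.
rewrite /= Eq E1NT eqb0 negbK.
case: ltnP => /= qNT; last first.
  apply: H => //; first by move=> x xNT; apply: Hq; clear -xNT qNT; lia.
  by clear -Ht; lia.
case: k qk Ht => [|k] qk Ht; first by exfalso; clear -qk qNT; lia.
exists k => //.
apply: wp_assign => //=; rewrite Eq.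
apply: wp_assign => //=.
apply: wp_assign => //=.
(* Common outcome of the three ways through the nested conditionals, before anything is stored. *)
pose R st := let: State e' m' o' t' := st in
  [/\ keeps 20 e e', e' vq = q, m' = m1, o' = o &
   [/\ e' vlo = slot_lo v LP LL q, e' vhi = slot_hi v LP LL q,
      e' vv = mx rk (slot_lo v LP LL q) (slot_hi v LP LL q) * N + q &
      t' <= t1 + 110]].
have mxN l r : mx rk l r < N by apply: mx_lt rk_lt _ _.
have vs1 l r : mx rk l r * N < 2 ^ w.
  by have := mxN l r; move: (mx _ _ _) => z; clear -W0; nia.
have vs2 l r : mx rk l r * N + q < 2 ^ w.
  by have := mxN l r; move: (mx _ _ _) => z; clear -W0 qNT NTN; nia.
have Rend e2 t2 : R (State e2 m1 o t2) ->
   wp (St cLO (V vN +' V vq) (V vlo);;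
     St cHI (V vN +' V vq) (V vhi);;
     St cTREE (V vN +' (V vNT +' V vq)) (V vv);;
     Set_ vq (V vq +' K 1))%cmd (Inv k) (State e2 m1 o t2).
  case=> K2 E2q _ _ [E2lo E2hi E2v T2].
  have [E2N E2NT] : e2 vN = N /\ e2 vNT = NT by rewrite !K2.
  have s1 : N + q <= 4 * N by clear -qNT NTN; lia.
  have s2 : N + (NT + q) <= 4 * N by clear -qNT NTN; lia.
  have s3 : NT + q <= 4 * N by clear -qNT NTN; lia.
  apply: wp_seq; apply: (wp_store (r := N + q) (v := slot_lo v LP LL q)) => //=;
    rewrite ?E2N ?E2q //.
  - by split=> //; apply: small.
  - exact: adr.
  apply: wp_seq; apply: (wp_store (r := N + q) (v := slot_hi v LP LL q)) => //=;
    rewrite ?E2N ?E2q //.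
  - by split=> //; apply: small.
  - exact: adr.
  apply: wp_seq; apply: (wp_store (r := N + (NT + q)) (v := mx rk (slot_lo v LP LL q) (slot_hi v LP LL q) * N + q)) => //=;
    rewrite ?E2N ?E2NT ?E2q //.
  - by split=> //; [split=> //|]; apply: small.
  - exact: adr.
  apply: wp_set => //=.
    by rewrite E2q; split=> //; apply: small; clear -qNT NTN; lia.
  rewrite E2q addn1; split=> //.
  - by move=> x x20; upd_other; apply: K2.
  - by do 3 (apply: holds_index_upd; rewrite ?leq_addr //).
  - exists q.+1; split=> //; first by clear -qk; lia.
    move=> x; rewrite ltnS leq_eqVlt => /predU1P [->|xq].
      split; rewrite /mupd /= ?eqxx //.
    have ne1 : (N + x == N + q) = false by rewrite eqn_add2l ltn_eqF.
    have ne2 : (N + (NT + x) == N + (NT + q)) = false by rewrite !eqn_add2l ltn_eqF.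
    by rewrite /mupd /= ne1 ne2; apply: Hq.
  - by clear -Ht T2; lia.
apply: wp_seq; apply: (@wp_mono _ _ _ R).
  by case=> e2 m2 o2 t2 H2; have [_ _ Em Eo _] := H2; rewrite Em Eo in H2 *; apply: Rend.
apply: wp_if => //=; rewrite /upd /= Eq E1LL eqb0 negbK.
case: ltnP => /= qLL; last first.
  apply: wp_set => //=; split=> //.
    by move=> x x20; upd_other; apply: K1.
  rewrite /slot_lo /slot_hi ltnNge qLL /= /upd /= mx_nil //.
  by split=> //; clear; lia.
have rN : LP + q < N by clear -qLL LPN; lia.
have rN4 : LP + q <= 4 * N by clear -rN; lia.
apply: wp_assign => //=.
  by rewrite /upd /= E1LP Eq; split=> //; apply: small.
rewrite /upd /= E1LP Eq.
have leb1 (a : bool) : a < 2 ^ w by apply: leq_ltn_trans W1; case: a.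
apply: (@wp_if _ _ _ _ _ _ _ _ _ _ (crosses v (LP + q))) => /=.
- rewrite /upd /= !Hm1 //; do !split=> //; try exact: adr; rewrite ?mulnb; exact: leb1.
- by rewrite /upd /= !Hm1 // E1sp E1ep E1dep !mulnb eqb0 negbK /crosses.
case: ifP => Ec; last first.
  apply: wp_set => //=; split=> //.
    by move=> x x20; upd_other; apply: K1.
  rewrite /slot_lo /slot_hi Ec andbF /upd /= mx_nil //.
  by split=> //; clear; lia.
apply: wp_assign => //=.
  by rewrite /upd /=; split=> //; apply: adr.
rewrite /upd /= Hm1 //.
apply: wp_assign => //=.
  by rewrite /upd /=; split=> //; apply: adr.
rewrite /upd /= Hm1 //.
apply: wp_set => //=.
  rewrite /upd /= Hm1 // E1N Eq Himx //.
  by split=> //; split=> //; split=> //; apply: adr.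
split=> //.
  by move=> x x20; upd_other; apply: K1.
rewrite /slot_lo /slot_hi Ec qLL /= /upd /= Hm1 // E1N Eq Himx //.
by split=> //; clear; lia.
Qed.

Lemma retrieve_spec v LP LL n k K (L : seq nat) Q e m o t :
  let NT := LL + minn k n in
  holds_index m -> v < N -> LP + LL <= N -> 0 < LL -> LL + n <= N ->
  (forall q, q < LL -> A cIMX (LP + q) = mx rk (A cILO (LP + q)) (A cIHI (LP + q))) ->
  (forall q, q < LL -> A cILO (LP + q) <= M /\ A cIHI (LP + q) <= M) ->
  slots_hold rk (slot_lo v LP LL) (slot_hi v LP LL) LL L ->
  sorted geq L -> all (fun x => 0 < x) L ->
  NT.*2 <= 2 ^ K.+1 ->
  A cLPTR v = LP -> A cLLEN v = LL ->
  e vN = N -> e vs = s -> e vn = n -> e vk = k -> e vcur = v ->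
  (forall e' m' t', holds_index m' -> t' <= t + 200 + 300 * NT + pop_cost K * minn k n ->
     Q (State e' m' (o ++ [seq A cDOC r | r <- take (minn k n) L]) t')) ->
  wp retrieve Q (State e m o t).
Proof.
move=> NT Hm vlt LPN LL0 LLn Himx Hb Hs srt pos NTK ELP ELL EN Es En Ek Ecur H.
have W0 := HW.
have small := small_value HW.
have adr := cell_small HW.
have NTN : NT <= N by rewrite /NT; clear -LLn; lia.
have NT0 : 0 < NT by rewrite /NT; clear -LL0; lia.
apply: wp_assign => //=; rewrite Ek.
apply: wp_seq.
pose R st := let: State e' m' o' t' := st in
  [/\ keeps 9 e e', e' vkk = minn k n, m' = m, o' = o & t' <= t + 30].
apply: (@wp_mono _ _ _ R); last first.
  apply: wp_if => //=; rewrite /upd /= En Ek eqb0 negbK.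
  case: ltnP => /= kn; apply: wp_set => //=; rewrite /upd /= ?En.
  - split=> //; first by move=> x x20; upd_other.
    + by rewrite (minn_idPr (ltnW kn)).
    + by clear; lia.
  - by clear -W0; lia.
  - split=> //; first by move=> x x20; upd_other.
    + by rewrite (minn_idPl kn).
    + by clear; lia.
case=> e1 m1 o1 t1 [K1 E1kk -> -> T1] {m1 o1}.
have E1cur : e1 vcur = v by rewrite K1.
have lat : forall (d : nat) (c : nat) (a : cmd) (e2 : nat -> nat) (t2 : nat) Q2,
   e2 vcur = v -> c < ncol ->
   wp a Q2 (State (upd e2 d (A c v)) m o (t2 + 7)) ->
   wp (Set_ d (Ld c (V vcur));; a)%cmd Q2 (State e2 m o t2).
  move=> d c a e2 t2 Q2 E2 Hc Hwp; apply: (wp_assign (v := A c v)) => //=.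
    by rewrite E2; split=> //; apply: adr.
  by rewrite E2 Hm.
do 2 (apply lat; [by [] | by [] | ]); rewrite ELP ELL.
apply: wp_assign => //=.
  by rewrite /upd /= E1kk; split=> //; apply: small; rewrite -/NT; clear -NTN; lia.
rewrite /upd /= E1kk -/NT.
do 3 (apply lat; [by [] | by [] | cbn beta]) => /=.
apply: wp_seq; apply: (@fill_spec v LP LL NT) => //.
- by rewrite /upd /= K1.
move=> e2 m2 t2 K2 Hm2 Hslots T2.
have E2N : e2 vN = N by rewrite K2 // /upd /= K1.
apply: wp_seq; apply: (build_spec P HW (NT := NT)) => //.
- by rewrite K2.
- by rewrite NT0.
move=> e3 m3 t3 K3 Ht3 Hm3 T3.
have E3N : e3 vN = N by rewrite K3.
have LO3 q : q < NT -> m3 cLO (N + q) = slot_lo v LP LL q.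
  by move=> qN; rewrite Hm3 //; case: (Hslots q qN).
have HI3 q : q < NT -> m3 cHI (N + q) = slot_hi v LP LL q.
  by move=> qN; rewrite Hm3 //; case: (Hslots q qN).
apply: wp_assign => //=; first by clear -W0; lia.
have lohi0 q : LL <= q -> slot_lo v LP LL q = 0 /\ slot_hi v LP LL q = 0.
  by move=> qL; rewrite /slot_lo /slot_hi ltnNge qL.
apply: (@pop_loop_spec w P N A rk M s NB HW I rk_lt rk_pos pos_rk L (minn k n) LL K NT) => //.
- by move=> c r Hc Hr; rewrite Hm3 ?Hr ?orbT //; apply: Hm2.
- move=> q qN; rewrite LO3 // HI3 // Hm3; first by case: (Hslots q qN).
  by rewrite addnA leq_addr !orbT.
- by rewrite NT0.
- move=> q qN; rewrite LO3 // HI3 // /slot_lo /slot_hi.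
  by case: ifP => // /andP[qL _]; apply: Hb.
- move=> q /andP[qL qN]; rewrite LO3 // HI3 //.
  by have [-> ->] := lohi0 q qL.
- move=> a; rewrite -Hs /NT big_split_ord /= [X in _ + X]big1 ?addn0 => [|q _].
    by apply: eq_bigr => q _; rewrite LO3 ?HI3 // /NT ltn_addr.
  rewrite LO3 ?HI3 ?ltn_add2l //.
  by have [-> ->] := lohi0 (LL + q) (leq_addr _ _).
- by rewrite /upd /= K3 // K2 // /upd /= K1.
- by rewrite /upd /= K3 // K2.
- by rewrite /upd /= K3 // K2.
- by rewrite /upd /= K3 // K2.
move=> e' m' t' Hm' T'; apply: H => //.
by clear -T1 T2 T3 T'; move: T' T1 T2 T3 => /=; lia.
Qed.

End Retrieve.

End Retrieval.
Import Retrieval.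

(** * Descent of the suffix tree and verification *)

Module Descent.

Implicit Types Q : state -> Prop.

Section Child.
Variables (X : finType) (key : X -> seq nat).
Implicit Types A B : {set X}.
Notation pre := (pre key).
Notation cls := (cls key).
Notation fam := (fam key).
Notation maxlen := (maxlen key).

(** Suffixes that end at depth [maxlen A] lie in no child, which takes the place of a terminator
    symbol. *)
Definition child A (c : nat) : {set X} :=
  [set y in A | (maxlen A < size (key y)) && (nth 0 (key y) (maxlen A) == c)].

Lemma child_cls A c (y : X) : A \in fam -> y \in child A c ->
  maxlen A < size (key y) /\ child A c = cls (maxlen A).+1 y.
Proof.
move=> fA; rewrite inE => /and3P[yA lt /eqP Ec]; split=> //.
have [ly EA] := lenP key _ yA (len_maxlen fA).
apply/setP => z; rewrite [in RHS]in_cls // inE.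
rewrite {1}EA in_cls // (take_nth 0 lt).
apply/and3P/andP => [[/andP[_ /eqP Ez] lz /eqP ez]|[lz]].
  by rewrite lz (take_nth 0 lz) Ez ez Ec.
rewrite (take_nth 0 lz) => /eqP /rcons_inj [Ez ez].
by rewrite Ez ez Ec !eqxx (ltnW lz).
Qed.

Lemma child_fam A c : A \in fam -> child A c != set0 ->
  child A c \in fam /\ maxlen A < maxlen (child A c).
Proof.
move=> fA /set0Pn [y yA]; have [lt E] := child_cls fA yA.
have H : len key (child A c) (maxlen A).+1 by rewrite E; apply: len_cls.
by split; [apply: len_fam H | case/andP: (len_bounds H)].
Qed.

Lemma pre_sub_child A (Q : seq nat) :
  A \in fam -> pre Q \subset A -> maxlen A < size Q ->
  pre Q \subset child A (nth 0 Q (maxlen A)).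
Proof.
move=> fA /subsetP H lt; apply/subsetP => y yQ; rewrite !inE H //=.
move: yQ; rewrite inE => /prefixP [s ->]; rewrite size_cat nth_cat lt eqxx andbT.
exact: leq_trans (leq_addr _ _).
Qed.

(** All members of [A] agree on their first [maxlen A] characters, so comparing [Q] with one
    representative decides for all of them. *)
Lemma fam_pre A (Q : seq nat) (x : X) :
  A \in fam -> pre Q \subset A -> size Q <= maxlen A -> x \in A ->
  if prefix Q (key x) then A = pre Q else pre Q = set0.
Proof.
move=> fA /subsetP H le xA.
have [lx EA] := lenP key _ xA (len_maxlen fA).
have share y : y \in A -> take (size Q) (key y) = take (size Q) (key x).
  rewrite {1}EA in_cls // => /andP[_ /eqP E].
  by rewrite -(take_takel (key y) le) E take_takel.
case: ifPn => pQ.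
  apply/setP => y; apply/idP/idP => [yA|]; last exact: H.
  by rewrite inE prefixE share // -prefixE.
apply/setP => y; rewrite in_set0; apply: contraNF pQ => yQ.
by move: (yQ); rewrite inE !prefixE (share _ (H _ yQ)).
Qed.

Definition keys A : seq nat :=
  undup [seq nth 0 (key y) (maxlen A) | y <- enum A & maxlen A < size (key y)].

Lemma mem_keys A c : (c \in keys A) = (child A c != set0).
Proof.
rewrite mem_undup; apply/mapP/set0Pn => [[y]|[y]].
  rewrite mem_filter mem_enum => /andP[lt yA] ->.
  by exists y; rewrite inE yA lt eqxx.
rewrite inE => /and3P[yA lt /eqP E]; exists y => //.
by rewrite mem_filter mem_enum lt.
Qed.

(** A common element puts both parents on one chain. If [A] were the shallower one, its child would
    contain [B]; but it is also a child of [B], hence equal to [B], although a child is deeper than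
    its parent. *)
Lemma child_inj A B c d : A \in fam -> B \in fam ->
  child A c != set0 -> child A c = child B d -> A = B /\ c = d.
Proof.
move=> fA fB /set0Pn [y yA] E.
have yB : y \in child B d by rewrite -E.
have [ltA EA] := child_cls fA yA; have [ltB EB] := child_cls fB yB.
move: (yA) (yB); rewrite !inE => /and3P[yA' _ /eqP Ec] /and3P[yB' _ /eqP Ed].
have [_ EA'] := lenP key _ yA' (len_maxlen fA); have [_ EB'] := lenP key _ yB' (len_maxlen fB).
wlog le : A B c d fA fB E yA yB ltA EA ltB EB yA' yB' Ec Ed EA' EB' / maxlen A <= maxlen B.
  move=> H; case: (leqP (maxlen A) (maxlen B)) => [|/ltnW] le; first exact: (H A B c d).
  by have [-> ->] := H B A d c fB fA (esym E) yB yA ltB EB ltA EA yB' yA' Ed Ec EB' EA' le.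
suff eAB : maxlen A = maxlen B by split; [rewrite EA' EB' eAB | rewrite -Ec -Ed eAB].
apply/eqP; rewrite eqn_leq le /= leqNgt; apply/negP => lt.
have fC := child_fam fB (_ : child B d != set0).
have [|_] := fC; first by apply/set0Pn; exists y.
have EBC : child B d = B.
  apply/eqP; rewrite eqEsubset; apply/andP; split.
    by apply/subsetP => z; rewrite inE => /andP[].
  by rewrite -E EA {1}EB'; apply: sub_cls.
by rewrite EBC ltnn.
Qed.

(** Distinct edges lead to distinct nodes, so the hash tables together hold linearly many keys. *)
Lemma sum_keys : \sum_(A in fam) size (keys A) <= #|fam|.
Proof.
pose s := [seq child A c | A <- enum fam, c <- keys A].
have us : uniq s.
  apply: allpairs_uniq_dep; first exact: enum_uniq.
    by move=> A _; apply: undup_uniq.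
  move=> [A c] [B d] /allpairsPdep [A' [c' [fA cA [-> ->]]]].
  move=> /allpairsPdep [B' [d' [fB dB [-> ->]]]] /= E.
  rewrite mem_enum in fA; rewrite mem_enum in fB; rewrite mem_keys in cA.
  by have [-> ->] := child_inj fA fB cA E.
have -> : \sum_(A in fam) size (keys A) = size s.
  by rewrite size_allpairs_dep sumnE big_map big_enum.
rewrite cardE; apply: uniq_leq_size us _ => C /allpairsPdep [A [c [fA cA ->]]].
rewrite mem_enum in fA; rewrite mem_keys in cA.
by rewrite mem_enum; case: (child_fam fA cA).
Qed.

End Child.

(** Row 0 is the root, which is nobody's child. So the product of the key test and the child row is
    0 exactly when no edge starts with the character. *)
Definition descend : cmd := (
  Set_ vcur (K 0);;
  Set_ vi (Ld cMAXL (V vcur));;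
  Set_ vok (K 1);;
  While (V vok *' (V vi <' V vp))
    (Set_ vc (In (V vi));;
     Set_ vb (Ld cHB (V vcur) +'
              Ar ShrO (Ar WrapMulO (V vc) (Ld cHA (V vcur))) (Ld cHS (V vcur)));;
     Set_ ve (Ld cBB (V vb) +'
              Ar ShrO (Ar WrapMulO (V vc) (Ld cBA (V vb))) (Ld cBS (V vb)));;
     Set_ vcur ((Ld cKEY (V ve) ==' V vc) *' Ld cCHILD (V ve));;
     If (V vcur) (Set_ vi (Ld cMAXL (V vcur))) (Set_ vok (K 0))))%cmd.

Definition verify : cmd := (
  If (V vok)
    (Set_ vx (Ld cTX (V vcur));;
     Set_ vok (V vp <' Ld cSL (V vcur) +' K 1);;
     Set_ vi (K 0);;
     While (V vok *' (V vi <' V vp))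
       (Set_ vok (Ld cTXT (V vx +' V vi) ==' In (V vi));;
        Set_ vi (V vi +' K 1)))
    skip)%cmd.

Section Descend.
Variables (w : nat) (P : seq nat) (N : nat) (A : nat -> nat -> nat).
Variables (X : finType) (key : X -> seq nat) (row : {set X} -> nat) (tx : X -> nat).
Hypothesis HW : 1000 * (N * N) + 1000 <= 2 ^ w.
Hypothesis P_words : forall i, nth 0 P i < 2 ^ w.
Notation wp := (wp w P).
Notation holds_index := (holds_index N A).
Notation pre := (pre key).
Notation fam := (fam key).
Notation maxlen := (maxlen key).

Definition bucket (v c : nat) : nat := A cHB v + mulshift w (A cHA v) (A cHS v) c.
Definition entry (b c : nat) : nat := A cBB b + mulshift w (A cBA b) (A cBS b) c.

(** [trie_hash] speaks of every word [c], because characters without an edge are looked up too. *)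
Record trie_index : Prop := TrieIndex {
  trie_root : [set: X] \in fam /\ row [set: X] = 0;
  trie_row : forall B, B \in fam -> row B < N;
  trie_maxlen : forall B, B \in fam -> A cMAXL (row B) = maxlen B;
  trie_rep : forall B, B \in fam -> exists2 x, x \in B &
    A cTX (row B) = tx x /\ A cSL (row B) = size (key x);
  trie_text : forall x j, j < size (key x) ->
    tx x + j < N /\ A cTXT (tx x + j) = nth 0 (key x) j;
  trie_size : forall x, size (key x) < N;
  trie_hash : forall B c, B \in fam -> c < 2 ^ w ->
    let e := entry (bucket (row B) c) c in
    [/\ bucket (row B) c < N, e < N &
     (A cKEY e == c) * A cCHILD e =
       if child key B c == set0 then 0 else row (child key B c)];
  trie_child : forall B c, B \in fam -> child key B c != set0 -> 0 < row (child key B c)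
}.
Hypothesis I : trie_index.

Lemma descend_spec Q e m o t :
  holds_index m -> e vp = size P -> size P < 2 ^ w ->
  (forall e' t', keeps 6 e e' -> t' <= t + 100 + 100 * size P ->
     (e' vok = 0 /\ pre P = set0) \/
     (e' vok = 1 /\ exists B, [/\ B \in fam, e' vcur = row B, pre P \subset B &
        size P <= maxlen B]) ->
     Q (State e' m o t')) ->
  wp descend Q (State e m o t).
Proof.
move=> Hm Ep pW H.
have W0 := HW.
have [rootF root0] := trie_root I.
have adr := cell_small HW.
have W00 : 0 < 2 ^ w by clear -W0; lia.
have W1 : 1 < 2 ^ w by clear -W0; lia.
have N0 : 0 < N by apply: leq_ltn_trans (trie_row I rootF).
apply: wp_assign => //=.
apply: wp_assign => //=.
  by rewrite /upd /=; split=> //; apply: (@adr 0).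
have EM : A cMAXL 0 = maxlen [set: X] by rewrite -(trie_maxlen I) ?root0.
rewrite /upd /= Hm // EM.
apply: wp_assign => //=.
(* The counter bounds the number of characters still to be passed; every edge increases [maxlen]. *)
pose Inv k st := let: State e' m' o' t' := st in
  [/\ keeps 6 e e', m' = m, o' = o, t' + 100 * k <= t + 50 + 100 * size P &
     (e' vok = 0 /\ pre P = set0) \/
     (e' vok = 1 /\ exists B, [/\ B \in fam, e' vcur = row B, pre P \subset B,
        e' vi = maxlen B & size P <= maxlen B + k])].
apply: (@wp_while _ _ _ _ _ Inv (size P)).
  split=> //.
  - by move=> x x6; upd_other.
  - by clear; lia.
  - right; split=> //; exists [set: X]; split; rewrite ?subsetT //.
    exact: leq_addl.
move=> k e1 m1 o1 t1 [K1 -> -> Ht Hcase].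
have E1p : e1 vp = size P by rewrite K1.
have boolW (a b : bool) : a * b < 2 ^ w by apply: leq_ltn_trans W1; case: a; case: b.
rewrite /= E1p.
case: Hcase => [[Eok E0]|[Eok [B [fB Ecur sub Ei sz]]]].
  rewrite Eok mul0n; split=> //=; apply: H => //; last by left.
  by clear -Ht; lia.
rewrite Eok mul1n Ei; split.
  by split=> //; apply: leq_ltn_trans W1; case: (_ < _).
rewrite eqb0 negbK.
case: ltnP => /= lt; last first.
  apply: H => //; first by clear -Ht; lia.
  by right; split=> //; exists B; split.
case: k sz Ht => [|k] sz Ht; first by exfalso; clear -lt sz; lia.
exists k => //.
set c := nth 0 P (maxlen B).
have cW : c < 2 ^ w by apply: P_words.
have [bN eN Ech] := trie_hash I fB cW.
set b := bucket (row B) c in bN eN Ech; set en := entry b c in eN Ech.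
have NW := ltNW HW.
have rN := trie_row I fB.
apply: wp_assign => //=; rewrite Ei -/c.
apply: (wp_assign (v := b)) => //=.
- rewrite /upd /= Ecur !Hm //; split; last exact: NW.
    by split=> //; apply: adr.
  by split=> //; [split=> //; split=> //; apply: adr | split=> //; apply: adr].
- by rewrite /upd /= Ecur !Hm.
apply: (wp_assign (v := en)) => //=.
- rewrite /upd /= !Hm //; split; last exact: NW.
    by split=> //; apply: adr.
  by split=> //; [split=> //; split=> //; apply: adr | split=> //; apply: adr].
- by rewrite /upd /= !Hm.
have crN : (if child key B c == set0 then 0 else row (child key B c)) < N.
  by case: ifPn => // ne; apply: (trie_row I); case: (child_fam fB ne).
apply: (wp_assign (v := if child key B c == set0 then 0 else row (child key B c))) => //=.
- rewrite /upd /= !Hm //; split.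
  + by split=> //; split=> //; apply: adr.
  + by split=> //; apply: adr.
  + by rewrite -/en Ech; apply: NW.
- by rewrite /upd /= !Hm.
apply: wp_if => //=; rewrite /upd /= -lt0n.
have subc := pre_sub_child fB sub lt; rewrite -/c in subc.
case: eqVneq crN => [E0|ne] crN.
  apply: wp_set => //=; split=> //.
  - by move=> x x6; upd_other; apply: K1.
  - by clear -Ht; move: Ht => /=; lia.
  - left; split=> //; apply/eqP; rewrite -subset0 -E0; exact: subc.
rewrite (trie_child I fB ne).
have [fC ltC] := child_fam fB ne.
apply: wp_set => //=.
  by rewrite /upd /=; split=> //; apply: adr.
rewrite /upd /= Hm // (trie_maxlen I) //.
split=> //.
- by move=> x x6; upd_other; apply: K1.
- by clear -Ht; move: Ht => /=; lia.
- right; split=> //; exists (child key B c); split=> //.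
  by clear -sz ltC; lia.
Qed.

Lemma verify_spec Q e m o t :
  holds_index m -> e vp = size P -> size P < 2 ^ w ->
  (e vok = 0 /\ pre P = set0) \/
     (e vok = 1 /\ exists B, [/\ B \in fam, e vcur = row B, pre P \subset B &
        size P <= maxlen B]) ->
  (forall e' t', keeps 6 e e' -> t' <= t + 100 + 100 * size P ->
     (e' vok = 0 /\ pre P = set0) \/
     [/\ e' vok = 1, pre P \in fam & e' vcur = row (pre P)] ->
     Q (State e' m o t')) ->
  wp verify Q (State e m o t).
Proof.
move=> Hm Ep pW Hcase H.
have W0 := HW.
have adr := cell_small HW.
have NW := ltNW HW.
have W00 : 0 < 2 ^ w by clear -W0; lia.
have W1 : 1 < 2 ^ w by clear -W0; lia.
case: Hcase => [[Eok E0]|[Eok [B [fB Ecur sub sz]]]].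
  apply: wp_if => //=; rewrite Eok /=; apply: wp_set => //=.
  apply: H; [by move=> x x6; upd_other | by clear; lia | by left].
apply: wp_if => //=; rewrite Eok /=.
have [x xB [Etx Esl]] := trie_rep I fB.
have rN := trie_row I fB.
have Hfin := fam_pre fB sub sz xB.
apply: wp_assign => //=.
  by rewrite Ecur; split=> //; apply: adr.
rewrite Ecur Hm // Etx.
have slN := trie_size I x.
apply: wp_assign => //=.
  rewrite /upd /= Ecur Hm // Esl; split=> //; split=> //.
    by split=> //; apply: adr.
  by rewrite addn1; apply: (leq_ltn_trans slN); clear -W0; nia.
rewrite /upd /= Ecur Hm // Esl Ep addn1 ltnS.
apply: wp_assign => //=.
pose Inv k st := let: State e' m' o' t' := st in
  [/\ keeps 6 e e', m' = m, o' = o, t' + 50 * k <= t + 50 + 50 * size P &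
   exists i, [/\ e' vi = i, i + k = size P, e' vcur = row B, e' vx = tx x &
     (e' vok = 0 /\ ~~ prefix P (key x)) \/
     [/\ e' vok = 1, size P <= size (key x) & take i P = take i (key x)]]].
apply: (@wp_while _ _ _ _ _ Inv (size P)).
  split=> //.
  - by move=> y y6; upd_other.
  - by clear; lia.
  - exists 0; split=> //; rewrite /upd /=.
    case: leqP => le; [by right; rewrite !take0 | left; split=> //].
    by apply: contraTN le => /size_prefix; rewrite leqNgt.
move=> k e1 m1 o1 t1 [K1 -> -> Ht [i [Ei ik E1cur E1x Hok]]].
have E1p : e1 vp = size P by rewrite K1.
rewrite /= E1p.
case: Hok => [[E1ok npre]|[E1ok szle Etake]].
  rewrite E1ok mul0n; split=> //=; apply: H => //; first by clear -Ht; lia.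
  by left; rewrite (negPf npre) in Hfin.
rewrite E1ok mul1n Ei; split.
  by split=> //; apply: leq_ltn_trans W1; case: (_ < _).
rewrite eqb0 negbK.
case: ltnP => /= lt; last first.
  apply: H => //; first by clear -Ht; lia.
  have pP : prefix P (key x).
    by rewrite prefixE -(take_takel (key x) lt) -Etake take_takel // take_size.
  by rewrite pP in Hfin; right; rewrite -Hfin.
case: k ik Ht => [|k] ik Ht; first by exfalso; clear -lt ik; lia.
exists k => //.
have iX : i < size (key x) by apply: leq_trans szle.
have [tN Etxt] := trie_text I iX.
apply: wp_assign => //=.
  rewrite Ei E1x; split=> //; split; last exact: adr.
  by split=> //; apply: NW.
rewrite Ei E1x Hm // Etxt.
apply: wp_set => //=.
  by rewrite /upd /= Ei; split=> //; rewrite addn1; apply: leq_ltn_trans pW.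
rewrite /upd /= Ei addn1.
split=> //.
- by move=> y y6; upd_other; apply: K1.
- by clear -Ht; move: Ht => /=; lia.
- exists i.+1; split=> //; first by clear -ik; lia.
  case: eqVneq => [E|ne]; [right|left]; split=> //.
    by rewrite (take_nth 0 lt) (take_nth 0 iX) Etake E.
  apply: contra ne => /prefixP [s' ->]; rewrite nth_cat lt //.
Qed.

End Descend.

End Descent.
Import Descent.

(** * Links, their groups, and the ownership of groups *)

Module Links.

Section Links.
Variables (X : finType) (key : X -> seq nat) (dn : X -> nat).
Implicit Types (A B C : {set X}) (Q : seq nat).
Notation pre := (pre key).
Notation cls := (cls key).
Notation fam := (fam key).
Notation minlen := (minlen key).

(** With the document number in front, the loci of nonempty strings are the nodes of the suffix
    trees of the single documents. *)
Definition key1 (x : X) : seq nat := dn x :: key x.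
Definition links : {set {set X}} := [set B in PrefixFamily.fam key1 | 0 < maxlen key1 B].
Definition link := {B : {set X} | B \in links}.
(** The document number is taken off. Truncation matters for a link with [minlen] 0, which occurs
    when all positions lie in one document. *)
Definition lowlen B : nat := (PrefixFamily.minlen key1 B).-1.
Definition highlen B : nat := (maxlen key1 B).-1.
(** The longest string of the link; by [link_high] it does not depend on the position picked. *)
Definition str B : seq nat :=
  if [pick x in B] is Some x then take (highlen B) (key x) else [::].
Definition key2 (b : link) : seq nat := lowlen (val b) :: str (val b).
Definition same_doc (x : X) : {set X} := [set y | dn y == dn x].
(* The links that cross the locus [A], one for each document in [A]: the link
   of a document is crossed at depths [lowlen] to [highlen]. *)
Definition cset A : {set link} :=
  [set b : link | [exists x in val b, val b == A :&: same_doc x]].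
Definition grp A (l : nat) : {set link} :=
  [set b in cset A | lowlen (val b) == l].
Implicit Types (b : link) (G : {set link}).

Lemma card_link : #|{: link}| <= 2 * #|X|.
Proof.
apply: leq_trans (card_fam key1); rewrite card_sig; apply: subset_leq_card.
apply/subsetP => B HB; have {HB} : B \in links by exact: HB.
by rewrite inE => /andP[].
Qed.

Lemma link_nonempty b : exists x, x \in val b.
Proof.
by apply/set0Pn; case: b => B /=; rewrite inE => /andP[/fam_nonempty].
Qed.

Lemma pre_same_doc Q (x : X) :
  pre Q :&: same_doc x = PrefixFamily.pre key1 (dn x :: Q).
Proof. by apply/setP => y; rewrite !inE /key1 prefix_cons eq_sym andbC. Qed.

Lemma link_len b (x : X) l : x \in val b ->
  reflect (l <= size (key x) /\ val b = PrefixFamily.pre key1 (dn x :: take l (key x)))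
    (lowlen (val b) <= l <= highlen (val b)).
Proof.
case: b => B /=; rewrite inE => /andP[fB m0] xB.
have -> : lowlen B <= l <= highlen B = len key1 B l.+1.
  apply/idP/idP => [H|/len_bounds].
    apply: (len_convex (len_minlen fB) (len_maxlen fB)).
    by move: H; rewrite /lowlen /highlen; lia.
  by rewrite /lowlen /highlen; lia.
by apply: (iffP (lenP key1 _ xB)).
Qed.

Lemma low_le_high b : lowlen (val b) <= highlen (val b).
Proof.
have [x xb] := link_nonempty b.
case: b xb => B /=; rewrite inE => /andP[fB m0] xB.
have := len_bounds (len_minlen fB); rewrite /lowlen /highlen; lia.
Qed.

Lemma link_high b (x : X) : x \in val b ->
  [/\ highlen (val b) <= size (key x), str (val b) = take (highlen (val b)) (key x) &
    val b = PrefixFamily.pre key1 (dn x :: str (val b))].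
Proof.
move=> xb; have le := low_le_high b.
have [lx Eb] : highlen (val b) <= size (key x) /\
    val b = PrefixFamily.pre key1 (dn x :: take (highlen (val b)) (key x)).
  by apply/(link_len _ xb); rewrite le leqnn.
suff E : str (val b) = take (highlen (val b)) (key x) by rewrite E.
rewrite /str; case: pickP => [y yb|/(_ x)]; last by rewrite xb.
move: yb; rewrite {1}Eb inE prefixE /= size_take_min (minn_idPl lx).
by case/eqP=> _ ->.
Qed.

(** A link is the locus of a document number followed by a string of each length from [lowlen] to
    [highlen]; a prefix of [str] meets the upper bound by itself. *)
Lemma mem_cset_pre Q b :
  (b \in cset (pre Q)) = prefix Q (str (val b)) && (lowlen (val b) <= size Q).
Proof.
rewrite inE; apply/existsP/andP => [[x /andP[xb /eqP Eb]]|[pQ lQ]].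
  have xQ : x \in pre Q by move: xb; rewrite Eb inE => /andP[].
  have [sQ _] := pre_cls xQ.
  have EQ : Q = take (size Q) (key x) by move: xQ; rewrite inE prefixE => /eqP.
  have /andP[H1 H2] : lowlen (val b) <= size Q <= highlen (val b).
    by apply/(link_len _ xb); rewrite -EQ -pre_same_doc.
  have [_ Es _] := link_high xb.
  by rewrite Es prefixE take_takel // -EQ eqxx.
have [x xb] := link_nonempty b; exists x; rewrite xb /=.
have [hx Es _] := link_high xb.
have sQ : size Q <= highlen (val b).
  by apply: leq_trans (size_prefix pQ) _; rewrite Es size_take_min geq_minl.
have EQ : Q = take (size Q) (key x).
  by move: pQ; rewrite Es prefixE take_takel // => /eqP.
have [|_ Eb] := (@link_len b x (size Q) xb) _; first by rewrite lQ sQ.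
by rewrite pre_same_doc EQ -Eb.
Qed.

Lemma cset_cover Q (x : X) : x \in pre Q ->
  exists2 b, b \in cset (pre Q) & x \in val b.
Proof.
move=> xQ; have [sQ EQ] := pre_cls xQ.
have xB : x \in pre Q :&: same_doc x by rewrite inE xQ inE eqxx.
have HB : pre Q :&: same_doc x \in links.
  have L : len key1 (pre Q :&: same_doc x) (size (dn x :: Q)).
    rewrite pre_same_doc; apply: (@len_pre _ _ _ x).
    by rewrite -pre_same_doc.
  rewrite inE (len_fam L) /=; case/andP: (len_bounds L) => _; exact: leq_trans.
pose b : link := exist (fun B : {set X} => B \in links) _ HB.
exists b => //; rewrite inE /=; apply/existsP; exists x.
by rewrite xB eqxx.
Qed.

Lemma mem_link_cset A b (x : X) :
  b \in cset A -> x \in val b -> val b = A :&: same_doc x.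
Proof.
rewrite inE => /existsP [y /andP[yb /eqP Eb]] xb; rewrite Eb.
move: xb; rewrite Eb inE => /andP[_]; rewrite inE => /eqP E.
by apply/setP => z; rewrite !inE E.
Qed.

Lemma cset_sub A b : b \in cset A -> val b \subset A.
Proof. by rewrite inE => /existsP [y /andP[_ /eqP ->]]; apply: subsetIl. Qed.

Lemma cset_inj A (b b' : link) (x x' : X) :
  b \in cset A -> b' \in cset A -> x \in val b -> x' \in val b' -> dn x = dn x' -> b = b'.
Proof.
move=> bA bA' xb xb' E; apply: val_inj.
rewrite (mem_link_cset bA xb) (mem_link_cset bA' xb').
by apply/setP => z; rewrite !inE E.
Qed.

Lemma fam_string A (x : X) : A \in fam -> x \in A ->
  exists Q, [/\ A = pre Q, size Q = minlen A & Q = take (minlen A) (key x)].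
Proof.
move=> fA xA; have [lx EA] := lenP key _ xA (len_minlen fA).
by exists (take (minlen A) (key x)); rewrite size_take_min (minn_idPl lx).
Qed.

Lemma cset_low A b : A \in fam -> b \in cset A ->
  lowlen (val b) <= minlen A.
Proof.
move=> fA; have /set0Pn [x xA] := fam_nonempty fA.
have [Q [EQ <- _]] := fam_string fA xA.
by rewrite {1}EQ mem_cset_pre => /andP[].
Qed.

(** For links with [lowlen] equal to [l] the length condition of [mem_cset_pre] is automatic, and a
    pure prefix condition on [key2] remains. *)
Lemma grp_pre Q l : l <= size Q ->
  grp (pre Q) l = PrefixFamily.pre key2 (l :: Q).
Proof.
move=> lQ; apply/setP => b; rewrite inE mem_cset_pre inE /key2 prefix_cons.
rewrite [l == _]eq_sym [RHS]andbC; case: eqP => [->|]; last by rewrite !andbF.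
by rewrite lQ !andbT.
Qed.

Lemma grp_fam A l : A \in fam -> grp A l != set0 -> grp A l \in PrefixFamily.fam key2.
Proof.
move=> fA /set0Pn [b bG]; have := bG; rewrite inE => /andP[bA /eqP El].
have /set0Pn [x xA] := fam_nonempty fA.
have [Q [EQ sQ _]] := fam_string fA xA.
have lQ : l <= size Q by rewrite sQ -El cset_low.
rewrite EQ grp_pre //; apply: (@len_fam _ _ _ (size (l :: Q))).
by apply: (@len_pre _ _ _ b); rewrite -grp_pre // -EQ.
Qed.

Lemma cset_between A B C b :
  A \subset B -> B \subset C -> b \in cset A -> b \in cset C -> b \in cset B.
Proof.
move=> AB BC bA bC; have [x xb] := link_nonempty b.
rewrite inE; apply/existsP; exists x; rewrite xb /= eqEsubset.
rewrite {1}(mem_link_cset bA xb) setSI //=.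
by rewrite (mem_link_cset bC xb) setSI.
Qed.

(** The smaller locus has the longer string and thus the stronger prefix condition; if the lengths
    compare the other way, the loci coincide. *)
Lemma grp_mono A B b : A \in fam -> B \in fam -> A \subset B ->
  b \in cset A -> b \in cset B ->
  grp A (lowlen (val b)) \subset grp B (lowlen (val b)).
Proof.
move=> fA fB AB bA bB; have [x xb] := link_nonempty b.
have xA := subsetP (cset_sub bA) _ xb; have xB := subsetP (cset_sub bB) _ xb.
have [Q [EQ sQ tQ]] := fam_string fA xA.
have [R [ER sR tR]] := fam_string fB xB.
have lQ : lowlen (val b) <= size Q by rewrite sQ cset_low.
have lR : lowlen (val b) <= size R by rewrite sR cset_low.
rewrite {1}EQ ER !grp_pre //; apply/subsetP => c; rewrite !inE.
have [le|/ltnW le] := leqP (minlen B) (minlen A).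
  apply: prefix_trans; rewrite prefix_cons eqxx /= tQ tR.
  by rewrite -(take_takel _ le) prefix_take.
have EAB : pre Q = pre R.
  apply/eqP; rewrite -EQ -ER eqEsubset AB /= EQ ER tQ tR.
  exact: sub_cls.
have := grp_pre lQ; rewrite EAB grp_pre // => /setP /(_ c).
by rewrite !inE => ->.
Qed.

(** Groups are kept as sets of links, without their locus, so that different loci can share one. *)
Definition items A : {set {set link}} :=
  if A \in fam then [set grp A (lowlen (val b)) | b in cset A] else set0.

Lemma itemsP A G :
  reflect (A \in fam /\ exists2 b, b \in cset A & G = grp A (lowlen (val b)))
          (G \in items A).
Proof.
rewrite /items; case: ifP => fA; last by rewrite in_set0; constructor; case.
by apply: (iffP imsetP) => [|[_]].
Qed.

Lemma items_sub A : items A \subset PrefixFamily.fam key2.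
Proof.
apply/subsetP => G /itemsP [fA [b bA ->]]; apply: grp_fam => //.
by apply/set0Pn; exists b; rewrite inE bA eqxx.
Qed.

Lemma items_small A : #|items A| <= (minlen A).+1.
Proof.
rewrite -[X in _ <= X]card_ord.
apply: leq_trans (leq_imset_card (fun l : 'I_(minlen A).+1 => grp A l) _).
apply: subset_leq_card; apply/subsetP => G /itemsP [fA [b bA ->]].
apply/imsetP; have H := cset_low fA bA.
by exists (Ordinal (H : lowlen (val b) < (minlen A).+1)).
Qed.

Lemma item_nonempty A G : G \in items A ->
  exists2 b, b \in G & [/\ b \in cset A & G = grp A (lowlen (val b))].
Proof.
by case/itemsP => fA [b bA ->]; exists b => //; rewrite inE bA eqxx.
Qed.

Lemma item_mem A G b : G \in items A -> b \in G ->
  b \in cset A /\ G = grp A (lowlen (val b)).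
Proof. by case/itemsP => fA [c cA ->]; rewrite inE => /andP[bA /eqP ->]. Qed.

(** A link of [G] crosses [B] as well, and its group at [B] is squeezed between those at [A] and at
    [C], which are both [G]. *)
Lemma items_between A B C G : B \in fam ->
  A \subset B -> B \subset C -> G \in items A -> G \in items C -> G \in items B.
Proof.
move=> fB AB BC GA GC; have [b bG [bA EA]] := item_nonempty GA.
have [bC EC] := item_mem GC bG.
have bB := cset_between AB BC bA bC.
have [fA _] := itemsP _ _ GA; have [fC _] := itemsP _ _ GC.
apply/itemsP; split=> //; exists b => //; apply/eqP; rewrite eqEsubset.
by rewrite {1}EA grp_mono //= EC grp_mono.
Qed.

Definition parent A : option {set X} :=
  if A \in fam then
    [pick B in fam | (A \proper B) &&
       [forall C in fam, (A \proper C) ==> (B \subset C)]]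
  else None.

Lemma parentP A B : parent A = Some B ->
  [/\ A \in fam, B \in fam, A \proper B &
     forall C, C \in fam -> A \proper C -> B \subset C].
Proof.
rewrite /parent; case: ifP => // fA; case: pickP => // B' /and3P[fB AB /forall_inP H] [<-].
by split=> // C fC AC; apply: (implyP (H _ fC)).
Qed.

(** The child is a largest locus that contains [A] and is properly contained in [B]. *)
Lemma child_towards A B : A \in fam -> B \in fam -> A \proper B ->
  exists C, [/\ C \in fam, A \subset C, C \subset B & parent C = Some B].
Proof.
move=> fA fB AB.
pose F := [set C in fam | (A \subset C) && (C \proper B)].
have AF : A \in F by rewrite inE fA subxx.
case: (@arg_maxnP _ A (mem F) (fun C => #|C|) AF) => C CF Cmax.
have := CF; rewrite /= inE => /and3P[fC AC CB].
exists C; split=> //; first exact: proper_sub.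
have /set0Pn [x xC] := fam_nonempty fC.
have Bmin D : D \in fam -> C \proper D -> B \subset D.
  move=> fD CD.
  have /orP[//|DB] : (B \subset D) || (D \subset B).
    apply: (fam_laminar fB fD); apply/set0Pn; exists x.
    by rewrite inE (subsetP (proper_sub CB)) ?(subsetP (proper_sub CD)).
  have [->//|neDB] := eqVneq D B.
  have DF : D \in F.
    by rewrite inE fD properEneq neDB DB (subset_trans AC (proper_sub CD)).
  by have := Cmax D DF; rewrite /= leqNgt (proper_card CD).
rewrite /parent fC; case: pickP => [B' /and3P[fB' CB' /forall_inP H]|/(_ B)].
  congr Some; apply/eqP; rewrite eqEsubset Bmin // andbT.
  by apply: (implyP (H _ fB)).
rewrite fB CB /= => /negP []; apply/forall_inP => D fD; apply/implyP; exact: Bmin.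
Qed.

Lemma minlen_sub A B : A \in fam -> B \in fam -> A \subset B ->
  minlen B <= minlen A.
Proof.
move=> fA fB AB; have /set0Pn [x xA] := fam_nonempty fA.
have [Q [EQ sQ tQ]] := fam_string fA xA.
have [R [ER sR tR]] := fam_string fB (subsetP AB _ xA).
rewrite leqNgt; apply/negP => lt.
have EAB : A = B.
  by apply/eqP; rewrite eqEsubset AB /= EQ ER tQ tR; apply/sub_cls/ltnW.
by rewrite EAB ltnn in lt.
Qed.

(** Loci with a common group share a position and are nested, say [A] inside [B]. If they differ,
    the child of [B] towards [A] has the group by [items_between], so [B] does not own it. *)
Lemma own_items_inj A B G :
  G \in own parent items A -> G \in own parent items B -> A = B.
Proof.
rewrite !inE => /andP[nA GA] /andP[nB GB].
have [b bG [bA EA]] := item_nonempty GA.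
have [bB EB] := item_mem GB bG.
have [x xb] := link_nonempty b.
have [fA _] := itemsP _ _ GA; have [fB _] := itemsP _ _ GB.
have xAB : A :&: B != set0.
  by apply/set0Pn; exists x; rewrite inE (subsetP (cset_sub bA)) ?(subsetP (cset_sub bB)).
wlog AB : A B nA GA nB GB bA EA bB EB fA fB xAB / A \subset B.
  move=> H; case/orP: (fam_laminar fA fB xAB) => AB; first exact: H.
  by symmetry; apply: H; rewrite // setIC.
have [//|neAB] := eqVneq A B.
have pAB : A \proper B by rewrite properEneq neAB.
have [C [fC AC CB EC]] := child_towards fA fB pAB.
by case/bigcupP: nB; exists C; rewrite ?EC //; apply: items_between GA GB.
Qed.

End Links.

End Links.
Import Links.

(** * Contents of the index and correctness of the query *)

Module IndexTable.

Definition query : cmd := (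
  Set_ vN (Ld cHDR (K 0));;
  Set_ vn (Ld cHDR (K 1));;
  Set_ vs (Ld cHDR (K 2));;
  descend;;
  verify;;
  If (V vok) retrieve skip)%cmd.

Record dictionary := Dictionary {
  d_mult : nat; d_shift : nat; d_buckets : nat; d_entries : nat;
  d_mult2 : nat -> nat; d_shift2 : nat -> nat; d_off : nat -> nat
}.

Definition d_bucket (w : nat) (d : dictionary) (c : nat) : nat :=
  mulshift w (d_mult d) (d_shift d) c.
Definition d_slot (w : nat) (d : dictionary) (c : nat) : nat :=
  d_off d (d_bucket w d c) +
  mulshift w (d_mult2 d (d_bucket w d c)) (d_shift2 d (d_bucket w d c)) c.

Definition dictionary_for (w : nat) (K : seq nat) (d : dictionary) : Prop :=
  [/\ [/\ d_mult d < 2 ^ w, d_shift d <= w, d_buckets d <= 4 * size K + 1 &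
         d_entries d <= 20 * size K + 3],
      forall j, d_mult2 d j < 2 ^ w /\ d_shift2 d j <= w,
      forall c, c < 2 ^ w -> d_bucket w d c < d_buckets d /\ d_slot w d c < d_entries d &
      {in K &, injective (d_slot w d)}].

Lemma dictionary_exists w (K : seq nat) :
  0 < w -> uniq K -> {in K, forall x, x < 2 ^ w} -> 4 * size K ^ 2 + 4 <= 2 ^ w ->
  exists d, dictionary_for w K d.
Proof.
move=> w0 uK HK HW.
have [a [s [nb [tot [a2 [s2 [off [H1 H2 H3 H4]]]]]]]] := perfect_hashing w0 uK HK HW.
by exists (Dictionary a s nb tot a2 s2 off).
Qed.

Lemma size_enumeration (T : finType) (l : seq T) : uniq l -> l =i predT -> size l = #|T|.
Proof.
move=> ul al; rewrite cardE; apply: perm_size; apply: uniq_perm; rewrite ?enum_uniq // => x.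
by rewrite al mem_enum.
Qed.

Section Interval.
Variables (X : finType) (e : seq X).

Definition interval (V : {set X}) : nat * nat :=
  if [pick p : 'I_(size e).+1 * 'I_(size e).+1 |
        [forall x, (x \in V) == (p.1 <= index x e < p.2)]] is Some p
  then (p.1 : nat, p.2 : nat) else (0, 0).

Lemma intervalP (V : {set X}) :
  (exists lo hi, lo <= hi <= size e /\ forall x, (x \in V) = (lo <= index x e < hi)) ->
  forall x, (x \in V) = ((interval V).1 <= index x e < (interval V).2).
Proof.
move=> [lo [hi [/andP[H1 H2] H]]]; rewrite /interval.
have L1 : lo < (size e).+1 by rewrite ltnS (leq_trans H1).
have L2 : hi < (size e).+1 by rewrite ltnS.
case: pickP => [p /forallP Hp x|/(_ (Ordinal L1, Ordinal L2)) /negP []].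
  by apply/eqP; apply: Hp.
by apply/forallP => x; rewrite H.
Qed.

Lemma interval_le (V : {set X}) : (interval V).1 <= size e /\ (interval V).2 <= size e.
Proof.
rewrite /interval; case: pickP => //= p _.
by have := ltn_ord p.1; have := ltn_ord p.2; rewrite !ltnS.
Qed.

End Interval.

(* Half-logarithmic blocks make the table indexed by block types and offsets linear in [n]. *)
Definition block (n : nat) : nat := uphalf (up_log 2 n).

(** The second bound makes the table of block types linear. By the last one the sparse table has
    O([block n]) levels, each with one entry per block, which is again linear. *)
Lemma block_bounds n : 1 < n ->
  [/\ 0 < block n, block n * 2 ^ block n <= 4 * n, block n <= 2 * n &
   forall l, 0 < l <= 2 * n -> trunc_log 2 l <= (block n).*2.+1].
Proof.
move=> n1; rewrite /block; set L := up_log 2 n.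
have L0 : 0 < L by rewrite up_log_gt0.
have /andP[nL Ln] := up_log2_bounds n; rewrite -/L in nL Ln.
have HL : 2 ^ L < 2 * n.
  have /andP[+ _] := @up_log_bounds 2 n isT n1; rewrite -/L.
  by case: (L) L0 => // k _ /=; rewrite expnS; lia.
have s0 : 0 < uphalf L by rewrite uphalf_gt0.
have s2 : (uphalf L).*2 <= L.+1 by rewrite uphalfE; lia.
have s2' : L <= (uphalf L).*2 by rewrite uphalfE; lia.
set s := uphalf L in s0 s2 s2' *.
have lt2 : s < 2 ^ s by apply: ltn_expl.
have H4 : s * 2 ^ s <= 4 * n.
  apply: (@leq_trans (2 ^ s * 2 ^ s)); first by rewrite leq_mul2r ltnW ?orbT.
  rewrite -expnD addnn; apply: (@leq_trans (2 ^ L.+1)); first by rewrite leq_exp2l.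
  by rewrite expnS; lia.
split=> //.
  have : 2 <= 2 ^ s by rewrite -{1}(expn1 2) leq_exp2l.
  by move: H4; move: (2 ^ s) => z; nia.
move=> l /andP[l0 ln].
have H1 := trunc_logP (isT : 1 < 2) l0.
have : 2 ^ trunc_log 2 l <= 2 ^ L.+1.
  by apply: (leq_trans H1); apply: (leq_trans ln); rewrite expnS leq_mul2l.
by rewrite leq_exp2l // => H; apply: (leq_trans H); rewrite ltnS.
Qed.

Section Index.
Variables (w n : nat) (X : finType) (key : X -> seq nat) (dn : X -> nat).
Implicit Types (B C U V : {set X}) (Q : seq nat).
Variables (txt : nat -> nat) (tx : X -> nat).
Hypothesis n_gt1 : 1 < n.
Hypothesis cardX : #|X| = n.
Hypothesis HW : 1000 * ((64 * n) * (64 * n)) + 1000 <= 2 ^ w.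
Hypothesis dn_word : forall x, dn x < 2 ^ w.
Hypothesis txt_word : forall r, txt r < 2 ^ w.
Hypothesis txt_key : forall x j, j < size (key x) ->
  tx x + j < n /\ txt (tx x + j) = nth 0 (key x) j.
Hypothesis tx_le : forall x, tx x <= n.

Notation fam := (fam key).
Notation minlen := (minlen key).
Notation maxlen := (maxlen key).
Notation link := (link key dn).
Notation items := (@Links.items X key dn).
Notation cset := (@Links.cset X key dn).
Notation grp := (@Links.grp X key dn).

Implicit Types (b : link) (G : {set link}).

Variables (ord e : seq link) (eX : seq X).
Hypothesis ord_uniq : uniq ord.
Hypothesis ord_all : ord =i predT.
Hypothesis e_uniq : uniq e.
Hypothesis e_all : e =i predT.
Hypothesis e_interval : forall Q, exists lo hi, lo <= hi <= size e /\
  forall b : link, (b \in PrefixFamily.pre (@key2 X key dn) Q) = (lo <= index b e < hi).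
Hypothesis eX_all : eX =i predT.
Hypothesis eX_uniq : uniq eX.
Hypothesis eX_interval : forall Q, exists lo hi, lo <= hi <= size eX /\
  forall x, (x \in pre key Q) = (lo <= index x eX < hi).
Variable D : {set X} -> dictionary.
Hypothesis D_ok : forall V, V \in fam -> dictionary_for w (keys key V) (D V).

Definition bsize V : nat := if V \in fam then d_buckets (D V) else 0.
Definition esize V : nat := if V \in fam then d_entries (D V) else 0.
Notation par := (parent key).
Notation lst := (lst par (fun V : {set X} => #|V|) (fun V => (minlen V).+1) items).
Notation top := (top par (fun V : {set X} => #|V|) (fun V => (minlen V).+1) items).
Definition lsize V : nat := if top V then #|lst V| else 0.

Variables (offB offE offL : {set X} -> nat) (invB invE invL : nat -> option ({set X} * nat)).
Definition allocated (sz : {set X} -> nat) (off : {set X} -> nat)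
    (inv : nat -> option ({set X} * nat)) : Prop :=
  [/\ forall V, off V + sz V <= \sum_V sz V,
   forall V i, i < sz V -> inv (off V + i) = Some (V, i) &
   forall r V i, inv r = Some (V, i) -> i < sz V].
Hypothesis allocB : allocated bsize offB invB.
Hypothesis allocE : allocated esize offE invE.
Hypothesis allocL : allocated lsize offL invL.
Variable reg : {set X} -> {set X}.
Hypothesis reg_ok : forall V, [/\ top (reg V), lst V \subset lst (reg V) &
  #|lst (reg V)| <= 3 * (minlen V).+1].

(** The largest bound is that for the hash entries: at most [20 * m + 3] at a node with [m] edges,
    hence [46 * n] over at most [2 * n] nodes and as many edges. *)
Definition nrows := 64 * n.
Definition nlinks := #|{: link}|.
Definition blk := block n.
Definition nblks := (nlinks %/ blk).+1.
(** Ranks start at 1, so that 0 can mark the absence of a link. *)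
Definition rank (b : link) : nat := (index b ord).+1.
Definition rk (i : nat) : nat := nth 0 [seq rank b | b <- e] i.
(** The root is put in front to get row 0; its other occurrence is never found by [index]. *)
Definition row V : nat := index V ([set: X] :: enum fam).
Definition node (r : nat) : {set X} := nth set0 ([set: X] :: enum fam) r.
Definition rep V : option X := [pick x in V].
Definition entry_key V (i : nat) : nat :=
  nth 0 (keys key V) (find (fun c => d_slot w (D V) c == i) (keys key V)).
Definition child_row V (c : nat) : nat :=
  if child key V c == set0 then 0 else row (child key V c).
Definition item_rep (G : {set link}) : option X :=
  [pick x | [exists b in G, x \in val b]].
(** With [item_high], the range of depths of the loci that have the group. The shifts in the columns
    make all four comparisons of the test strict, and the default 0 of [item_high] rejects every
    locus. *)
Definition item_low (G : {set link}) : nat :=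
  if [pick V | (G \in items V) && [forall U, (G \in items U) ==> (minlen V <= minlen U)]]
  is Some U then minlen U else 0.
Definition item_high (G : {set link}) : nat :=
  if [pick V | (G \in items V) && [forall U, (G \in items U) ==> (minlen U <= minlen V)]]
  is Some U then (minlen U).+2 else 0.
Definition item (r : nat) : {set link} :=
  if invL r is Some (t, i) then nth set0 (enum (lst t)) i else set0.
Definition ranked (r : nat) : option link := [pick b | rank b == r].

Definition column (c r : nat) : nat :=
  nth 0 [::
    nth 0 [:: nrows; n; blk; nblks] r;
    txt r;
    maxlen (node r);
    d_mult (D (node r));
    d_shift (D (node r));
    offB (node r);
    (if rep (node r) is Some x then tx x else 0);
    (if rep (node r) is Some x then size (key x) else 0);
    (interval eX (node r)).1;
    (interval eX (node r)).2.+1;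
    (minlen (node r)).+1;
    offL (reg (node r));
    #|lst (reg (node r))|;
    (if invB r is Some (U, i) then d_mult2 (D U) i else 0);
    (if invB r is Some (U, i) then d_shift2 (D U) i else 0);
    (if invB r is Some (U, i) then offE U + d_off (D U) i else 0);
    (if invE r is Some (U, i) then entry_key U i else 0);
    (if invE r is Some (U, i) then child_row U (entry_key U i) else 0);
    (if item_rep (item r) is Some x then (index x eX).+1 else 0);
    item_low (item r);
    item_high (item r);
    (interval e (item r)).1;
    (interval e (item r)).2;
    mx rk (interval e (item r)).1 (interval e (item r)).2;
    rk r;
    mx rk r ((r %/ blk).+1 * blk);
    mx rk ((r %/ blk) * blk) r;
    code rk blk r * blk;
    (if ranked r is Some b then if rep (val b) is Some x then dn x else 0 else 0);
    (if ranked r is Some b then index b e else 0);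
    first_from blk (r %/ blk) (r %% blk);
    trunc_log 2 r * nblks;
    2 ^ trunc_log 2 r;
    mx rk ((r %% nblks) * blk) ((r %% nblks + 2 ^ (r %/ nblks)) * blk)] c.

(* The values are words wherever they are used; truncation makes all of them so. *)
Definition table (c r : nat) : nat := let v := column c r in if v < 2 ^ w then v else 0.

Lemma table_word c r : table c r < 2 ^ w.
Proof. by rewrite /table; case: ifP => // _; rewrite expn_gt0. Qed.

Lemma tableE c r : column c r < 2 ^ w -> table c r = column c r.
Proof. by rewrite /table => ->. Qed.

Lemma nrows_word : nrows < 2 ^ w.
Proof. by have := HW; rewrite /nrows; nia. Qed.

Lemma tableE_small c r : column c r <= nrows -> table c r = column c r.
Proof. by move=> H; apply: tableE; apply: leq_ltn_trans nrows_word. Qed.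

Lemma nlinks_le : nlinks <= 2 * n.
Proof. by rewrite -cardX; apply: card_link. Qed.

Lemma size_e : size e = nlinks.
Proof. exact: size_enumeration. Qed.

Lemma size_ord : size ord = nlinks.
Proof. exact: size_enumeration. Qed.

Lemma size_eX : size eX = n.
Proof. by rewrite -cardX; apply: size_enumeration. Qed.

Lemma rank_le b : 0 < rank b <= nlinks.
Proof. by rewrite /rank /= -size_ord index_mem ord_all. Qed.

Lemma rank_inj : injective rank.
Proof. by move=> b c []; apply: index_inj; rewrite ?ord_all. Qed.

Lemma rk_index b : rk (index b e) = rank b.
Proof. by rewrite /rk (nth_map b) ?nth_index ?index_mem ?e_all. Qed.

Lemma index_e b : index b e < nlinks.
Proof. by rewrite -size_e index_mem e_all. Qed.

Lemma index_onto i : i < nlinks -> exists b, index b e = i.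
Proof.
rewrite -size_e; case E: e => [|b0 e'] // Hi; rewrite -E in Hi *.
by exists (nth b0 e i); rewrite index_uniq.
Qed.

Lemma rk_out i : nlinks <= i -> rk i = 0.
Proof. by move=> H; rewrite /rk nth_default // size_map size_e. Qed.

Lemma rk_le i : rk i <= nlinks.
Proof.
have [/index_onto [b <-]|/rk_out -> //] := ltnP i nlinks.
by rewrite rk_index; case/andP: (rank_le b).
Qed.

Lemma rk_lt i : rk i < nrows.
Proof. by have := rk_le i; have := nlinks_le; rewrite /nrows; lia. Qed.

Lemma rk_pos i : 0 < rk i -> i < nlinks.
Proof. by rewrite ltnNge => H; apply: contraTltn H => /rk_out ->. Qed.

Lemma mx_le_nlinks l r : mx rk l r <= nlinks.
Proof. by apply: mx_leq => i _; apply: rk_le. Qed.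

Lemma ranked_rank b : ranked (rank b) = Some b.
Proof.
rewrite /ranked; case: pickP => [c /eqP /rank_inj -> //|/(_ b)].
by rewrite eqxx.
Qed.

Lemma nlinks_nrows : nlinks <= nrows. Proof. by have := nlinks_le; rewrite /nrows; lia. Qed.

Lemma pos_rk i : i < nlinks -> table cPOS (rk i) = i.
Proof.
move=> iM; have [b Eb] := index_onto iM.
rewrite tableE_small /column /= -Eb rk_index ranked_rank //.
by rewrite (leq_trans (ltnW (index_e b))) // nlinks_nrows.
Qed.

Lemma index_rmq : rmq_index nrows table rk nlinks blk nblks.
Proof.
have [s0 s1 s2 Hlog] := block_bounds n_gt1; rewrite -/blk in s0 s1 s2 Hlog.
have ML := nlinks_le; have MN := nlinks_nrows.
have mxN l r : mx rk l r <= nrows by apply: leq_trans (mx_le_nlinks _ _) MN.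
have MB : nlinks %/ blk <= nlinks by apply: leq_div.
have spt l : 0 < l <= nlinks -> (trunc_log 2 l).+1 * nblks <= nrows.
  move=> Hl; have {}Hl : trunc_log 2 l <= blk.*2.+1 by apply: Hlog; lia.
  have := leq_trunc_div nlinks blk; rewrite /nblks /nrows.
  move: Hl s2 MB ML; move: (trunc_log 2 l) (nlinks %/ blk) (nlinks) (blk) => a b c d; nia.
split=> //.
- by rewrite /nrows; lia.
- by move=> i iN; rewrite tableE_small // /column /=; apply: ltnW; apply: rk_lt.
- by move=> l lM; rewrite tableE_small //; apply: mxN.
- by move=> r rM; rewrite tableE_small //; apply: mxN.
- move=> r rM; rewrite tableE_small // /column /=.
  apply: (@leq_trans (2 ^ blk * blk)); first by rewrite leq_mul2r ltnW ?code_lt ?orbT.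
  by rewrite mulnC /nrows; lia.
- by rewrite mulnC /nrows; lia.
- move=> c o cs os; rewrite tableE_small /column /=.
    by rewrite divnMDl // divn_small // addn0 modnMDl modn_small.
  by apply: leq_trans (first_from_le _ _ _) _; rewrite /nrows; lia.
- move=> l Hl; rewrite !tableE_small //.
  + have /andP[l0 lM] := Hl; apply: leq_trans (trunc_logP (isT : 1 < 2) l0) _.
    exact: leq_trans MN.
  + by apply: leq_trans (spt l Hl); rewrite leq_mul2r leqnSn orbT.
- move=> l Hl; apply: spt; lia.
- move=> l b Hl bN; rewrite tableE_small /column /=.
    by rewrite divnMDl // divn_small // addn0 modnMDl modn_small.
  exact: mxN.
Qed.

Lemma X_inhabited : exists x : X, x \in [set: X].
Proof. by apply/set0Pn; rewrite -card_gt0 cardsT cardX; lia. Qed.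

Lemma root_fam : [set: X] \in fam.
Proof.
have [x _] := X_inhabited.
have E : pre key [::] = [set: X] by apply/setP => y; rewrite !inE prefix0s.
by rewrite -E; apply: (@len_fam _ _ _ (size (Nil nat))); apply: (@len_pre _ _ _ x); rewrite E inE.
Qed.

Lemma card_fam_le : #|fam| <= 2 * n.
Proof. by rewrite -cardX; apply: card_fam. Qed.

Lemma node_row B : B \in fam -> node (row B) = B.
Proof. by move=> fB; rewrite /node nth_index // inE mem_enum fB orbT. Qed.

Lemma row_lt B : row B <= 2 * n + 1.
Proof.
apply: leq_trans (index_size _ _) _ => /=; rewrite -cardE.
by have := card_fam_le; move: #|_| => z; lia.
Qed.

Lemma size_key (x : X) : size (key x) <= n.
Proof.
case E: (size (key x)) => [|j] //.
have jx : j < size (key x) by rewrite E.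
by have [H _] := txt_key jx; lia.
Qed.

Lemma repP B : B \in fam -> exists2 x, rep B = Some x & x \in B.
Proof.
move=> /fam_nonempty /set0Pn [x xB]; rewrite /rep.
by case: pickP => [y yB|/(_ x)]; [exists y | rewrite xB].
Qed.

Lemma len_le B l : len key B l -> l <= n.
Proof. by case/existsP => x /andP[H _]; apply: leq_trans (size_key x). Qed.

Lemma sum_fam (f : {set X} -> nat) :
  \sum_B (if B \in fam then f B else 0) = \sum_(B in fam) f B.
Proof. by rewrite -big_mkcond. Qed.

Lemma sum_dictionaries (a b : nat) :
  \sum_(B in fam) (a * size (keys key B) + b) <= (a + b) * (2 * n).
Proof.
rewrite big_split /= -big_distrr /= sum_nat_const.
have := sum_keys key; have := card_fam_le.
by move: #|_| (\sum_(_ in _) _) => u v; nia.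
Qed.

Lemma sum_bsize : \sum_B bsize B <= nrows.
Proof.
rewrite /bsize sum_fam; apply: (@leq_trans ((4 + 1) * (2 * n))); last by rewrite /nrows; lia.
apply: leq_trans (sum_dictionaries 4 1); apply: leq_sum => B fB.
by have [[]] := D_ok fB.
Qed.

Lemma sum_esize : \sum_B esize B <= nrows.
Proof.
rewrite /esize sum_fam; apply: (@leq_trans ((20 + 3) * (2 * n))); last by rewrite /nrows; lia.
apply: leq_trans (sum_dictionaries 20 3); apply: leq_sum => B fB.
by have [[]] := D_ok fB.
Qed.

Lemma key_word (x : X) j : nth 0 (key x) j < 2 ^ w.
Proof.
have [H|H] := ltnP j (size (key x)); last by rewrite nth_default // expn_gt0.
by have [_ <-] := txt_key H.
Qed.

Lemma entry_key_word B i : entry_key B i < 2 ^ w.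
Proof.
rewrite /entry_key; set j := find _ _.
have [H|H] := ltnP j (size (keys key B)); last by rewrite nth_default // expn_gt0.
have := mem_nth 0 H; rewrite mem_undup => /mapP [y _ ->]; exact: key_word.
Qed.

Lemma w_word : w < 2 ^ w. Proof. exact: ltn_expl. Qed.

Lemma index_trie : trie_index w nrows table key row tx.
Proof.
have row_N B : row B <= nrows by apply: leq_trans (row_lt B) _; rewrite /nrows; lia.
have nN : n <= nrows by rewrite /nrows; lia.
split.
- by split; [apply: root_fam | rewrite /row /= eqxx].
- by move=> B fB; apply: leq_ltn_trans (row_lt B) _; rewrite /nrows; lia.
- move=> B fB; rewrite tableE_small /column /= node_row //.
  by apply: leq_trans nN; apply: len_le (len_maxlen fB).
- move=> B fB; have [x Ex xB] := repP fB; exists x => //.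
  rewrite !tableE_small /column /= node_row // Ex //.
    by apply: leq_trans (size_key x) nN.
  by apply: leq_trans (tx_le x) nN.
- move=> x j H; have [H1 H2] := txt_key H; split; first exact: leq_trans nN.
  by rewrite tableE /column /= ?H2 //; apply: key_word.
- by move=> x; apply: leq_ltn_trans (size_key x) _; rewrite /nrows; lia.
- move=> B c fB cW.
  have [[D1 D2 D3 D4] D5 D6 D7] := D_ok fB.
  have [cB cE] := D6 c cW.
  have [B1 B2 B3] := allocB; have [E1 E2 E3] := allocE.
  have bB : d_bucket w (D B) c < bsize B by rewrite /bsize fB.
  have eB : d_slot w (D B) c < esize B by rewrite /esize fB.
  have bN : offB B + d_bucket w (D B) c < nrows.
    by apply: leq_trans sum_bsize; apply: leq_trans (B1 B); rewrite ltn_add2l.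
  have eN : offE B + d_slot w (D B) c < nrows.
    by apply: leq_trans sum_esize; apply: leq_trans (E1 B); rewrite ltn_add2l.
  have Eb : bucket w table (row B) c = offB B + d_bucket w (D B) c.
    rewrite /bucket tableE_small /column /= node_row //; last first.
      by apply: leq_trans (ltnW bN); apply: leq_addr.
    rewrite tableE /column /= node_row // tableE /column /= node_row //.
    exact: leq_ltn_trans D2 w_word.
  have [M1 M2] := D5 (d_bucket w (D B) c).
  have Ee : entry w table (bucket w table (row B) c) c = offE B + d_slot w (D B) c.
    rewrite Eb /entry tableE_small /column /= B2 //; last first.
      by apply: leq_trans (ltnW eN); rewrite leq_add2l leq_addr.
    rewrite tableE /column /= B2 // tableE /column /= B2 //; last exact: leq_ltn_trans M2 w_word.
    by rewrite /d_slot addnA.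
  rewrite Ee Eb; split=> //.
  rewrite tableE /column /= E2 //; last exact: entry_key_word.
  have crN u : child_row B u <= nrows by rewrite /child_row; case: ifP.
  rewrite tableE_small /column /= E2 //; last exact: crN.
  rewrite -/(child_row B c).
  have [cK|cK] := boolP (c \in keys key B).
    suff -> : entry_key B (d_slot w (D B) c) = c by rewrite eqxx mul1n.
    have Hh : has (fun x => d_slot w (D B) x == d_slot w (D B) c) (keys key B).
      by apply/hasP; exists c.
    apply: D7 => //; first by rewrite /entry_key mem_nth // -has_find.
    by have /eqP := nth_find 0 Hh.
  case: eqP => [->|_]; first by rewrite mul1n.
  by move: cK; rewrite mem_keys negbK /child_row => ->.
(* If the child were the root, so would be its parent [B], against the growth of [maxlen]. *)
- move=> B c fB ne; have [fC ltC] := child_fam fB ne.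
  rewrite /row /=; case: eqP => // E; move: ltC; rewrite -E ltnNge.
  have sub : child key B c \subset B by apply/subsetP => y; rewrite inE => /andP[].
  have BT : B = [set: X] by apply/eqP; rewrite eqEsubset subsetT E.
  by rewrite BT leqnn.
Qed.

Lemma mu_parent B C : par B = Some C -> #|B| < #|C|.
Proof. by case/parentP => _ _ /proper_card. Qed.

Lemma minlen_parent B C : par B = Some C -> (minlen C).+1 <= (minlen B).+1.
Proof. by case/parentP => fB fC /proper_sub BC _; rewrite ltnS; apply: minlen_sub. Qed.

(** There are at most [2 * nlinks], hence [4 * n] groups, and [sum_top] contributes the factor
    [3 / 2]. *)
Lemma sum_lsize : \sum_B lsize B <= 6 * n.
Proof.
have H := sum_top mu_parent (@items_small X key dn) (@items_sub X key dn)
  (@own_items_inj X key dn).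
have H2 : #|PrefixFamily.fam (@key2 X key dn)| <= 2 * nlinks by apply: card_fam.
rewrite /lsize -big_mkcond /=; have := nlinks_le; move: H H2.
by move: (\sum_(_ | _) _) #|_| => u v; lia.
Qed.

Lemma fam_interval B : B \in fam ->
  forall x, (x \in B) = ((interval eX B).1 <= index x eX < (interval eX B).2).
Proof.
move=> fB; apply: intervalP; have [x xB] := set0Pn _ (fam_nonempty fB).
have [Q [-> _ _]] := fam_string fB xB; exact: eX_interval.
Qed.

Lemma item_interval G B : G \in items B ->
  forall b, (b \in G) = ((interval e G).1 <= index b e < (interval e G).2).
Proof.
move=> GB; have fG := subsetP (@items_sub X key dn B) _ GB.
apply: intervalP; have [b bG] := set0Pn _ (fam_nonempty fG).
have [Q [-> _ _]] := fam_string fG bG; exact: e_interval.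
Qed.

Section Locus.
Variable B : {set X}.
Hypothesis fB : B \in fam.
Let LP := offL (reg B).
Let LL := #|lst (reg B)|.

Lemma list_fits : LP + LL <= 6 * n.
Proof.
have [t1 _ _] := reg_ok B; have [H _ _] := allocL.
by have := H (reg B); rewrite {1}/lsize t1 => /leq_trans; apply; apply: sum_lsize.
Qed.

Lemma list_ptr : table cLPTR (row B) = LP.
Proof.
by rewrite tableE_small /column /= node_row //; have := list_fits; rewrite /nrows /LP; lia.
Qed.

Lemma list_len : table cLLEN (row B) = LL.
Proof.
rewrite tableE_small /column /= node_row //; have := list_fits; rewrite /nrows -/LL.
by move: LP LL => u v; lia.
Qed.

Lemma item_list q : q < LL -> item (LP + q) = nth set0 (enum (lst (reg B))) q.
Proof.
move=> qL; have [t1 _ _] := reg_ok B; have [_ H _] := allocL.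
by rewrite /item H // /lsize t1.
Qed.

Lemma index_item_low r : table cDLO r = item_low (item r).
Proof.
rewrite tableE_small // /column /= /item_low; case: pickP => // U /andP[/itemsP [fU _] _].
by have := len_le (len_minlen fU); rewrite /nrows; lia.
Qed.

Lemma index_item_high r : table cDHI r = item_high (item r).
Proof.
rewrite tableE_small // /column /= /item_high; case: pickP => // U /andP[/itemsP [fU _] _].
by have := len_le (len_minlen fU); rewrite /nrows; lia.
Qed.

Lemma item_repP G U : G \in items U ->
  exists2 x, item_rep G = Some x & forall U', G \in items U' -> x \in U'.
Proof.
move=> GU; rewrite /item_rep; case: pickP => [x /exists_inP [b bG xb]|H].
  exists x => // U' GU'; have [bU' _] := item_mem GU' bG.
  exact: subsetP (cset_sub bU') _ xb.
have [b bG _] := item_nonempty GU; have [x xb] := link_nonempty b.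
by have /exists_inP [] := H x; exists b.
Qed.

Lemma item_lowP G U : G \in items U ->
  exists2 U', G \in items U' & item_low G = minlen U' /\ minlen U' <= minlen U.
Proof.
move=> GU; rewrite /item_low; case: pickP => [U' /andP[GU' /forallP H]|H].
  by exists U' => //; split=> //; apply: (implyP (H U)).
have [U' /= GU' Hmin] := @arg_minnP _ U (fun U => G \in items U) minlen GU.
have /negP [] := H U'; rewrite GU' /=; apply/forallP => U2; apply/implyP; exact: Hmin.
Qed.

Lemma item_highP G U : G \in items U ->
  exists2 U', G \in items U' & item_high G = (minlen U').+2 /\ minlen U <= minlen U'.
Proof.
move=> GU; rewrite /item_high; case: pickP => [U' /andP[GU' /forallP H]|H].
  by exists U' => //; split=> //; apply: (implyP (H U)).
have [U' /= GU' Hmax] := @arg_maxnP _ U (fun U => G \in items U) minlen GU.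
have /negP [] := H U'; rewrite GU' /=; apply/forallP => U2; apply/implyP; exact: Hmax.
Qed.

Lemma sub_minlen U V (x : X) : U \in fam -> V \in fam ->
  x \in U -> x \in V -> minlen V <= minlen U -> U \subset V.
Proof.
move=> fU fV xU xV le.
have [_ EU] := lenP key _ xU (len_minlen fU); have [_ EV] := lenP key _ xV (len_minlen fV).
by have := sub_cls key x le; rewrite -EU -EV.
Qed.

(** The stored position lies in every locus that has the group. If it lies in [B] as well and the
    depth of [B] is in range, then [B] is nested between the deepest and the shallowest such locus,
    and [items_between] applies. *)
Lemma index_crosses r : crosses table (row B) r = (item r \in items B).
Proof.
have [x0 x0B] := set0Pn _ (fam_nonempty fB).
have [Hi1 Hi2] := interval_le eX B; rewrite size_eX in Hi1 Hi2.
have ESP : table cSP (row B) = (interval eX B).1.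
  by rewrite tableE_small /column /= node_row // /nrows; lia.
have EEP : table cEP (row B) = (interval eX B).2.+1.
  by rewrite tableE_small /column /= node_row // /nrows; lia.
have EDEP : table cDEP (row B) = (minlen B).+1.
  rewrite tableE_small /column /= node_row //.
  by have := len_le (len_minlen fB); rewrite /nrows; lia.
have EX : table cXPOS r = if item_rep (item r) is Some x then (index x eX).+1 else 0.
  rewrite tableE_small // /column /=; case: (item_rep _) => //= x.
  have := index_size x eX; rewrite size_eX /nrows; have := n_gt1.
  by move: (index x eX) => z; clear; lia.
rewrite /crosses ESP EEP EDEP EX index_item_low index_item_high.
apply/idP/idP => [/andP[H1 /andP[H2 H3]]|GB].
  have [U GU [EU leU]] : exists2 U, item r \in items U &
      item_high (item r) = (minlen U).+2 /\ minlen B <= minlen U.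
    move: H3; rewrite /item_high; case: pickP => // U /andP[GU _] H3.
    by exists U => //; split=> //; lia.
  have [x Ex xmem] := item_repP GU; rewrite Ex in H1.
  have [U' GU' [EU' _]] := item_lowP GU; rewrite EU' in H2.
  have xB : x \in B by rewrite fam_interval //; lia.
  have [fU _] := itemsP _ _ GU; have [fU' _] := itemsP _ _ GU'.
  apply: (@items_between _ _ _ U B U') => //.
    by apply: (@sub_minlen _ _ x) => //; apply: xmem.
  by apply: (@sub_minlen _ _ x) => //; apply: xmem.
have [x -> xmem] := item_repP GB.
have [U GU [-> leU]] := item_lowP GB; have [U' GU' [-> leU']] := item_highP GB.
have := xmem _ GB; rewrite fam_interval // => /andP[H1 H2].
by rewrite !ltnS H1 H2 leU leU'.
Qed.

Lemma count_item G (a : pred nat) : G \in items B ->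
  count a (rg rk (interval e G).1 (interval e G).2) = \sum_(b in G) a (rank b).
Proof.
move=> GB; have HG := item_interval GB.
have [_ hi] := interval_le e G; rewrite size_e in hi.
have in_range i : (interval e G).1 <= i <
    (interval e G).1 + ((interval e G).2 - (interval e G).1) -> i < nlinks.
  by clear -hi; lia.
have /permP -> : perm_eq (rg rk (interval e G).1 (interval e G).2) [seq rank b | b <- enum G].
  apply: uniq_perm.
  - rewrite map_inj_in_uniq ?iota_uniq // => i j; rewrite !mem_iota => Hi Hj.
    have [b <-] := index_onto (in_range _ Hi).
    have [c <-] := index_onto (in_range _ Hj).
    by rewrite !rk_index => /rank_inj ->.
  - by rewrite (map_inj_uniq rank_inj) enum_uniq.
  move=> r; apply/mapP/mapP => [[i]|[b]].
    rewrite mem_iota => Hi ->; have [b Eb] := index_onto (in_range _ Hi).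
    by exists b; [rewrite mem_enum HG Eb; clear -Hi; lia | rewrite -rk_index Eb].
  rewrite mem_enum HG => /andP[H1 H2] ->; exists (index b e); rewrite ?rk_index //.
  by rewrite mem_iota H1 subnKC // (leq_trans H1 (ltnW H2)).
rewrite count_map -sum1_count big_mkcond /= big_enum /=.
by apply: eq_bigr => b _; case: (a _).
Qed.

(** Every link that crosses [B] lies in exactly one group of [B], that of its [lowlen]. *)
Lemma sum_items (f : link -> nat) :
  \sum_(b in cset B) f b = \sum_(G in items B) \sum_(b in G) f b.
Proof.
rewrite (partition_big (fun b : link => grp B (lowlen key dn (val b))) (mem (items B))) /=.
  apply: eq_bigr => G GB; apply: eq_bigl => b.
  apply/andP/idP => [[bB /eqP <-]|bG]; first by rewrite inE bB eqxx.
  by have [bB ->] := item_mem GB bG.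
by move=> b bB; apply/itemsP; split=> //; exists b.
Qed.

Definition ranking : seq nat := sort geq [seq rank b | b <- enum (cset B)].

(** The list of the region contains all groups of [B]; the other groups in it fail the test and
    leave empty intervals, so every link crossing [B] is counted once. *)
Lemma index_slots : slots_hold rk (slot_lo table (row B) LP LL) (slot_hi table (row B) LP LL) LL ranking.
Proof.
move=> a.
have ilo r : table cILO r = (interval e (item r)).1.
  rewrite tableE_small // /column /=; have [+ _] := interval_le e (item r).
  by rewrite size_e => /leq_trans; apply; apply: nlinks_nrows.
have ihi r : table cIHI r = (interval e (item r)).2.
  rewrite tableE_small // /column /=; have [_ +] := interval_le e (item r).
  by rewrite size_e => /leq_trans; apply; apply: nlinks_nrows.
have -> : count a ranking = \sum_(b in cset B) a (rank b).
  rewrite /ranking; have /permP -> : perm_eq (sort geq [seq rank b | b <- enum (cset B)])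
    [seq rank b | b <- enum (cset B)] by rewrite perm_sort.
  rewrite count_map -sum1_count big_mkcond /= big_enum /=.
  by apply: eq_bigr => b _; case: (a _).
rewrite sum_items.
have [t1 sub _] := reg_ok B.
have sub2 : items B \subset lst (reg B).
  by apply: subset_trans sub; apply: sub_lst mu_parent _.
transitivity (\sum_(G in lst (reg B) | G \in items B) \sum_(b in G) a (rank b) : nat).
  have -> : \sum_(G in lst (reg B) | G \in items B) \sum_(b in G) a (rank b) =
      \sum_(q < LL) if nth set0 (enum (lst (reg B))) q \in items B then
        \sum_(b in nth set0 (enum (lst (reg B))) q) a (rank b) else 0.
    by rewrite -big_enum_cond /= (big_nth set0) -cardE big_mkord big_mkcond.
  apply: eq_bigr => q _; rewrite /slot_lo /slot_hi ltn_ord index_crosses item_list //=.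
  case: ifP => [GB|_]; last by rewrite rg_nil.
  by rewrite ilo ihi item_list // count_item.
apply: eq_bigl => G; case: (boolP (G \in items B)) => GB; rewrite ?andbF ?andbT //.
exact: subsetP GB.
Qed.

End Locus.

Lemma ranking_sorted B : sorted geq (ranking B).
Proof. by apply: sort_sorted => x y; rewrite /geq orbC leq_total. Qed.

Lemma ranking_pos B : all (fun r => 0 < r) (ranking B).
Proof.
rewrite all_sort; apply/allP => r /mapP [b _ ->].
by case/andP: (rank_le b).
Qed.

Lemma list_nonempty B : B \in fam -> 0 < #|lst (reg B)|.
Proof.
move=> fB; have [_ sub _] := reg_ok B.
have [x xB] := set0Pn _ (fam_nonempty fB).
have [Q [EQ _ _]] := fam_string fB xB; rewrite EQ in xB.
have [b bB _] := cset_cover dn xB; rewrite -EQ in bB.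
apply/card_gt0P; exists (grp B (lowlen key dn (val b))); apply: (subsetP sub).
apply: (subsetP (sub_lst _ _ mu_parent _)).
by apply/itemsP; split=> //; exists b.
Qed.

Lemma index_imx r : table cIMX r = mx rk (table cILO r) (table cIHI r) /\
  table cILO r <= nlinks /\ table cIHI r <= nlinks.
Proof.
have MN := nlinks_nrows.
have [H1 H2] := interval_le e (item r); rewrite size_e in H1 H2.
have E1 : table cILO r = (interval e (item r)).1 by rewrite tableE_small // (leq_trans H1).
have E2 : table cIHI r = (interval e (item r)).2 by rewrite tableE_small // (leq_trans H2).
split; last by rewrite E1 E2.
by rewrite E1 E2 tableE_small // /column /= (leq_trans (mx_le_nlinks _ _)).
Qed.

Lemma index_doc b (x : X) : x \in val b -> table cDOC (rank b) = dn x.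
Proof.
move=> xb.
suff E : column cDOC (rank b) = dn x by rewrite tableE E.
rewrite /column /= ranked_rank /rep; case: pickP => [y yb|/(_ x)]; last by rewrite xb.
have [_ _ Eb] := link_high xb.
by move: yb; rewrite Eb inE /key1 prefix_cons => /andP[/eqP].
Qed.

Section Query.
Variables (P : seq nat) (k : nat).
Hypothesis P_words : forall i, nth 0 P i < 2 ^ w.
Hypothesis P_size : size P < 2 ^ w.
Let kk := minn k n.

(** [NT] bounds the number of slots: at most [3 * (p + 1)] list items, since the locus has [minlen]
    at most [p], and one slot for each split. *)
Definition query_time (p k : nat) : nat :=
  let NT := 3 * (p + 1) + k in 1000 + 200 * p + 300 * NT + pop_cost (up_log 2 NT) * k.

Lemma query_spec (en : nat -> nat) (m : nat -> nat -> nat) :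
  holds_index nrows table m -> en vk = k -> en vp = size P ->
  wp w P query (fun st => let: State _ m' o' t' := st in
    [/\ holds_index nrows table m', t' <= query_time (size P) kk &
     (pre key P = set0 /\ o' = [::]) \/
     (pre key P \in fam /\
      o' = [seq table cDOC r | r <- take kk (ranking (pre key P))])])
    (State en m [::] 0).
Proof.
move=> Hm Ek Ep.
have n1 := n_gt1.
have W0 : 1000 * (nrows * nrows) + 1000 <= 2 ^ w by exact: HW.
have adr := cell_small W0.
have nN : 4 < nrows by rewrite /nrows; lia.
have W3 : 2 < 2 ^ w by clear -W0; lia.
have header c : c < 4 -> table cHDR c = nth 0 [:: nrows; n; blk; nblks] c.
  move=> c4; rewrite tableE_small // /column /=.
  have [_ _ s2 _] := block_bounds n1; rewrite -/blk in s2.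
  have ML := nlinks_le; have := leq_div nlinks blk.
  case: c c4 => [|[|[|[|]]]] //= _; rewrite /nblks /nrows; try lia.
have ld c d (Hc : c < 4) (v := nth 0 [:: nrows; n; blk; nblks] c) (a : cmd) e2 t2 (Q2 : state -> Prop) :
    wp w P a Q2 (State (upd e2 d v) m [::] (t2 + 7)) ->
    wp w P (Set_ d (Ld cHDR (K c));; a)%cmd Q2 (State e2 m [::] t2).
  move=> H; apply: (wp_assign (v := v)) => //=.
    have cN : c < nrows by apply: ltn_trans nN.
    by split; [apply: (ltNW W0) | apply: adr].
  by rewrite Hm ?header //; apply: ltn_trans nN.
do 3 (apply ld; first by []).
apply: wp_seq; apply: (descend_spec W0 P_words index_trie) => //.
move=> e1 t1 K1 T1 H1.
apply: wp_seq; apply: (verify_spec W0 index_trie) => //.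
  by rewrite K1.
move=> e2 t2 K2 T2 H2.
case: H2 => [[Eok E0]|[Eok fP Ecur]].
  apply: wp_if => //=; rewrite Eok /=; apply: wp_set => //=; first by clear -W3; lia.
  split=> //; last by left.
  by clear -T1 T2; move: T1 T2; rewrite /query_time /=; lia.
apply: wp_if => //=; rewrite Eok /=.
set B := pre key P in fP Ecur *.
pose LL := #|lst (reg B)|; pose LP := offL (reg B).
have fits := list_fits B; rewrite -/LP -/LL in fits.
have minP : minlen B <= size P.
  have [x xB] := set0Pn _ (fam_nonempty fP).
  by case/andP: (len_bounds (len_pre xB)).
have [_ _ LLb] := reg_ok B; rewrite -/LL in LLb.
pose K := up_log 2 (3 * (size P + 1) + kk).
have NTb : LL + kk <= 3 * (size P + 1) + kk.
  by rewrite leq_add2r; apply: (leq_trans LLb); rewrite addn1 leq_mul2l /= ltnS.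
have K9 x : x < 5 -> 1 < x -> e2 x = nth 0 [:: 0; 0; nrows; n; blk] x.
  move=> x5 x1; rewrite K2 ?K1; try by apply: leq_trans x5 _.
  by case: x x5 x1 => [|[|[|[|[|]]]]].
apply: (@retrieve_spec w P nrows table rk nlinks blk nblks W0 index_rmq rk_lt rk_pos pos_rk
  (row B) LP LL n k K (ranking B)) => //.
- by apply: leq_ltn_trans (row_lt B) _; clear -n1; rewrite /nrows; lia.
- by apply: (leq_trans fits); rewrite /nrows leq_mul2r orbT.
- exact: list_nonempty.
- by clear -fits; rewrite /nrows; lia.
- by move=> q _; case: (index_imx (LP + q)).
- by move=> q _; case: (index_imx (LP + q)).
- exact: index_slots.
- exact: ranking_sorted.
- exact: ranking_pos.
- rewrite -/kk -mul2n expnS leq_mul2l /=; apply: (leq_trans NTb).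
  by case/andP: (up_log2_bounds (3 * (size P + 1) + kk)).
- exact: list_ptr.
- exact: list_len.
- by rewrite K9.
- by rewrite K9.
- by rewrite K9.
- by rewrite K2 // K1.
move=> e3 m3 t3 Hm3 T3; split=> //; last by right.
move: T3 T1 T2; rewrite -/kk /query_time -/K /=.
move: (pop_cost K * kk) => z; clear -NTb; move: LL NTb => LL NTb; lia.
Qed.

End Query.

End Index.

End IndexTable.
Import IndexTable.

(** * Existence of the index and the bound on the query time *)

Module QueryBounds.

(** Scores enter the index only through the order [ord] of all links, the best ones last. *)
Lemma index_exists w n (X : finType) (key : X -> seq nat) (dn : X -> nat)
    (txt : nat -> nat) (tx : X -> nat) (ord : seq (link key dn)) :
  1 < n -> #|X| = n -> 1000 * ((64 * n) * (64 * n)) + 1000 <= 2 ^ w ->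
  (forall x, dn x < 2 ^ w) -> (forall r, txt r < 2 ^ w) ->
  (forall x j, j < size (key x) -> tx x + j < n /\ txt (tx x + j) = nth 0 (key x) j) ->
  (forall x, tx x <= n) -> uniq ord -> ord =i predT ->
  exists A : nat -> nat -> nat, (forall c r, A c r < 2 ^ w) /\
  forall (P : seq nat) (k : nat) (en : nat -> nat) (m : nat -> nat -> nat),
    (forall i, nth 0 P i < 2 ^ w) -> size P < 2 ^ w ->
    holds_index (64 * n) A m -> en vk = k -> en vp = size P ->
    wp w P query (fun st => let: State _ m' o' t' := st in
      [/\ holds_index (64 * n) A m', t' <= query_time (size P) (minn k n) &
       if pre key P == set0 then o' = [::] else
       exists ls : seq (link key dn),
         [/\ uniq ls, ls =i @Links.cset X key dn (pre key P),
             sorted (fun b c => index c ord <= index b ord) ls &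
             forall f : link key dn -> nat, (forall (b : link key dn) x, x \in val b -> f b = dn x) ->
               o' = [seq f b | b <- take (minn k n) ls]]])
      (State en m [::] 0).
Proof.
move=> n1 cX HW dW tW tk tl uo ao.
have w0 : 0 < w by case: (w) HW => //; rewrite expn0; lia.
have [e [ue ae ie]] := interval_order (@key2 X key dn).
have [eX [uX aX iX]] := interval_order key.
have txt_nth x j : nth 0 (key x) j < 2 ^ w.
  have [H|H] := ltnP j (size (key x)); last by rewrite nth_default // expn_gt0.
  by have [_ <-] := tk x j H.
have [D HD] : exists D : {set X} -> dictionary,
    forall B, B \in fam key -> dictionary_for w (Descent.keys key B) (D B).
  apply: (@fin_all_exists _ _ (fun B d => B \in fam key -> dictionary_for w (Descent.keys key B) d)).
  move=> B; have [fB|fB] := boolP (B \in fam key); last first.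
    by exists (Dictionary 0 0 0 0 id id id).
  have [d Hd] : exists d, dictionary_for w (Descent.keys key B) d.
    apply: dictionary_exists => //; first exact: undup_uniq.
      by move=> c; rewrite mem_undup => /mapP [y _ ->].
    have : size (Descent.keys key B) <= 2 * n.
      have H1 := sum_keys key; have H2 := card_fam key; rewrite cX in H2.
      apply: leq_trans (leq_trans H1 H2).
      by rewrite (bigD1 B fB) /= leq_addr.
    move: (size _) => z Hz; have : z ^ 2 <= (2 * n) ^ 2 by rewrite leq_sqr.
    by rewrite -!mulnn; move: HW; clear; nia.
  by exists d.
have [offB [invB aB]] := allocation (bsize key D).
have [offE [invE aE]] := allocation (esize key D).
have [offL [invL aL]] := allocation (lsize key dn).
have [reg Hreg] := fin_all_exists (region (@mu_parent X key) (@minlen_parent X key)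
  (@items_small X key dn)).
exists (table w n txt tx ord e eX D offB offE offL invB invE invL reg); split.
  by move=> c r; apply: table_word.
move=> P k en m Pw Ps Hm Ek Ep.
have := query_spec n1 cX HW tW tk tl uo ao ue ae ie aX uX iX HD aB aE aL Hreg Pw Ps Hm Ek Ep.
apply: wp_mono => -[e' m' o' t'] [Hm' Ht' Hout]; split=> //.
case: Hout => [[-> ->]|[fP ->]]; first by rewrite eqxx.
rewrite (negPf (fam_nonempty fP)).
exists (sort (relpre (rank ord) geq) (enum (@Links.cset X key dn (pre key P)))); split.
- by rewrite sort_uniq enum_uniq.
- by move=> b; rewrite mem_sort mem_enum.
- apply: sort_sorted => b c; rewrite /= /rank; exact: leq_total.
move=> f Hf; rewrite /ranking sort_map -map_take -map_comp; apply: eq_map => b /=.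
have [x xb] := link_nonempty b.
by rewrite (Hf b x xb); apply: index_doc.
Qed.

Lemma lg_sq p : 0 < p -> lg p ^ 2 <= 4 * p.
Proof.
rewrite /lg; case: p => [|[|p]] // _.
have /andP[H _] := @up_log_bounds 2 p.+2 isT isT.
have L0 : 0 < up_log 2 p.+2 by rewrite up_log_gt0.
have sq (m : nat) : m ^ 2 <= 2 ^ m.+1.
  elim: m => // -[|[|[|m]]] IH //; move: IH; rewrite expnS => IH.
  by rewrite [2 ^ _]expnS; move: IH; rewrite -!mulnn; nia.
apply: leq_trans (sq _) _.
have -> : 2 ^ (up_log 2 p.+2).+1 = 4 * 2 ^ (up_log 2 p.+2).-1.
  by rewrite -{1}(prednK L0) !expnS mulnA.
by rewrite leq_mul2l ltnW.
Qed.

Lemma lg_mul a b : lg (a * b) <= lg a + lg b.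
Proof.
rewrite /lg; apply: up_log_min => //; rewrite expnD.
by apply: leq_mul; case/andP: (up_log2_bounds a); case/andP: (up_log2_bounds b).
Qed.

Lemma leq_lg : {homo lg : a b / a <= b}.
Proof.
move=> a b ab; apply: up_log_min => //; apply: (leq_trans ab).
by case/andP: (up_log2_bounds b).
Qed.

(** If [k ^ 2 <= p], then [2 * k * lg p <= k ^ 2 + lg p ^ 2 <= 5 * p]; otherwise
    [lg p <= 2 * lg k]. *)
Lemma mul_lg p k : 0 < p -> k * lg p <= 2 * (k * lg k) + 3 * p.
Proof.
move=> p0; have sq := lg_sq p0.
have [le|lt] := leqP (k ^ 2) p.
  apply: (@leq_trans (3 * p)); last exact: leq_addl.
  have : 2 * (k * lg p) <= k ^ 2 + lg p ^ 2.
    exact: (nat_Cauchy k (lg p)).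
  move: (lg p ^ 2) (k * lg p) (k ^ 2) sq le => x y z; lia.
have : lg p <= lg (k ^ 2) by apply: leq_lg; apply: ltnW.
rewrite -mulnn => /leq_trans /(_ (lg_mul k k)) H.
apply: (@leq_trans (k * (lg k + lg k))); first by rewrite leq_mul2l H orbT.
by rewrite mulnDr; lia.
Qed.

(** As [lg 1 = 0], the case [k = 1] has to be paid by [p]. *)
Lemma leq_mul_lg p k : 0 < p -> k <= p + k * lg k.
Proof.
move=> p0; case: k => [|[|k]] //; first by rewrite (leq_trans p0) ?leq_addr.
have : 0 < lg k.+2 by rewrite /lg up_log_gt0.
by move: (lg _) => z; nia.
Qed.

Lemma query_time_le p k : 0 < p -> query_time p k <= 6 * 1000 * (p + k * lg k).
Proof.
move=> p0; rewrite /query_time /pop_cost.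
have H1 := mul_lg k p0; have H2 := leq_mul_lg k p0.
have HK : k * up_log 2 (3 * (p + 1) + k) <= k * lg p + k * lg k + 3 * k.
  case: (posnP k) => [->|k0]; first by rewrite !mul0n.
  (* The sum is replaced by a product, whose logarithm splits. *)
  have : lg (3 * (p + 1) + k) <= lg (8 * (p * k)).
    by apply: leq_lg; nia.
  have : lg (8 * (p * k)) <= 3 + (lg p + lg k).
    apply: leq_trans (lg_mul _ _) _; apply: leq_add (lg_mul _ _).
    by rewrite /lg (_ : 8 = 2 ^ 3) // up_log2K // ; lia.
  rewrite -/(lg (3 * (p + 1) + k)); move: (lg (3 * _ + _)) (lg (8 * _)) => x y.
  move: (lg p) (lg k) => u v; nia.
move: HK H1 H2; move: (up_log 2 _) => K.
have -> : (1000 + 160 * K.+1) * k = 1160 * k + 160 * (k * K) by clear; nia.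
move=> HK H1 H2.
move: HK H1 H2 p0; move: (k * K) (k * lg p) (k * lg k) => x y z; lia.
Qed.

End QueryBounds.
Import QueryBounds.

(** * Documents, scores and the final bounds *)

Section Documents.
Variables (D : nat) (docs : 'I_D -> seq nat).

(** The end of a document is left out, as a nonempty pattern does not occur there. *)
Definition position : finType := {i : 'I_D & 'I_(size (docs i))}.
Definition doc (x : position) : 'I_D := tag x.
Definition suffix_of (x : position) : seq nat := drop (tagged x) (docs (doc x)).
Definition docs_seq : seq (seq nat) := [seq docs i | i <- enum 'I_D].
Definition text (r : nat) : nat := nth 0 (flatten docs_seq) r.
Definition text_pos (x : position) : nat :=
  flatten_index (shape docs_seq) (doc x) (tagged x).

Lemma card_position : #|position| = total_length docs.
Proof.
rewrite card_tagged /total_length sumnE big_map big_enum /=.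
by apply: eq_bigr => i _; rewrite card_ord.
Qed.

Lemma size_docs_seq : size (flatten docs_seq) = total_length docs.
Proof.
rewrite size_flatten /shape /docs_seq -map_comp sumnE big_map big_enum /=.
exact: eq_bigr.
Qed.

Lemma text_suffix (x : position) j : j < size (suffix_of x) ->
  text_pos x + j < total_length docs /\ text (text_pos x + j) = nth 0 (suffix_of x) j.
Proof.
rewrite size_drop => Hj.
have E : text_pos x + j = flatten_index (shape docs_seq) (doc x) (tagged x + j).
  by rewrite /text_pos /flatten_index addnA.
have nd : nth [::] docs_seq (doc x) = docs (doc x).
  by rewrite (nth_map (doc x)) ?size_enum_ord // nth_ord_enum.
have Hs : tagged x + j < nth 0 (shape docs_seq) (doc x).
  rewrite /shape (nth_map [::]) ?nd; last by rewrite /docs_seq size_map size_enum_ord.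
  by rewrite -ltn_subRL.
split; first by rewrite E -size_docs_seq size_flatten; apply: flatten_indexP.
rewrite /text nth_flatten /= E flatten_indexKl // flatten_indexKr // nd.
by rewrite /suffix_of nth_drop.
Qed.

Lemma text_pos_le (x : position) : text_pos x <= total_length docs.
Proof.
have : 0 < size (suffix_of x) by rewrite size_drop subn_gt0.
by move=> /text_suffix [/ltnW]; rewrite addn0.
Qed.

Lemma text_word w : (forall i, all_words w (docs i)) -> forall r, text r < 2 ^ w.
Proof.
move=> H r; have [lt|ge] := ltnP r (size (flatten docs_seq)); last first.
  by rewrite /text nth_default // expn_gt0.
have /flattenP [d /mapP [i _ ->]] := mem_nth 0 lt; exact: H.
Qed.

Lemma occ_suffix (i : 'I_D) (Q : seq nat) (j : 'I_(size (docs i))) :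
  (widen_ord (leqnSn _) j \in occ (docs i) Q) =
  (Tagged (fun i => 'I_(size (docs i))) j \in pre suffix_of Q).
Proof. by rewrite !inE. Qed.

Lemma occ_nonempty (i : 'I_D) (Q : seq nat) : Q != [::] ->
  reflect (exists2 x, x \in pre suffix_of Q & doc x = i) (i \in containing docs Q).
Proof.
move=> Q0; rewrite inE; apply: (iffP (set0Pn _)) => [[j jQ]|[x xQ <-]].
  have lt : j < size (docs i).
    rewrite ltnNge; apply: contra Q0 => ge; move: jQ.
    by rewrite inE (drop_oversize ge) prefixs0.
  exists (Tagged (fun i => 'I_(size (docs i))) (Ordinal lt)) => //.
  by rewrite -occ_suffix; move: jQ; rewrite !inE.
exists (widen_ord (leqnSn _) (tagged x)); rewrite occ_suffix.
by case: (x) xQ.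
Qed.

Lemma occ_eq (i : 'I_D) (P Q : seq nat) : P != [::] -> Q != [::] ->
  (forall x, doc x = i -> (x \in pre suffix_of P) = (x \in pre suffix_of Q)) ->
  occ (docs i) P = occ (docs i) Q.
Proof.
move=> P0 Q0 H; apply/setP => j; have [lt|ge] := ltnP j (size (docs i)).
  have -> : j = widen_ord (leqnSn _) (Ordinal lt) by apply: val_inj.
  by rewrite !occ_suffix; apply: H.
by rewrite !inE (drop_oversize ge) !prefixs0 (negPf P0) (negPf Q0).
Qed.

End Documents.

Section TopK.
Variables (D : nat) (docs : 'I_D -> seq nat) (disp : Order.disp_t) (T : orderType disp).
Variable score : seq nat -> 'I_D -> T.
Hypothesis score_occ : relevance_score docs score.

Let dn (x : position docs) : nat := doc x.
Let key := @suffix_of D docs.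

Definition link_doc (b : link key dn) : 'I_D := doc (xchoose (link_nonempty b)).
Definition weight (b : link key dn) : T := score (Links.str key dn (val b)) (link_doc b).

Lemma link_docE (b : link key dn) (x : position docs) : x \in val b -> link_doc b = doc x.
Proof.
move=> xb; apply: val_inj; have yb := xchooseP (link_nonempty b).
have [_ _ Eb] := link_high yb.
by move: xb; rewrite Eb inE prefix_cons => /andP[/eqP].
Qed.

Lemma weightE (P : seq nat) (b : link key dn) : P != [::] ->
  b \in @Links.cset _ key dn (pre key P) -> weight b = score P (link_doc b).
Proof.
move=> P0 bP; have [x xb] := link_nonempty b.
have [_ _ Eb] := link_high xb.
have pP : prefix P (Links.str key dn (val b)) by move: bP; rewrite mem_cset_pre => /andP[].
have S0 : Links.str key dn (val b) != [::].
  by apply: contraNneq P0 => E; move: pP; rewrite E prefixs0.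
apply: score_occ; apply: occ_eq => // y Ey.
have := mem_link_cset bP xb; rewrite {1}Eb => /setP /(_ y).
rewrite /pre !inE prefix_cons /dn -(link_docE xb) Ey eqxx /= andbT => ->.
by [].
Qed.

Lemma topk_links (P : seq nat) k (ls : seq (link key dn)) :
  P != [::] -> uniq ls -> ls =i @Links.cset _ key dn (pre key P) ->
  sorted (fun b c => weight c <= weight b)%O ls ->
  is_topk docs score P k [seq val (link_doc b) | b <- take (minn k #|position docs|) ls].
Proof.
move=> P0 ul als sl.
pose ds := [seq link_doc b | b <- ls].
have dsu : uniq ds.
  rewrite map_inj_in_uniq // => b c; rewrite !als => bP cP.
  have [x xb] := link_nonempty b; have [y yc] := link_nonempty c.
  rewrite (link_docE xb) (link_docE yc) => E.
  by apply: (cset_inj bP cP xb yc); rewrite /dn E.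
have ads : ds =i containing docs P.
  move=> i; apply/mapP/(@occ_nonempty D docs i P P0) => [[b]|[x xP <-]].
    rewrite als => bP ->; have [x xb] := link_nonempty b.
    by exists x; rewrite ?(link_docE xb) //; apply: (subsetP (cset_sub bP)).
  have [b bP xb] := cset_cover dn xP.
  by exists b; rewrite ?als // (link_docE xb).
have sds : size ds = #|containing docs P|.
  by rewrite -(card_uniqP dsu); apply: eq_card.
(* Each document containing [P] has a position of its own, so capping [k] at the number of positions
   loses no answer. *)
have dsn : size ds <= #|position docs|.
  rewrite sds; have -> : containing docs P = [set doc x | x in pre key P].
    apply/setP => i; apply/(@occ_nonempty D docs i P P0)/imsetP => [[x xP <-]|[x xP ->]]; by exists x.
  exact: leq_trans (leq_imset_card _ _) (max_card _).
have srt : sorted (fun i j => score P j <= score P i)%O ds.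
  rewrite sorted_map; apply: (sub_in_sorted _ _ sl) => [b c|]; last first.
    by apply/allP => b; apply: idP.
  by rewrite !als => bP cP /=; rewrite -!(weightE P0).
exists (take (minn k #|position docs|) ds); first by rewrite -!map_take -map_comp.
set s := take _ ds; split.
- exact: take_uniq.
- by move=> i /mem_take; rewrite ads.
- by rewrite size_take_min -minnA (minn_idPr dsn) sds.
- exact: take_sorted.
move=> i j iS; rewrite -ads -(cat_take_drop (minn k #|position docs|) ds) mem_cat -/s => /orP[->//|jd] _.
have := srt; rewrite -(cat_take_drop (minn k #|position docs|) ds) -/s.
have tr : transitive (fun i j => score P j <= score P i)%O.
  by move=> y x z /= xy yz; apply: Order.POrderTheory.le_trans yz xy.
by rewrite (sorted_pairwise tr) pairwise_cat => /and3P[/allrelP /(_ i j iS jd)].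
Qed.

End TopK.

Lemma run_compiled w k (P : seq nat) (c : cmd) (M : nat -> nat) (Q : state -> Prop) :
  0 < w -> (forall i, nth 0 P i < 2 ^ w) -> size P < 2 ^ w -> k < 2 ^ w ->
  (forall a, M a < 2 ^ w) -> wfc c ->
  wp w P c Q (State (regs (init P k M)) (fun col r => M (r * ncol + col)) [::] 0) ->
  exists t st, let c' := iter t (step w (Machine.comp c 0) P) (init P k M) in
    [/\ halted (Machine.comp c 0) c', sim w st c', time st = t & Q st].
Proof.
move=> w0 Pw Ps kw Mw wc H.
have S : sim w (State (regs (init P k M)) (fun col r => M (r * ncol + col)) [::] 0)
    (Config 0 (regs (init P k M)) M [::]).
  by split=> // x /=; do 2 (case: ifP => // _); rewrite expn_gt0.
have A0 : at_ (Machine.comp c 0) 0 (Machine.comp c 0) by move=> i _; rewrite add0n.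
have [t [R [M' [o [st [E S' T HQ]]]]]] := wp_sound w0 Pw A0 wc S H.
exists t, st; rewrite /init in E *; rewrite E; split=> //.
by rewrite /halted /= add0n nth_default.
Qed.

Section Layout.
Variables (A : nat -> nat -> nat) (N : nat).
Definition layout : seq nat := mkseq (fun x => A (x %% ncol) (x %/ ncol)) (ncol * N).

Lemma layout_holds (M : nat -> nat) :
  stores layout M -> holds_index N A (fun c r => M (r * ncol + c)).
Proof.
move=> S c r cn rN.
have lt : r * ncol + c < ncol * N by move: cn rN; rewrite /ncol; lia.
rewrite S ?size_mkseq // nth_mkseq // modnMDl modn_small // divnMDl //.
by rewrite divn_small // addn0.
Qed.

Lemma holds_layout (M : nat -> nat) (m : nat -> nat -> nat) :
  (forall c r, c < ncol -> M (r * ncol + c) = m c r) -> holds_index N A m -> stores layout M.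
Proof.
move=> E H x; rewrite size_mkseq => lt; rewrite nth_mkseq //.
by rewrite {1}(divn_eq x ncol) E ?ltn_mod // H ?ltn_mod // ltn_divLR // mulnC.
Qed.

End Layout.

(** [1000 * 64 ^ 2 < 2 ^ 22], and one more bit absorbs the summand 1000; since [lg n >= 1], the
    required [23 + 2 * lg n] bits are available. *)
Lemma word_bound n w : 1 < n -> 40 * lg n <= w ->
  1000 * ((64 * n) * (64 * n)) + 1000 <= 2 ^ w.
Proof.
move=> n1 H; have L0 : 0 < lg n by rewrite /lg up_log_gt0.
have /andP[nL _] := up_log2_bounds n; rewrite -/(lg n) in nL.
have le : 2 ^ (23 + 2 * lg n) <= 2 ^ w by rewrite leq_exp2l //; lia.
apply: leq_trans le; rewrite expnD mul2n -addnn expnD.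
have : n * n <= 2 ^ lg n * 2 ^ lg n by apply: leq_mul.
have -> : 2 ^ 23 = 2 * (1024 * (64 * 64)) by rewrite -[1024]/(2 ^ 10) -[64]/(2 ^ 6) -!expnD -expnS.
have : 4 <= n * n by nia.
rewrite mulnACA; move: (n * n) (_ * 2 ^ lg n) => x y; lia.
Qed.

Theorem theorem3 :
  exists (a : nat) (prog : program), forall b : nat, exists C : nat,
  forall (n w D : nat) (docs : 'I_D -> seq nat)
    (disp : Order.disp_t) (T : orderType disp)
    (score : seq nat -> 'I_D -> T),
    1 < n -> total_length docs = n ->
    a * lg n <= w <= b * lg n ->
    D <= 2 ^ w -> (forall i : 'I_D, all_words w (docs i)) ->
    relevance_score docs score ->
  exists idx : seq nat,
    [/\ all_words w idx,
        size idx * w <= C * (n * lg n) &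
        forall (P : seq nat) (k : nat),
          P != [::] -> size P < 2 ^ w -> all_words w P -> k < 2 ^ w ->
          answers_within w prog idx P k
            (C * (size P + lg (lg n) ^ 2 + k * lg (lg (lg n)) + k * lg k))
            (is_topk docs score P k)].
Proof.
(* The index has [40 * 64 * n] words of at most [b * lg n] bits; [6 * 1000] is the factor of
   [query_time_le]. *)
exists 40, (Machine.comp query 0) => b; exists (40 * 64 * b + 6 * 1000).
move=> n w D docs disp T score n1 tn /andP[aw wb] Dw docw rel.
have HW := word_bound n1 aw.
have w0 : 0 < w by apply: leq_trans aw; rewrite muln_gt0 /lg up_log_gt0.
pose key := @suffix_of D docs; pose dn (x : position docs) : nat := doc x.
pose wt := @weight D docs disp T score.
pose le b c := (wt b <= wt c)%O.
pose ord := sort le (enum {: link key dn}).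
have [] := @index_exists w n (position docs) key dn (text docs) (@text_pos D docs) ord => //.
- by rewrite card_position.
- by move=> x; apply: leq_trans (ltn_ord (doc x)) Dw.
- exact: text_word.
- by move=> x j /text_suffix; rewrite tn.
- by move=> x; rewrite -tn text_pos_le.
- by rewrite sort_uniq enum_uniq.
- by move=> x; rewrite mem_sort mem_enum.
move=> A [Aw HA]; exists (layout A (64 * n)); split.
- by move=> x /mapP [y _ ->].
- by rewrite size_mkseq /ncol; move: wb; clear; nia.
move=> P k P0 Ps Pw kw M Mw Ms.
have Pw' i : nth 0 P i < 2 ^ w.
  have [lt|ge] := ltnP i (size P); last by rewrite nth_default ?expn_gt0.
  exact: Pw (mem_nth 0 lt).
have p0 : 0 < size P by rewrite lt0n size_eq0.
have Hwp := HA P k (regs (init P k M)) (fun c r => M (r * ncol + c)) Pw' Ps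
  (layout_holds Ms) erefl erefl.
have wq : wfc query by vm_compute.
have [t [[e m o t'] [Ht S E [Hm tb Ho]]]] := run_compiled w0 Pw' Ps kw Mw wq Hwp.
exists t; last first.
  move: (iter t _ _) S Ht => c [_ HM Eo _ _] Ht.
  split; [exact: Ht | exact: holds_layout HM Hm | rewrite {}Eo /out].
  have topk ls := @topk_links D docs disp T score rel P k ls P0; rewrite card_position tn in topk.
  (* If [P] does not occur, its locus is empty and no link crosses it, so the empty output fits the
     empty list of links. *)
  case: ifP Ho => [/eqP E0 ->|_ [ls [ul als sl Hls]]].
    apply: (topk [::]) => // B; rewrite E0; apply/esym/negP => /cset_sub sb.
    by have [x /(subsetP sb)] := link_nonempty B; rewrite inE.
  rewrite (Hls (fun b => val (link_doc b))) => [|B x /link_docE -> //].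
  apply: topk => //; apply: sub_sorted sl => B B'.
  have le_tr : transitive le by move=> ? ? ?; apply: Order.POrderTheory.le_trans.
  have le_refl : reflexive le by move=> ?; apply: Order.POrderTheory.lexx.
  apply: (sorted_leq_index le_tr le_refl); rewrite ?mem_sort ?mem_enum //.
  by apply: sort_sorted => ? ?; apply: Order.TotalTheory.le_total.
rewrite -[t]add0n -E; apply: (leq_trans tb); apply: (leq_trans (query_time_le _ p0)).
have H : minn k n * lg (minn k n) <= k * lg k.
  by apply: leq_mul; [|apply: leq_lg]; apply: geq_minl.
move: H; move: (lg (lg n) ^ 2) (k * lg (lg _)) (minn k n * _) (k * lg k) => u v x y H.
by clear -H; nia.
Qed.
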